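(* Every germ of holomorphic foliation on $(\mathbb{C}^2,0)$ of multiplicity at most four that is regular after a single blow-up is homogeneous dicritical. For higher multiplicities the equivalent statement is false: for every integer $m\geq 5$ there is a germ of holomorphic foliation on $(\mathbb{C}^2,0)$ of multiplicity $m$ that is regular after a single blow-up but is not homogeneous dicritical.
   Context: A germ of holomorphic foliation $\mathcal{F}$ on $(\mathbb{C}^2,0)$ is given by a germ of holomorphic 1-form $\omega$ (or a vector field) with at most an isolated zero at $0$; its multiplicity is the order of vanishing of $\omega$ at $0$. Let $E\cong\mathbb{P}^1$ be the exceptional divisor of the blow-up of $0\in\mathbb{C}^2$ and let $\widetilde{\mathcal{F}}$ be the saturated pull-back of $\mathcal{F}$ by the blow-up. $\mathcal{F}$ is regular after a single blow-up if $\widetilde{\mathcal{F}}$ has no singular point on $E$. A radial foliation is one defined by a germ of holomorphic vector field with linear part $x\partial_x+y\partial_y$. For distinct foliations $\mathcal{F}=\{\omega=0\}$ and $\mathcal{G}$ defined by a vector field $X$, $\mathrm{Tang}(\mathcal{F},\mathcal{G})$ is the divisor of zeros of $\omega(X)$. $\mathcal{F}$ is homogeneous dicritical if it is regular after a single blow-up and there exists a radial foliation $\mathcal{G}$ such that $\mathrm{Tang}(\mathcal{F},\mathcal{G})$ is invariant by $\mathcal{F}$ (each irreducible component of its support is a separatrix of $\mathcal{F}$). *)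

(* Defs.v *)
From HB Require Import structures.
From mathcomp Require Import all_boot all_order all_algebra.
From mathcomp Require Import complex.
From mathcomp Require Import all_classical all_reals all_analysis.
Import Order.TTheory GRing.Theory Num.Theory numFieldNormedType.Exports.

Set Implicit Arguments.
Unset Strict Implicit.
Unset Printing Implicit Defensive.

Local Open Scope classical_set_scope.
Local Open Scope ring_scope.

Record fps (R : Type) := Fps { fps_coef :> nat -> R }.

HB.instance Definition _ (R : Type) := gen_eqMixin (fps R).
HB.instance Definition _ (R : Type) := gen_choiceMixin (fps R).

Lemma fpsP (R : Type) (f g : fps R) : (forall i, f i = g i) <-> f = g.
Proof.
split=> [|-> //]; case: f g => [f] [g] /= fg; congr Fps; exact/funext.
Qed.

Section FpsZmod.
Variable R : zmodType.
Implicit Types f g h : fps R.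

Definition fps_add f g := Fps (fun i => f i + g i).
Definition fps_opp f := Fps (fun i => - f i).
Definition fps_zero : fps R := Fps (fun=> 0).

Fact fps_addA : associative fps_add.
Proof. by move=> f g h; apply/fpsP => i /=; rewrite addrA. Qed.
Fact fps_addC : commutative fps_add.
Proof. by move=> f g; apply/fpsP => i /=; rewrite addrC. Qed.
Fact fps_add0 : left_id fps_zero fps_add.
Proof. by move=> f; apply/fpsP => i /=; rewrite add0r. Qed.
Fact fps_addN : left_inverse fps_zero fps_opp fps_add.
Proof. by move=> f; apply/fpsP => i /=; rewrite addNr. Qed.

HB.instance Definition _ := GRing.isZmodule.Build (fps R)
  fps_addA fps_addC fps_add0 fps_addN.

Lemma fpsD f g i : (f + g) i = f i + g i. Proof. by []. Qed.
Lemma fpsN f i : (- f) i = - f i. Proof. by []. Qed.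
Lemma fps0 i : (0 : fps R) i = 0. Proof. by []. Qed.
End FpsZmod.

Section FpsRing.
Variable R : comNzRingType.
Implicit Types f g h : fps R.

Definition fps_one : fps R := Fps (fun i => (i == 0%N)%:R).
Definition fps_mul f g := Fps (fun i => \sum_(j < i.+1) f j * g (i - j)%N).

Fact fps_mulE f g i : fps_mul f g i = \sum_(j < i.+1) f j * g (i - j)%N.
Proof. by []. Qed.

Fact fps_mul_rev f g i : fps_mul f g i = \sum_(j < i.+1) f (i - j)%N * g j.
Proof.
rewrite /= (reindex_inj rev_ord_inj) /=.
by apply: eq_bigr => j _; rewrite (sub_ordK j).
Qed.

Fact fps_mulA : associative fps_mul.
Proof.
move=> f g h; apply/fpsP => i; rewrite fps_mulE fps_mul_rev.
pose coef3 j k := f j * (g (i - j - k)%N * h k).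
transitivity (\sum_(j < i.+1) \sum_(k < i.+1 | (k <= i - j)%N) coef3 j k).
  apply: eq_bigr => j _; rewrite fps_mul_rev big_distrr /=.
  by rewrite (big_ord_narrow_leq (leq_subr _ _)).
rewrite (exchange_big_dep predT) //=; apply: eq_bigr => k _.
transitivity (\sum_(j < i.+1 | (j <= i - k)%N) coef3 j k).
  apply: eq_bigl => j; rewrite -ltnS -(ltnS j) -!subSn ?leq_ord //.
  by rewrite -subn_gt0 -(subn_gt0 j) -!subnDA addnC.
rewrite (big_ord_narrow_leq (leq_subr _ _)) big_distrl /=.
by apply: eq_bigr => j _; rewrite /coef3 -!subnDA addnC mulrA.
Qed.

Fact fps_mulC : commutative fps_mul.
Proof.
move=> f g; apply/fpsP => i; rewrite fps_mul_rev /=.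
by apply: eq_bigr => j _; rewrite mulrC.
Qed.

Fact fps_mul1 : left_id fps_one fps_mul.
Proof.
move=> f; apply/fpsP => i; rewrite /= big_ord_recl subn0 mul1r.
by rewrite big1 ?addr0 // => j _; rewrite mul0r.
Qed.

Fact fps_mulDl : left_distributive fps_mul +%R.
Proof.
move=> f g h; apply/fpsP => i; rewrite fpsD /= -big_split.
by apply: eq_bigr => j _; rewrite mulrDl.
Qed.

Fact fps_one_neq0 : fps_one != 0.
Proof.
by apply/eqP => /fpsP/(_ 0%N) /= /eqP; rewrite oner_eq0.
Qed.

HB.instance Definition _ := GRing.Zmodule_isComNzRing.Build (fps R)
  fps_mulA fps_mulC fps_mul1 fps_mulDl fps_one_neq0.

Lemma fpsM f g i : (f * g) i = \sum_(j < i.+1) f j * g (i - j)%N.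
Proof. by []. Qed.
Lemma fps1E i : (1 : fps R) i = (i == 0%N)%:R. Proof. by []. Qed.
End FpsRing.

(* K[[x, y]] is realised as K[[y]][[x]]: f i j is the coefficient of x^i y^j. *)
Notation "{ 'fps2' K }" := (fps (fps K)) (format "{ 'fps2'  K }").

Section Germs.
Variable K : numFieldType.
Implicit Types f g h T : {fps2 K}.

Definition fps2_of (E : nat -> nat -> K) : {fps2 K} :=
  Fps (fun i => Fps (E i)).
Definition fconst (c : K) : {fps2 K} :=
  fps2_of (fun i j => if (i == 0%N) && (j == 0%N) then c else 0).
Definition varx : {fps2 K} := fps2_of (fun i j => ((i == 1%N) && (j == 0%N))%:R).
Definition vary : {fps2 K} := fps2_of (fun i j => ((i == 0%N) && (j == 1%N))%:R).

Definition dx f : {fps2 K} := fps2_of (fun i j => f i.+1 j *+ i.+1).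
Definition dy f : {fps2 K} := fps2_of (fun i j => f i j.+1 *+ j.+1).

(* f(g1, g2), meaningful when g1 and g2 have no constant term: the terms
   f k l * g1 ^+ k * g2 ^+ l with k > i + j or l > i + j then do not
   contribute to x^i y^j. *)
Definition fcomp f (g1 g2 : {fps2 K}) : {fps2 K} :=
  fps2_of (fun i j => \sum_(k < (i + j).+1) \sum_(l < (i + j).+1)
    f k l * (g1 ^+ k * g2 ^+ l) i j).

(* Cauchy estimates: the convergent series form the ring K{x, y}, which for
   K = C is the ring of germs at 0 of holomorphic functions on C^2. *)
Definition convergent f : Prop :=
  exists M r : K, forall i j, `|f i j| <= M * r ^+ (i + j).

Definition vanishes_at f (x y : K) : Prop :=
  (fun n : nat => \sum_(i < n) \sum_(j < n) f i j * x ^+ i * y ^+ j) @ \oo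
    --> (0 : K).

Definition germ_unit f : Prop := exists2 g, convergent g & f * g = 1.
Definition germ_dvd f g : Prop := exists2 h, convergent h & g = f * h.
Definition germ_irreducible f : Prop :=
  [/\ convergent f, f <> 0, ~ germ_unit f &
      forall g h, convergent g -> convergent h -> f = g * h ->
        germ_unit g \/ germ_unit h].

(* As a 1-form, w stands for w.1 dx + w.2 dy; as a vector field, X stands for
   X.1 d/dx + X.2 d/dy. *)
Definition germ2 : Type := ({fps2 K} * {fps2 K})%type.
Implicit Types w eta X phi : germ2.

Definition isolated_zero w : Prop :=
  exists2 r : K, 0 < r & forall x y : K, `|x| < r -> `|y| < r ->
    (x, y) <> (0, 0) -> ~ (vanishes_at w.1 x y /\ vanishes_at w.2 x y).

(* "At most" an isolated zero: w may be nonzero at the origin. *)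
Definition foliation w : Prop :=
  [/\ convergent w.1, convergent w.2 & isolated_zero w].

Definition nonsingular w : Prop := w.1 0%N 0%N <> 0 \/ w.2 0%N 0%N <> 0.

Definition multiplicity w (m : nat) : Prop :=
  (forall i j, (i + j < m)%N -> w.1 i j = 0 /\ w.2 i j = 0) /\
  (exists i j, (i + j = m)%N /\ (w.1 i j <> 0 \/ w.2 i j <> 0)).

Definition pullback phi w : germ2 :=
  let a := fcomp w.1 phi.1 phi.2 in
  let b := fcomp w.2 phi.1 phi.2 in
  (a * dx phi.1 + b * dx phi.2, a * dy phi.1 + b * dy phi.2).

(* The blow-up in local coordinates (x, y) centred at a point of E, chosen so
   that E = {x = 0}: [chart_fin t] is centred at the point of E given by the
   direction [1 : t], and [chart_inf] at the one given by [0 : 1]. *)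
Definition chart_fin (t : K) : germ2 := (varx, varx * (fconst t + vary)).
Definition chart_inf : germ2 := (varx * vary, varx).

(* The blow-up is biholomorphic off E = {x = 0}, so the saturated pull-back is
   generated by the form with at most an isolated zero which agrees with the
   pulled back form up to a power of the equation of E. *)
Definition saturated_pullback phi w eta : Prop :=
  foliation eta /\
  exists k : nat, pullback phi w = (varx ^+ k * eta.1, varx ^+ k * eta.2).

Definition regular_at phi w : Prop :=
  exists2 eta, saturated_pullback phi w eta & nonsingular eta.

Definition regular_after_blowup w : Prop :=
  (forall t : K, regular_at (chart_fin t) w) /\ regular_at chart_inf w.

Definition radial X : Prop :=
  [/\ convergent X.1, convergent X.2 &
      forall i j, (i + j <= 1)%N ->
        X.1 i j = varx i j /\ X.2 i j = vary i j].

Definition contract w X : {fps2 K} := w.1 * X.1 + w.2 * X.2.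

(* {f = 0} is invariant: f divides the coefficient of w /\ df. *)
Definition separatrix w f : Prop :=
  germ_irreducible f /\ germ_dvd f (w.1 * dy f - w.2 * dx f).

(* The divisor {T = 0} is invariant by w. *)
Definition invariant_divisor w T : Prop :=
  forall f, germ_irreducible f -> germ_dvd f T -> separatrix w f.

(* [contract w X <> 0] says that w and X define distinct foliations. *)
Definition homogeneous_dicritical w : Prop :=
  regular_after_blowup w /\
  exists X, [/\ radial X, contract w X <> 0 &
                invariant_divisor w (contract w X)].

End Germs.

(* Main.v *)
(** Write a foliation of multiplicity [m] as [w = a dx + b dy], with dual vector
    field [v = a d/dy - b d/dx].  It is regular after one blow-up exactly when its
    initial part is [p (x dy - y dx)] with [p] a form of degree [m - 1] that is
    coprime to the part [q] of degree [m + 2] of [x a + y b].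

    In each direction with [p <> 0] the blown-up foliation is transversal to the
    exceptional divisor, so an analytic differential equation yields a smooth
    separatrix.  Let [T] be a product of [m + 2] of them, with initial form [r].
    Since the [2m]-th power of the maximal ideal lies in [(a, b)], the equation
    [T = w(X)] with [X] radial only involves the parts of [T] of degree less than
    [2m].  In degree [m + 2] it reads [r = q + p h] with [h] a cubic form, which
    is all for [m <= 3].  For [m = 4] one condition is left, in degree 7, where
    the quotient by [p], [q] is a line spanned by the Jacobian of [(p, q)]; for
    [h = lam p] it is affine in [lam] with nonzero slope.

    Conversely an invariant [T = w(X)] satisfies [v(T) = g T].  For
    [w = - x^(m-1) y dx + (x^m + y^(m+1) + x^3 y^m) dy] and [m >= 5] the three
    lowest homogeneous parts of this equation are contradictory. *)

Require Import Defs.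
From HB Require Import structures.
From mathcomp Require Import all_boot all_order all_algebra.
From mathcomp Require Import complex.
From mathcomp Require Import all_classical all_reals all_analysis.
From mathcomp Require Import ring zify.
Import Order.TTheory GRing.Theory Num.Theory numFieldNormedType.Exports.

Set Implicit Arguments.
Unset Strict Implicit.
Unset Printing Implicit Defensive.

Local Open Scope classical_set_scope.
Local Open Scope ring_scope.

(** * Formal power series *)

(** Forms [p], [q] of degrees [m - 1] and [m + 2] without common zero are a complete intersection:
    the quotient by them lives in degrees up to its socle degree [2m - 1], which is [m + 2] for
    [m = 3] and 7 for [m = 4]. Up to sign, the slope in [lam] is [1/3 + 1/18]: modulo [(p, q)],
    invariance forces [- lam / 3] times the Jacobian into the second part of [T], whatever the
    separatrices, while the radial field contributes [lam / 18]. In the counterexample [p = x^(m-1)]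
    and [q = y^(m+2)]; its term [x^3 y^m] adds [x^3 y^(m+1)] to [w(X)], which lies outside [(p, q)]
    exactly when [m >= 5]. Irreducible components are reached without unique factorization: a
    separatrix [y = s(x)] is prime because the remainder of [F] on division by [y - s] is
    [F(x, s(x))]. Convergence being a Cauchy estimate, the division, the inverse and the
    differential equation each need a majorant. A form is handled through its value at [x = 1],
    where a factor [x] is invisible; degree bounds and the direction [[0 : 1]] are therefore tracked
    separately. *)

Lemma seq_rec (T : Type) (x0 : T) (Phi : nat -> (nat -> T) -> T) :
  (forall n g h, (forall k, (k < n)%N -> g k = h k) -> Phi n g = Phi n h) ->
  exists h, forall n, h n = Phi n h.
Proof.
(* [s n] lists the first [n] values; past its end the default [x0] is harmless, since [Phi n] only
   reads values below [n]. *)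
move=> Phi_ext; pose s := fix s n :=
  if n is k.+1 then rcons (s k) (Phi k (nth x0 (s k))) else [::].
have sz n : size (s n) = n by elim: n => //= n IHn; rewrite size_rcons IHn.
have sE k n : (k < n)%N -> nth x0 (s n) k = nth x0 (s k.+1) k.
  elim: n => // n IHn; rewrite ltnS leq_eqVlt => /predU1P[-> //|kn].
  by rewrite [s n.+1]/= nth_rcons sz kn IHn.
exists (fun n => nth x0 (s n.+1) n) => n.
rewrite /= nth_rcons sz ltnn eqxx; apply: Phi_ext => k kn; exact: sE.
Qed.

Section FpsGeneric.
Variable R : comNzRingType.
Implicit Types f g h : fps R.

Lemma fps_sum I (r : seq I) (P : pred I) (F : I -> fps R) n :
  (\sum_(i <- r | P i) F i) n = \sum_(i <- r | P i) F i n.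
Proof. by elim/big_rec2: _ => //= i x f _ <-. Qed.

Definition fmono (k : nat) : fps R := Fps (fun i => (i == k)%:R).

Lemma fmonoM k f i : (fmono k * f) i = if (k <= i)%N then f (i - k)%N else 0.
Proof.
rewrite fpsM; case: leqP => ki.
  rewrite (bigD1 (Ordinal (ki : k < i.+1)%N)) //= eqxx mul1r big1 ?addr0 // => j.
  by rewrite -val_eqE /= => /negbTE ->; rewrite mul0r.
apply: big1 => j _ /=; suff -> : (j == k :> nat) = false by rewrite mul0r.
by apply/negbTE; rewrite neq_ltn (leq_ltn_trans _ ki) // -ltnS.
Qed.

Lemma fmono0 : fmono 0 = 1. Proof. exact/fpsP. Qed.

Lemma fmonoD k l : fmono k * fmono l = fmono (k + l).
Proof.
apply/fpsP => i; rewrite fmonoM /=; case: leqP => ki.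
  by rewrite -(eqn_add2l k) subnKC.
suff -> : (i == k + l)%N = false by [].
lia.
Qed.

Lemma fmonoX k n : fmono k ^+ n = fmono (k * n).
Proof.
elim: n => [|n IHn]; first by rewrite expr0 muln0 fmono0.
by rewrite exprS IHn fmonoD mulnS.
Qed.

Lemma fmonoI k f g : fmono k * f = fmono k * g -> f = g.
Proof.
move=> /fpsP fg; apply/fpsP => i; move: (fg (k + i)%N).
by rewrite !fmonoM leq_addr addKn.
Qed.

Lemma fmono_dvd k f : (forall i, (i < k)%N -> f i = 0) ->
  f = fmono k * Fps (fun i => f (i + k)%N).
Proof.
move=> f0; apply/fpsP => i; rewrite fmonoM /=.
by case: leqP => [ki|/f0 //]; rewrite subnK.
Qed.

(** As a predicate on rings, it passes from [K] to [K[[y]]] and then to [K[[y]][[x]]] by two uses of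
    the same lemma. *)
Definition nzd := forall a b : R, a * b = 0 -> a = 0 \/ b = 0.

Lemma fps_lead f g n k : (forall i, (i < n)%N -> f i = 0) ->
  (forall i, (i < k)%N -> g i = 0) ->
  (f * g) (n + k)%N = f n * g k /\ (forall i, (i < n + k)%N -> (f * g) i = 0).
Proof.
move=> fn gk; have E : f * g = fmono (n + k) * (Fps (fun i => f (i + n)%N) * Fps (fun i => g (i + k)%N)).
  by rewrite {1}(fmono_dvd fn) {1}(fmono_dvd gk) mulrACA fmonoD.
split=> [|i ink]; rewrite E fmonoM; last by rewrite leqNgt ink.
by rewrite leqnn subnn fpsM big_ord_recl big_ord0 addr0.
Qed.

Lemma fps_ord f : f <> 0 ->
  exists2 n, f n <> 0 & forall i, (i < n)%N -> f i = 0.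
Proof.
move=> /eqP f0; have [n] : exists n, f n != 0.
  apply/not_existsP => nf; move/eqP: f0; apply; apply/fpsP => i.
  by apply/eqP/negPn/negP; exact: nf.
move=> fn; have exn : exists n, f n != 0 by exists n.
case: (ex_minnP exn) => k /eqP fk kmin; exists k => // i ik.
by apply/eqP/negPn/negP => /kmin; rewrite leqNgt ik.
Qed.

Lemma fps_nzd : nzd -> forall f g, f * g = 0 -> f = 0 \/ g = 0.
Proof.
move=> nz f g fg; have [f0|/fps_ord[n fn fn0]] := pselect (f = 0); first by left.
have [g0|/fps_ord[k gk gk0]] := pselect (g = 0); first by right.
by have [+ _] := fps_lead fn0 gk0; rewrite fg fps0 => /esym /nz[].
Qed.

Lemma fps_unit f c : f 0%N * c = 1 -> exists h, f * h = 1.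
Proof.
move=> fc; pose Phi (n : nat) (h : nat -> R) :=
  c * ((n == 0%N)%:R - \sum_(k < n) f k.+1 * h (n - k.+1)%N).
have [n g h gh|h hE] := @seq_rec R 0 Phi.
  congr (c * (_ - _)); apply: eq_bigr => k _; rewrite gh //.
  by have := ltn_ord k; lia.
exists (Fps h); apply/fpsP => n; rewrite fpsM big_ord_recl /= subn0.
by rewrite (hE n) mulrA fc mul1r addrNK.
Qed.

End FpsGeneric.

Section MapFps.
Variables (R S : comNzRingType) (phi : {rmorphism R -> S}).

Definition map_fps (f : fps R) : fps S := Fps (fun i => phi (f i)).

Fact map_fps_zmod : zmod_morphism map_fps.
Proof. by move=> f g; apply/fpsP => i /=; rewrite rmorphB. Qed.
HB.instance Definition _ :=
  GRing.isZmodMorphism.Build (fps R) (fps S) map_fps map_fps_zmod.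

Fact map_fps_monoid : monoid_morphism map_fps.
Proof.
split; first by apply/fpsP => i /=; rewrite rmorph_nat.
move=> f g; apply/fpsP => i; rewrite fpsM /= rmorph_sum.
by apply: eq_bigr => j _; rewrite rmorphM.
Qed.
HB.instance Definition _ :=
  GRing.isMonoidMorphism.Build (fps R) (fps S) map_fps map_fps_monoid.

End MapFps.

Section ConstFps.
Variable R : comNzRingType.

Definition fps_const (c : R) : fps R := Fps (fun i => if i == 0%N then c else 0).

Fact fps_const_zmod : zmod_morphism fps_const.
Proof. by move=> a b; apply/fpsP => -[|i] /=; rewrite ?subr0. Qed.
HB.instance Definition _ :=
  GRing.isZmodMorphism.Build R (fps R) fps_const fps_const_zmod.

Lemma fps_constM c (f : fps R) i : (fps_const c * f) i = c * f i.
Proof.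
rewrite fpsM big_ord_recl subn0 big1 ?addr0 // => j _.
by rewrite /= mul0r.
Qed.

Fact fps_const_monoid : monoid_morphism fps_const.
Proof.
split; first by apply/fpsP => -[|i].
by move=> a b; apply/fpsP => i; rewrite fps_constM; case: i => [|i] //=; rewrite mulr0.
Qed.
HB.instance Definition _ :=
  GRing.isMonoidMorphism.Build R (fps R) fps_const fps_const_monoid.

Definition fps_of_poly (p : {poly R}) : fps R := Fps (fun i => p`_i).

Fact fps_of_poly_zmod : zmod_morphism fps_of_poly.
Proof. by move=> p q; apply/fpsP => i /=; rewrite coefB. Qed.
HB.instance Definition _ :=
  GRing.isZmodMorphism.Build {poly R} (fps R) fps_of_poly fps_of_poly_zmod.

Fact fps_of_poly_monoid : monoid_morphism fps_of_poly.
Proof.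
split; first by apply/fpsP => i /=; rewrite coef1.
by move=> p q; apply/fpsP => i /=; rewrite coefM.
Qed.
HB.instance Definition _ :=
  GRing.isMonoidMorphism.Build {poly R} (fps R) fps_of_poly fps_of_poly_monoid.

Definition fps_coef0 (f : fps R) : R := f 0%N.

Fact fps_coef0_zmod : zmod_morphism fps_coef0. Proof. by []. Qed.
HB.instance Definition _ :=
  GRing.isZmodMorphism.Build (fps R) R fps_coef0 fps_coef0_zmod.

Fact fps_coef0_monoid : monoid_morphism fps_coef0.
Proof. by split=> // f g; rewrite /fps_coef0 fpsM big_ord_recl big_ord0 addr0. Qed.
HB.instance Definition _ :=
  GRing.isMonoidMorphism.Build (fps R) R fps_coef0 fps_coef0_monoid.

End ConstFps.

(** * Homogeneous parts as a ring morphism *)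

Section Homog.
Variable K : numFieldType.
Implicit Types f g : {fps2 K}.

(* The homogeneous part of degree [d] at [x = 1]: [x^(d-j) y^j] becomes ['X^j]. *)
Definition hpart f : fps {poly K} :=
  Fps (fun d => \poly_(j < d.+1) f (d - j)%N j).

Lemma coef_hpart f d j : (hpart f d)`_j = if (j <= d)%N then f (d - j)%N j else 0.
Proof. by rewrite coef_poly ltnS. Qed.

Lemma hpartE f i j : f i j = (hpart f (i + j)%N)`_j.
Proof. by rewrite coef_hpart leq_addl addnK. Qed.

Lemma size_hpart f d : (size (hpart f d) <= d.+1)%N.
Proof. exact: size_poly. Qed.

Lemma hpart_inj : injective hpart.
Proof.
by move=> f g fg; apply/fpsP => i; apply/fpsP => j; rewrite !hpartE fg.
Qed.

Fact hpart_zmod : zmod_morphism hpart.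
Proof.
move=> f g; apply/fpsP => d; apply/polyP => j.
by rewrite coefB !coef_hpart; case: ifP; rewrite ?subr0.
Qed.
HB.instance Definition _ :=
  GRing.isZmodMorphism.Build {fps2 K} (fps {poly K}) hpart hpart_zmod.

Lemma hpartD f g d : hpart (f + g) d = hpart f d + hpart g d.
Proof. by rewrite raddfD. Qed.

Lemma hpartD_eq f g d p q :
  hpart f d = p -> hpart g d = q -> hpart (f + g) d = p + q.
Proof. by move=> <- <-; exact: hpartD. Qed.

Lemma hpartB f g d : hpart (f - g) d = hpart f d - hpart g d.
Proof. by rewrite raddfB. Qed.

Fact hpart_monoid : monoid_morphism hpart.
Proof.
split.
  apply/fpsP => d; apply/polyP => j; rewrite coef_hpart /=.
  case: leqP => jd.
    by case: d j jd => [|d] [|j] jd //=; rewrite ?coefC ?coef1 ?coef0 //; case: (d.+1 - j.+1)%N.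
  by case: d jd => [|d] jd; rewrite ?coef0 // coef1; case: j jd.
move=> f g; apply/fpsP => d; apply/polyP => j; rewrite coef_hpart fpsM coef_sum.
under [RHS]eq_bigr => e _ do rewrite coefM.
rewrite exchange_big /=; case: leqP => jd; last first.
  symmetry; apply: big1 => l _; apply: big1 => e _; rewrite !coef_hpart.
  case: leqP => le; last by rewrite mul0r.
  case: leqP => je; last by rewrite mulr0.
  have := ltn_ord e; have := ltn_ord l; lia.
rewrite fps_sum.
transitivity (\sum_(k < (d - j).+1) \sum_(l < j.+1) f k l * g (d - j - k)%N (j - l)%N).
  by apply: eq_bigr => k _; exact: fpsM.
rewrite exchange_big /=; apply: eq_bigr => l _.
have lj : (l <= j)%N by rewrite -ltnS.
pose G (e : nat) : K := (hpart f e)`_l * (hpart g (d - e)%N)`_(j - l)%N.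
transitivity (\sum_(e < d.+1) G e); last by [].
(* For fixed [l], only the degrees [e] with [l <= e <= d - j + l] contribute: outside this range one
   of the two exponents of [x] would be negative. *)
rewrite -(big_mkord xpredT G) (@big_cat_nat _ _ _ l) ?leq0n ?(leq_trans lj) ?(leqW jd) //=.
have h1 : (l <= (d - j + l).+1)%N by lia.
have h2 : ((d - j + l).+1 <= d.+1)%N by lia.
rewrite (big_cat_nat h1 h2) /=.
rewrite [X in X + _]big_nat [X in X + _]big1 ?add0r => [|e el]; last first.
  by rewrite /G coef_hpart; case: leqP; rewrite ?mul0r //; lia.
rewrite [X in _ + X]big_nat [X in _ + X]big1 ?addr0 => [|e el]; last first.
  by rewrite /G [X in _ * X]coef_hpart; case: leqP; rewrite ?mulr0 //; lia.
have -> : \sum_(l <= e < (d - j + l).+1) G e = \sum_(0 <= k < (d - j).+1) G (k + l)%N.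
  by rewrite -[X in index_iota X]add0n big_addn subSn ?leq_addl // addnK.
rewrite big_mkord; apply: eq_bigr => k _.
have kd := ltn_ord k; rewrite /G !coef_hpart leq_addl addnK.
have -> : (j - l <= d - (k + l))%N by lia.
by congr (_ * g _ _); lia.
Qed.
HB.instance Definition _ :=
  GRing.isMonoidMorphism.Build {fps2 K} (fps {poly K}) hpart hpart_monoid.

End Homog.

(** * Derivatives and blow-up charts *)

Section Derivations.
Variable R : comNzRingType.
Implicit Types f g : fps R.

Lemma fpsMn f n i : (f *+ n) i = f i *+ n.
Proof. by elim: n => // n IHn; rewrite !mulrS fpsD IHn. Qed.

Definition fder f : fps R := Fps (fun i => f i.+1 *+ i.+1).

Lemma fderM f g : fder (f * g) = fder f * g + f * fder g.
Proof.
apply/fpsP => i; rewrite fpsD; change (fder (f * g) i) with ((f * g) i.+1 *+ i.+1).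
rewrite !fpsM.
transitivity (\sum_(k < i.+2) (f k *+ k * g (i.+1 - k)%N
                               + f k * (g (i.+1 - k)%N *+ (i.+1 - k)))).
  rewrite -sumrMnl; apply: eq_bigr => k _.
  by rewrite mulrnAl mulrnAr -mulrnDr subnKC // -ltnS.
rewrite big_split /= big_ord_recl mulr0n mul0r add0r; congr (_ + _).
rewrite big_ord_recr /= subnn mulr0n mulr0 addr0; apply: eq_bigr => k _ /=.
by rewrite subSn // -ltnS.
Qed.

End Derivations.

Section Chart.
Variable K : numFieldType.
Implicit Types f g : {fps2 K}.

Lemma dxE f : dx f = fder f.
Proof. by apply/fpsP => i; apply/fpsP => j; rewrite /= fpsMn. Qed.

Lemma dyE f i : dy f i = fder (f i). Proof. exact/fpsP. Qed.

Lemma dxM f g : dx (f * g) = dx f * g + f * dx g.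
Proof. by rewrite !dxE fderM. Qed.

Lemma dyM f g : dy (f * g) = dy f * g + f * dy g.
Proof.
apply/fpsP => i; rewrite dyE fpsD !fpsM.
transitivity (\sum_(k < i.+1) fder (f k * g (i - k)%N)).
  apply/fpsP => j /=; rewrite fps_sum fps_sum -sumrMnl.
  exact: eq_bigr.
by rewrite -big_split; apply: eq_bigr => k _; rewrite fderM !dyE.
Qed.

Fact dx_zmod : zmod_morphism (@dx K).
Proof.
move=> f g; apply/fpsP => i; apply/fpsP => j /=.
exact: mulrnBl.
Qed.
HB.instance Definition _ :=
  GRing.isZmodMorphism.Build {fps2 K} {fps2 K} (@dx K) dx_zmod.

Fact dy_zmod : zmod_morphism (@dy K).
Proof.
move=> f g; apply/fpsP => i; apply/fpsP => j /=.
exact: mulrnBl.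
Qed.
HB.instance Definition _ :=
  GRing.isZmodMorphism.Build {fps2 K} {fps2 K} (@dy K) dy_zmod.

Lemma hpart_dy f d : hpart (dy f) d = (hpart f d.+1)^`().
Proof. by apply/polyP => j; rewrite coef_deriv !coef_hpart /= ltnS; case: leqP; rewrite ?mul0rn. Qed.

(** Euler's relation [x f_x = d f - y f_y] read at [x = 1], where the derivative in [x] is not
    directly visible. *)
Lemma hpart_dx f d :
  hpart (dx f) d = hpart f d.+1 *+ d.+1 - 'X * (hpart f d.+1)^`().
Proof.
apply/polyP => j; rewrite coefB coefMn coefXM coef_deriv !coef_hpart /=.
case: j => [|j] /=; first by rewrite subr0 subn0.
rewrite !ltnS; case: (ltngtP j d) => [jd|jd|->]; last by rewrite subrr.
  by rewrite subnSK // subSS -mulrnBr ?ltnS ?(ltnW jd) // subSS.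
by rewrite !mul0rn subrr.
Qed.

Lemma varxE : varx K = fmono (fps K) 1.
Proof. by apply/fpsP => -[|[|i]]; apply/fpsP => j. Qed.

Lemma varyE : vary K = fps_const (fmono K 1).
Proof. by apply/fpsP => -[|i]; apply/fpsP => j. Qed.

Lemma fconstE t : fconst t = fps_const (fps_const t) :> {fps2 K}.
Proof. by apply/fpsP => -[|i]; apply/fpsP => j. Qed.

Lemma fps_of_polyX : fps_of_poly 'X = fmono K 1.
Proof. by apply/fpsP => i /=; rewrite coefX. Qed.

Lemma fps_of_polyC c : fps_of_poly c%:P = fps_const c :> fps K.
Proof. by apply/fpsP => i /=; rewrite coefC. Qed.

(** The substitution [(x, x (t + y))] turns the part of degree [i] into [x^i] times its value at
    [(1, t + y)]. Written this way it is a composite of ring morphisms, which [fcomp] is not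
    visibly. *)
Definition tau (t : K) : {fps2 K} -> {fps2 K} :=
  map_fps (fps_of_poly (R := K) \o comp_poly ('X + t%:P)) \o @hpart K.

HB.instance Definition _ (t : K) :=
  GRing.RMorphism.copy (tau t)
    (map_fps (fps_of_poly (R := K) \o comp_poly ('X + t%:P)) \o @hpart K).

Lemma tauE t f i : tau t f i = fps_of_poly (hpart f i \Po ('X + t%:P)).
Proof. by []. Qed.

Lemma fcomp_fin t f : fcomp f (chart_fin t).1 (chart_fin t).2 = tau t f.
Proof.
apply/fpsP => i; apply/fpsP => j; rewrite tauE.
have cE : fconst t + vary K = fps_const (fps_of_poly ('X + t%:P)).
  by rewrite fconstE varyE rmorphD /= rmorphD /= fps_of_polyX fps_of_polyC addrC.
have E k l : ((chart_fin t).1 ^+ k * (chart_fin t).2 ^+ l) i j =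
    if i == (k + l)%N then (('X + t%:P) ^+ l)`_j else 0.
  have cX (c : fps K) : fps_const c ^+ l = fps_const (c ^+ l) by rewrite rmorphXn.
  have pX (p : {poly K}) : fps_of_poly p ^+ l = fps_of_poly (p ^+ l) by rewrite rmorphXn.
  rewrite [(chart_fin t).1]/= [(chart_fin t).2]/= cE varxE exprMn cX pX mulrA.
  rewrite !fmonoX !mul1n fmonoD fmonoM.
  case: ltngtP => //= [ki|->]; last by rewrite subnn.
  by rewrite -[(i - _)%N]prednK ?subn_gt0.
transitivity (\sum_(k < (i + j).+1) \sum_(l < (i + j).+1)
    f k l * if i == (k + l)%N then (('X + t%:P) ^+ l)`_j else 0).
  by apply: eq_bigr => k _; apply: eq_bigr => l _; rewrite -E.
transitivity (\sum_(l < i.+1) (f (i - l)%N l *: 'X^l \Po ('X + t%:P))`_j); last first.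
  by rewrite /= poly_def raddf_sum coef_sum.
rewrite exchange_big /=.
rewrite (big_ord_widen (i + j).+1
  (fun l => (f (i - l)%N l *: 'X^l \Po ('X + t%:P))`_j)) ?ltnS ?leq_addr //.
rewrite [RHS]big_mkcond /=; apply: eq_bigr => l _; rewrite ltnS.
case: leqP => li.
  have kl : (i - l < (i + j).+1)%N by lia.
  rewrite (bigD1 (Ordinal kl)) //= subnK // eqxx big1 ?addr0.
    by rewrite comp_polyZ coefZ comp_Xn_poly.
  move=> k; rewrite -val_eqE /= => /eqP kil.
  by case: eqP; rewrite ?mulr0 //; lia.
by apply: big1 => k _; case: eqP; rewrite ?mulr0 //; lia.
Qed.

Lemma hpart_varx : hpart (varx K) = fmono {poly K} 1.
Proof.
apply/fpsP => d; apply/polyP => j; rewrite coef_hpart /=.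
case: d => [|[|d]]; case: j => [|[|j]] //=; rewrite ?coef0 ?coef1 //=.
- by rewrite andbF.
- by case: ifP => //; rewrite andbF.
Qed.

Lemma hpart_vary : hpart (vary K) = fps_const 'X * fmono {poly K} 1.
Proof.
apply/fpsP => d; apply/polyP => j; rewrite coef_hpart fps_constM /=.
case: d => [|[|d]]; case: j => [|[|j]] //=; rewrite ?mulr0 ?mulr1 ?coef0 ?coefX //=.
by case: ifP => //; case: (_ - _)%N => [|[]].
Qed.

Lemma map_fps_fmono (R S : comNzRingType) (phi : {rmorphism R -> S}) k :
  map_fps phi (fmono R k) = fmono S k.
Proof. by apply/fpsP => i /=; rewrite rmorph_nat. Qed.

Lemma map_fps_const (R S : comNzRingType) (phi : {rmorphism R -> S}) c :
  map_fps phi (fps_const c) = fps_const (phi c).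
Proof. by apply/fpsP => -[|i] //=; rewrite rmorph0. Qed.

Lemma tau_varx t : tau t (varx K) = varx K.
Proof. by rewrite /tau [LHS]/= hpart_varx map_fps_fmono varxE. Qed.

Lemma chart_fin_direction t :
  fconst t + vary K = fps_const (fps_of_poly ('X + t%:P)).
Proof. by rewrite fconstE varyE rmorphD /= rmorphD /= fps_of_polyX fps_of_polyC addrC. Qed.

Lemma tau_vary t : tau t (vary K) = varx K * (fconst t + vary K).
Proof.
rewrite chart_fin_direction /tau [LHS]/= hpart_vary rmorphM /= map_fps_fmono.
by rewrite map_fps_const /= comp_polyX varxE mulrC.
Qed.

Lemma dx_fps_const (c : fps K) : dx (fps_const c) = 0.
Proof. by apply/fpsP => i; apply/fpsP => j /=; rewrite mul0rn. Qed.

Lemma dx_varx : dx (varx K) = 1.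
Proof. by apply/fpsP => -[|[|i]]; apply/fpsP => -[|j] /=; rewrite ?mul0rn. Qed.

Lemma dy_varx : dy (varx K) = 0.
Proof. by apply/fpsP => -[|[|i]]; apply/fpsP => -[|j] /=; rewrite ?mul0rn. Qed.

Lemma dx_vary : dx (vary K) = 0.
Proof. by rewrite varyE dx_fps_const. Qed.

Lemma dy_vary : dy (vary K) = 1.
Proof. by apply/fpsP => -[|[|i]]; apply/fpsP => -[|j] /=; rewrite ?mul0rn. Qed.

Lemma dy_fconst (c : K) : dy (fconst c) = 0.
Proof. by apply/fpsP => -[|i]; apply/fpsP => -[|j] /=; rewrite ?mul0rn. Qed.

Lemma pullback_fin t (w : germ2 K) : pullback (chart_fin t) w =
  (tau t w.1 + tau t w.2 * (fconst t + vary K), tau t w.2 * varx K).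
Proof.
rewrite /pullback !fcomp_fin [(chart_fin t).1]/= [(chart_fin t).2]/=.
rewrite dxM dyM dx_varx dy_varx chart_fin_direction dx_fps_const.
rewrite -chart_fin_direction [dy (_ + _)]raddfD /= dy_fconst dy_vary.
by rewrite !mul0r !mulr0 !mulr1 mul1r !add0r addr0 mulr1.
Qed.

Definition swap f : {fps2 K} := fps2_of (fun i j => f j i).

Lemma swapK : involutive swap.
Proof. by move=> f; apply/fpsP => i; apply/fpsP. Qed.

Fact swap_zmod : zmod_morphism swap.
Proof. by move=> f g; apply/fpsP => i; apply/fpsP. Qed.
HB.instance Definition _ :=
  GRing.isZmodMorphism.Build {fps2 K} {fps2 K} swap swap_zmod.

Fact swap_monoid : monoid_morphism swap.
Proof.
split; first by apply/fpsP => -[|i]; apply/fpsP => -[|j].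
move=> f g; apply/fpsP => i; apply/fpsP => j.
change ((f * g) j i = (swap f * swap g) i j).
rewrite !fpsM !fps_sum.
transitivity (\sum_(k < j.+1) \sum_(l < i.+1) f k l * g (j - k)%N (i - l)%N).
  by apply: eq_bigr => k _; exact: fpsM.
rewrite exchange_big; apply: eq_bigr => l _; exact/esym/fpsM.
Qed.
HB.instance Definition _ :=
  GRing.isMonoidMorphism.Build {fps2 K} {fps2 K} swap swap_monoid.

Lemma swap_dx f : swap (dx f) = dy (swap f). Proof. exact/fpsP. Qed.
Lemma swap_dy f : swap (dy f) = dx (swap f). Proof. exact/fpsP. Qed.
Lemma swap_varx : swap (varx K) = vary K.
Proof. by apply/fpsP => i; apply/fpsP => j /=; rewrite andbC. Qed.
Lemma swap_vary : swap (vary K) = varx K.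
Proof. by rewrite -swap_varx swapK. Qed.

Lemma coef_hpart_swap f d j : (j <= d)%N ->
  (hpart (swap f) d)`_j = (hpart f d)`_(d - j)%N.
Proof. by move=> jd; rewrite !coef_hpart jd leq_subr subKn. Qed.

Definition swapg (w : germ2 K) : germ2 K := (swap w.2, swap w.1).

Lemma fcomp_inf f :
  fcomp f (chart_inf K).1 (chart_inf K).2 = tau 0 (swap f).
Proof.
rewrite -fcomp_fin; apply/fpsP => i; apply/fpsP => j.
have f0 : fconst 0 = 0 :> {fps2 K}.
  by apply/fpsP => k; apply/fpsP => l /=; case: ifP.
pose F k l := f k l * ((varx K * vary K) ^+ k * varx K ^+ l) i j.
transitivity (\sum_(k < (i + j).+1) \sum_(l < (i + j).+1) F k l); first by [].
rewrite exchange_big; apply: eq_bigr => k _; apply: eq_bigr => l _.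
by rewrite /F [_ ^+ l * _]mulrC [(chart_fin 0).2]/= f0 add0r.
Qed.

(** Exchanging the coordinates carries the point [[0 : 1]] of the exceptional divisor to [[1 : 0]],
    so that the finite charts suffice. *)
Lemma pullback_inf (w : germ2 K) :
  pullback (chart_inf K) w = pullback (chart_fin 0) (swapg w).
Proof.
rewrite pullback_fin /pullback !fcomp_inf [(chart_inf K).1]/= [(chart_inf K).2]/=.
rewrite dxM dyM dx_varx dy_varx dx_vary dy_vary [(swapg w).1]/= [(swapg w).2]/=.
have -> : fconst 0 = 0 :> {fps2 K}.
  by apply/fpsP => k; apply/fpsP => l /=; case: ifP.
rewrite !mulr0 !mul0r !mulr1 mul1r add0r !addr0; congr (_, _).
by rewrite addrC add0r.
Qed.

Lemma regular_at_inf (w : germ2 K) :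
  regular_at (chart_inf K) w <-> regular_at (chart_fin 0) (swapg w).
Proof. by rewrite /regular_at /saturated_pullback pullback_inf. Qed.

End Chart.

(** * Convergent series *)

Section Convergence.
Variable K : numFieldType.
Implicit Types f g : {fps2 K}.

Lemma convergent_pos f : convergent f -> exists M r : K,
  [/\ 0 < M, 1 <= r & forall i j, `|f i j| <= M * r ^+ (i + j)].
Proof.
move=> [M [r fM]]; exists (`|M| + 1), (`|r| + 1); split.
- by rewrite ltr_wpDl.
- by rewrite lerDr.
move=> i j; apply: le_trans (fM i j) _; apply: le_trans (_ : `|M| * `|r| ^+ (i + j) <= _).
  rewrite -normrX -normrM ger0_norm //; exact: le_trans (fM i j).
by apply: ler_pM => //; rewrite ?exprn_ge0 ?lerDl // lerXn2r ?nnegrE ?addr_ge0 // lerDl.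
Qed.

Lemma convergent_common f g : convergent f -> convergent g -> exists M r : K,
  [/\ 0 < M, 1 <= r, forall i j, `|f i j| <= M * r ^+ (i + j)
    & forall i j, `|g i j| <= M * r ^+ (i + j)].
Proof.
move=> /convergent_pos[M [r [M0 r1 fM]]] /convergent_pos[N [s [N0 s1 gN]]].
have r0 : 0 <= r by apply: le_trans r1.
have s0 : 0 <= s by apply: le_trans s1.
exists (M + N), (r + s); split; first exact: addr_gt0.
- by apply: le_trans r1 _; rewrite lerDl.
- move=> i j; apply: le_trans (fM i j) _.
  by rewrite ler_pM ?exprn_ge0 ?(ltW M0) ?lerDl ?(ltW N0) // lerXn2r ?nnegrE ?addr_ge0 ?lerDl.
- move=> i j; apply: le_trans (gN i j) _.
  by rewrite ler_pM ?exprn_ge0 ?(ltW N0) ?lerDr ?(ltW M0) // lerXn2r ?nnegrE ?addr_ge0 ?lerDr.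
Qed.

Lemma convergent_rates f (C a b : K) : 0 <= a -> 0 <= b ->
  (forall i j, `|f i j| <= C * (a ^+ i * b ^+ j)) -> convergent f.
Proof.
move=> a0 b0 fC; have C0 : 0 <= C.
  by have := le_trans (normr_ge0 _) (fC 0%N 0%N); rewrite !expr0 !mulr1.
exists C, (a + b) => i j; apply: le_trans (fC i j) _.
rewrite exprD ler_wpM2l // ler_pM ?exprn_ge0 //.
  by rewrite lerXn2r ?nnegrE ?addr_ge0 ?lerDl.
by rewrite lerXn2r ?nnegrE ?addr_ge0 ?lerDr.
Qed.

Lemma convergentD f g : convergent f -> convergent g -> convergent (f + g).
Proof.
move=> cf cg; have [M [r [_ _ fM gM]]] := convergent_common cf cg.
exists (M + M), r => i j; rewrite mulrDl; apply: le_trans (ler_normD _ _) _.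
exact: lerD.
Qed.

Lemma convergentN f : convergent f -> convergent (- f).
Proof. by move=> [M [r fM]]; exists M, r => i j; rewrite /= normrN. Qed.

Lemma convergentB f g : convergent f -> convergent g -> convergent (f - g).
Proof. by move=> cf /convergentN; exact: convergentD. Qed.

Lemma ler_natX2 n : n.+1%:R <= 2 ^+ n :> K.
Proof. by rewrite -natrX ler_nat ltn_expl. Qed.

Lemma convergentM f g : convergent f -> convergent g -> convergent (f * g).
Proof.
move=> cf cg; have [M [r [M0 r1 fM gM]]] := convergent_common cf cg.
have r0 : 0 <= r by apply: le_trans r1.
apply: (@convergent_rates _ (M * M) (2 * r) (2 * r)); rewrite ?mulr_ge0 // => i j.
rewrite fpsM fps_sum; apply: le_trans (ler_norm_sum _ _ _) _.
(* The number of terms, [(i + 1) (j + 1)], is absorbed by doubling the rate. *)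
have E : \sum_(k < i.+1) \sum_(l < j.+1) (M * M * r ^+ (i + j)) <=
    M * M * ((2 * r) ^+ i * (2 * r) ^+ j).
  rewrite !sumr_const !card_ord -!mulrnA -[_ *+ (_ * _)]mulr_natr.
  rewrite -[leLHS]mulrA ler_pM2l ?mulr_gt0 //.
  rewrite -exprD exprMn mulrC ler_wpM2r ?exprn_ge0 // mulnC natrM exprD.
  by rewrite ler_pM ?ler_natX2.
apply: le_trans E; apply: ler_sum => k _.
have -> : (f k * g (i - k)%N) j = \sum_(l < j.+1) f k l * g (i - k)%N (j - l)%N.
  exact: fpsM.
apply: le_trans (ler_norm_sum _ _ _) _; apply: ler_sum => l _; rewrite normrM.
have ki := leq_ord k; have lj := leq_ord l.
have -> : (i + j = (k + l) + ((i - k) + (j - l)))%N by lia.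
by rewrite exprD mulrACA ler_pM.
Qed.

Lemma convergent_fin f n : (forall i j, (n <= i + j)%N -> f i j = 0) ->
  convergent f.
Proof.
move=> fn; exists (\sum_(i < n) \sum_(j < n) `|f i j|), 1 => i j.
rewrite expr1n mulr1; case: (leqP n (i + j)) => [/fn ->|ij].
  by rewrite normr0 sumr_ge0 // => k _; rewrite sumr_ge0.
have ni : (i < n)%N by lia. have nj : (j < n)%N by lia.
rewrite (bigD1 (Ordinal ni)) //= (bigD1 (Ordinal nj)) //= -addrA lerDl addr_ge0 //.
  by rewrite sumr_ge0.
by rewrite sumr_ge0 // => k _; rewrite sumr_ge0.
Qed.

Lemma convergent_fconst (c : K) : convergent (fconst c).
Proof. by apply: (@convergent_fin _ 1) => -[|i] [|j]. Qed.

Lemma convergent0 : convergent (0 : {fps2 K}).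
Proof. exact: (@convergent_fin _ 0). Qed.

Lemma convergent1 : convergent (1 : {fps2 K}).
Proof. by apply: (@convergent_fin _ 1) => -[|i] [|j]. Qed.

Lemma convergent_varx : convergent (varx K).
Proof. by apply: (@convergent_fin _ 2) => -[|[|i]] [|[|j]]. Qed.

Lemma convergent_vary : convergent (vary K).
Proof. by apply: (@convergent_fin _ 2) => -[|[|i]] [|[|j]]. Qed.

Lemma convergentX f n : convergent f -> convergent (f ^+ n).
Proof.
move=> cf; elim: n => [|n IHn]; first exact: convergent1.
by rewrite exprS; apply: convergentM.
Qed.

Lemma convergent_sum I (r : seq I) (P : pred I) (F : I -> {fps2 K}) :
  (forall i, P i -> convergent (F i)) -> convergent (\sum_(i <- r | P i) F i).
Proof. by move=> cF; apply: big_ind => //; [exact: convergent0|exact: convergentD]. Qed.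

Lemma convergent_prod I (r : seq I) (P : pred I) (F : I -> {fps2 K}) :
  (forall i, P i -> convergent (F i)) -> convergent (\prod_(i <- r | P i) F i).
Proof. by move=> cF; apply: big_ind => //; [exact: convergent1|exact: convergentM]. Qed.

Lemma convergent_swap f : convergent f -> convergent (swap f).
Proof. by move=> [M [r fM]]; exists M, r => i j; rewrite /= addnC. Qed.

Lemma convergent_dx f : convergent f -> convergent (dx f).
Proof.
move=> /convergent_pos[M [r [M0 r1 fM]]]; have r0 : 0 <= r by apply: le_trans r1.
exists (M * r), (2 * r) => i j; rewrite /= normrMn -[leLHS]mulr_natr.
apply: le_trans (ler_wpM2r (ler0n _ _) (fM _ _)) _.
rewrite addSn exprS exprMn mulrA -[leLHS]mulrA ler_wpM2l ?mulr_ge0 // ?(ltW M0) //.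
rewrite mulrC ler_wpM2r ?exprn_ge0 //; apply: le_trans (ler_natX2 _) _.
by rewrite ler_weXn2l ?leq_addr // ler1n.
Qed.

Lemma convergent_dy f : convergent f -> convergent (dy f).
Proof.
by move=> cf; rewrite -[f]swapK -swap_dx; do !apply: convergent_swap; apply/convergent_dx/convergent_swap.
Qed.

(** Because the two ratios [S] and [2 S] differ, the convolution costs a factor 2 instead of
    [i + 1]; inductive bounds can therefore close up. At [S = 1/2] it is the geometric sum. *)
Lemma geom_conv (S : K) i :
  \sum_(k < i.+1) S ^+ k * (2 * S) ^+ (i - k) = 2 * (2 * S) ^+ i - S ^+ i.
Proof.
elim: i => [|i IHi]; first by rewrite big_ord_recl big_ord0 subn0 !expr0; ring.
rewrite big_ord_recr /= subnn mulr1.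
under eq_bigr => k _ do rewrite subSn ?leq_ord // exprS mulrCA.
by rewrite -mulr_sumr IHi !exprS; ring.
Qed.

Lemma convergent_inv f : convergent f -> f 0%N 0%N <> 0 ->
  exists2 g, convergent g & f * g = 1.
Proof.
move=> cf /eqP f0; have [c0 fc0] : exists c0, f 0%N * c0 = 1.
  by apply: (@fps_unit _ _ (f 0%N 0%N)^-1); rewrite divff.
have [g fg] := fps_unit fc0; exists g => //.
pose h := f - fconst (f 0%N 0%N).
have /convergent_pos[M [r [M0 r1 hM]]] : convergent h.
  by apply: convergentB => //; apply: convergent_fconst.
have r0 : 0 < r by apply: lt_le_trans r1.
pose c : K := `|(f 0%N 0%N)^-1|; have c0' : 0 < c by rewrite normr_gt0 invr_neq0.
(* As [h] has no constant term, raising its rate from [r] to [S] lowers its constant to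
   [e = M / (1 + 8 M c)], so that [8 c e <= 1]. The 8 comes from the bound [2 c] on [g] and a factor
   2 from the convolution in each variable. *)
pose S := r * (1 + 8 * M * c).
have A0 : 0 < 8 * M * c by rewrite !mulr_gt0.
have A1 : 1 <= 1 + 8 * M * c by rewrite lerDl ltW.
have A2 : 0 < 1 + 8 * M * c by apply: lt_le_trans A1.
have S0 : 0 < S by rewrite mulr_gt0.
have S0' : 0 <= S by exact: ltW.
have S20 : 0 <= 2 * S by rewrite mulr_ge0.
have c0'' : 0 <= c by exact: ltW.
have hS k l : `|h k l| <= M / (1 + 8 * M * c) * S ^+ (k + l).
  case kl : (k + l)%N => [|n].
    move/eqP: kl; rewrite addn_eq0 => /andP[/eqP -> /eqP ->].
    by rewrite /h fpsD fpsD /= subrr normr0 mulr1 divr_ge0 // ltW.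
  apply: le_trans (hM _ _) _; rewrite kl -mulrA ler_pM2l // exprMn.
  rewrite mulrCA -[leLHS]mulr1 ler_wpM2l ?exprn_ge0 ?(ltW r0) //.
  rewrite exprS mulKf; last by rewrite gt_eqF.
  exact: exprn_ege1.
have gE i j : g i j = (f 0%N 0%N)^-1 * ((1 : {fps2 K}) i j - (h * g) i j).
  have -> : 1 = fconst (f 0%N 0%N) * g + h * g by rewrite -mulrDl addrC subrK fg.
  rewrite !fpsD addrK fconstE fps_constM fps_constM mulrA mulVf ?mul1r //.
have h00 : h 0%N 0%N = 0 by rewrite /h fpsD fpsD /= subrr.
apply: (@convergent_rates _ (2 * c) (2 * S) (2 * S))=> // i j.
move En : (i + j)%N => n; elim/ltn_ind: n i j En => n IHn i j En.
rewrite gE normrM -/c [2 * c]mulrC -!mulrA ler_pM2l //.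
apply: le_trans (ler_normB _ _) _.
have R1 : 1 <= (2 * S) ^+ i * (2 * S) ^+ j.
  rewrite -exprD exprn_ege1 // mulr_ege1 ?ler1n //.
  by rewrite mulr_ege1.
have -> : 2 * ((2 * S) ^+ i * (2 * S) ^+ j) = (2 * S) ^+ i * (2 * S) ^+ j + (2 * S) ^+ i * (2 * S) ^+ j.
  by ring.
apply: lerD.
  apply: le_trans R1; rewrite fps1E; case: (i == 0%N); rewrite ?fps1E ?fps0 ?normr0 ?ler01 //.
  by case: (j == 0%N); rewrite ?normr1 ?normr0 ?ler01.
rewrite fpsM fps_sum; apply: le_trans (ler_norm_sum _ _ _) _.
pose e := M / (1 + 8 * M * c).
have e0 : 0 <= e by rewrite divr_ge0 // ltW.
have bound (k : 'I_i.+1) : `|(h k * g (i - k)%N) j| <=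
    2 * c * e * (S ^+ k * (2 * S) ^+ (i - k)) * (2 * (2 * S) ^+ j).
  have -> : (h k * g (i - k)%N) j = \sum_(l < j.+1) h k l * g (i - k)%N (j - l)%N.
    exact: fpsM.
  apply: le_trans (ler_norm_sum _ _ _) _.
  apply: le_trans (_ : \sum_(l < j.+1) 2 * c * e * (S ^+ k * (2 * S) ^+ (i - k)) *
      (S ^+ l * (2 * S) ^+ (j - l)) <= _); last first.
    rewrite -mulr_sumr; apply: ler_wpM2l; first by do ?[exact|apply: mulr_ge0|apply: exprn_ge0].
    by rewrite geom_conv gerBl exprn_ge0.
  apply: ler_sum => l _; rewrite normrM.
  have ki := leq_ord k; have lj := leq_ord l.
  case kl : (k + l)%N => [|p].
    move/eqP: kl; rewrite addn_eq0 => /andP[/eqP -> /eqP ->].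
    by rewrite h00 normr0 mul0r; do ?[exact|apply: mulr_ge0|apply: exprn_ge0].
  have lt_n : (i - k + (j - l) < n)%N by clear -ki lj kl En; lia.
  have gb := IHn _ lt_n (i - k)%N (j - l)%N erefl.
  apply: le_trans (ler_pM _ _ (hS k l) gb) _ => //.
  by rewrite -/e exprD le_eqVlt; apply/orP; left; apply/eqP; ring.
apply: le_trans (ler_sum _ (fun k _ => bound k)) _.
rewrite -mulr_suml -mulr_sumr geom_conv.
have ec : 8 * c * e <= 1.
  rewrite /e mulrA ler_pdivrMr // mul1r.
  by rewrite mulrAC lerDr.
have E1 : 2 * c * e * (2 * (2 * S) ^+ i - S ^+ i) <= 2 * c * e * (2 * (2 * S) ^+ i).
  apply: ler_wpM2l; first by do ?[exact|apply: mulr_ge0].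
  by rewrite gerBl exprn_ge0.
apply: le_trans (ler_wpM2r _ E1) _; first by do ?[exact|apply: mulr_ge0|apply: exprn_ge0].
have -> : 2 * c * e * (2 * (2 * S) ^+ i) * (2 * (2 * S) ^+ j) =
  8 * c * e * ((2 * S) ^+ i * (2 * S) ^+ j) by ring.
by rewrite ler_piMl // mulr_ge0 ?exprn_ge0.
Qed.

End Convergence.

(** * Division by [y - s(x)] and analytic differential equations *)

Section Majorants.
Variable K : numFieldType.

Lemma sum_shift (H : nat -> K) k n :
  \sum_(i < n) (if (k <= i)%N then H (i - k)%N else 0) = \sum_(j < n - k) H j.
Proof.
elim: n => [|n IHn]; first by rewrite !big_ord0.
rewrite big_ord_recr IHn /=; case: leqP => kn; first by rewrite subSn // big_ord_recr.
by rewrite (eqP kn) addr0 (eqP (ltnW kn)).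
Qed.

Lemma ler_sum_widen (H : nat -> K) m n : (forall j, 0 <= H j) -> (m <= n)%N ->
  \sum_(j < m) H j <= \sum_(j < n) H j.
Proof.
move=> H0 mn; rewrite (big_ord_widen n H mn) big_mkcond /=.
by apply: ler_sum => j _; case: ifP.
Qed.

(** The shift by one in [d (i - k.+1)] produces the factor [rho], whose smallness controls the
    product of the partial sums. *)
Lemma ler_sum_conv (x d : nat -> K) (rho : K) n : 0 <= rho ->
  (forall i, 0 <= x i) -> (forall i, 0 <= d i) ->
  \sum_(i < n.+1) (\sum_(k < i) x k * d (i - k.+1)%N) * rho ^+ i <=
  rho * ((\sum_(k < n) x k * rho ^+ k) * (\sum_(i < n) d i * rho ^+ i)).
Proof.
move=> rho0 x0 d0; rewrite big_ord_recl big_ord0 mul0r add0r mulr_suml mulr_sumr.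
pose H k (i : nat) := d i * rho ^+ i * (rho * (x k * rho ^+ k)).
apply: le_trans (_ : \sum_(k < n) \sum_(i < n)
    (if (k <= i)%N then H k (i - k)%N else 0) <= _); last first.
  apply: ler_sum => k _; rewrite sum_shift mulrA mulr_sumr.
  under [leRHS]eq_bigr => i _ do rewrite mulrC.
  apply: (@ler_sum_widen (H k)); last exact: leq_subr.
  by move=> j; rewrite /H !mulr_ge0 ?exprn_ge0.
rewrite exchange_big; apply: ler_sum => i _ /=.
rewrite mulr_suml (big_ord_widen n (fun k => x k * d (i.+1 - k.+1)%N * rho ^+ i.+1)) //.
rewrite big_mkcond; apply: ler_sum => k _; rewrite ltnS; case: leqP => // ki.
have E : rho ^+ i = rho ^+ (i - k) * rho ^+ k by rewrite -exprD subnK.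
rewrite /H subSS exprS E le_eqVlt; apply/orP; left; apply/eqP; ring.
Qed.

End Majorants.

Notation xser := (map_fps (fps_const (R := _))).

Section Division.
Variable K : numFieldType.
Implicit Types F G Q : {fps2 K}.

Lemma xserE (s : fps K) i j : xser s i j = if j == 0%N then s i else 0.
Proof. by []. Qed.

Lemma convergent_xser (s : fps K) (C a : K) : 0 <= a ->
  (forall i, `|s i| <= C * a ^+ i) -> convergent (xser s).
Proof.
move=> a0 sC; apply: (@convergent_rates _ _ C a 0) => // i [|j].
  by rewrite xserE expr0 mulr1 /=.
by rewrite xserE /= normr0 expr0n !mulr0.
Qed.

(* [G = y Q + R] where [F = (y - s) Q + R], [R] depends on [x] only and
   [s k.+1 = e k (R k)].  Letting [s] depend on [R] covers both the division by
   a given [y - s] and, for [e k z = z / k.+1], the equation [s' = F(x, s(x))]. *)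
Lemma division_rec (e : nat -> K -> K) F : exists G : {fps2 K}, forall i,
  G i = F i + \sum_(k < i)
    fps_const (e k (G k 0%N)) * Fps (fun j => G (i - k.+1)%N j.+1).
Proof.
pose Phi (i : nat) (G : nat -> fps K) := F i + \sum_(k < i)
  fps_const (e k (G k 0%N)) * Fps (fun j => G (i - k.+1)%N j.+1).
have [n g h gh|G GE] := @seq_rec (fps K) 0 Phi; last by exists (Fps G).
congr (_ + _); apply: eq_bigr => k _.
by rewrite !gh //; have := ltn_ord k; lia.
Qed.

Lemma division_eq (e : nat -> K -> K) F G :
  (forall i, G i = F i + \sum_(k < i)
    fps_const (e k (G k 0%N)) * Fps (fun j => G (i - k.+1)%N j.+1)) ->
  F = (vary K - xser (Fps (fun i => if i is k.+1 then e k (G k 0%N) else 0)))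
        * fps2_of (fun i j => G i j.+1) + xser (Fps (fun i => G i 0%N)).
Proof.
move=> GE; set s := Fps _; set Q := fps2_of _; set R := Fps _.
rewrite mulrBl varyE; apply/fpsP => i; rewrite !fpsD fpsN fps_constM.
have -> : (xser s * Q) i = \sum_(k < i)
    fps_const (e k (G k 0%N)) * Fps (fun j => G (i - k.+1)%N j.+1).
  rewrite fpsM big_ord_recl.
  have -> : xser s (ord0 : 'I_i.+1) = 0 by apply/fpsP => -[].
  by rewrite mul0r add0r.
have Gdec : G i = fmono K 1 * Q i + xser R i.
  apply/fpsP => -[|j]; rewrite fpsD fmonoM ?subn1 xserE /= ?add0r ?addr0 //.
rewrite addrAC -Gdec GE addrK //.
Qed.

(* Cauchy estimates are awkward to propagate through the quadratic recursion,
   but the truncated sums of a majorant [d], weighted by a small [rho], satisfy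
   [D (n+1) <= 2 M + (r rho S n) D n] with [S] the partial sums of [|s|]. *)
Lemma division_bound (e : nat -> K -> K) F G (M r : K) :
  0 < M -> 1 <= r -> (forall i j, `|F i j| <= M * r ^+ (i + j)) ->
  (forall i, G i = F i + \sum_(k < i)
    fps_const (e k (G k 0%N)) * Fps (fun j => G (i - k.+1)%N j.+1)) ->
  exists d : nat -> K, [/\ forall i, 0 <= d i,
    forall i j, `|G i j| <= d i * r ^+ j &
    forall rho : K, 0 < rho -> r * rho <= 2^-1 ->
      (forall n, \sum_(i < n) d i * rho ^+ i <= 4 * M ->
        r * rho * (\sum_(k < n) `|e k (G k 0%N)| * rho ^+ k) <= 2^-1) ->
      forall i, d i <= 4 * M * rho^-1 ^+ i].
Proof.
move=> M0 r1 FM GE; have r0 : 0 <= r by apply: le_trans r1.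
pose a k := `|e k (G k 0%N)|.
pose Phi (i : nat) (d : nat -> K) :=
  M * r ^+ i + r * \sum_(k < i) a k * d (i - k.+1)%N.
have [n g h gh|d dE] := @seq_rec K 0 Phi.
  congr (_ + r * _); apply: eq_bigr => k _.
  by rewrite gh //; have := ltn_ord k; lia.
have d0 i : 0 <= d i.
  elim/ltn_ind: i => i IHi; rewrite dE addr_ge0 ?mulr_ge0 ?exprn_ge0 ?(ltW M0) //.
  by apply: sumr_ge0 => k _; rewrite mulr_ge0 ?normr_ge0 // IHi //; have := ltn_ord k; lia.
exists d; split => //.
  elim/ltn_ind => i IHi j; rewrite GE dE mulrDl fpsD.
  apply: le_trans (ler_normD _ _) _; apply: lerD; first by rewrite -mulrA -exprD.
  rewrite fps_sum; apply: le_trans (ler_norm_sum _ _ _) _.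
  rewrite mulrAC mulr_sumr; apply: ler_sum => k _.
  rewrite fps_constM normrM -/(a k) mulrCA ler_wpM2l ?normr_ge0 //= -exprS mulrC.
  by apply: IHi; have := ltn_ord k; lia.
move=> rho rho0 rrho hX.
have dsum n : \sum_(i < n) d i * rho ^+ i <= 4 * M.
  elim: n => [|n IHn]; first by rewrite big_ord0 mulr_ge0 // ltW.
  have D0 : 0 <= \sum_(i < n) d i * rho ^+ i.
    by apply: sumr_ge0 => i _; rewrite mulr_ge0 ?exprn_ge0 // ltW.
  under eq_bigr => i _ do rewrite dE mulrDl.
  rewrite big_split /=; apply: le_trans (_ : 2 * M + 2 * M <= _); last first.
    by rewrite -mulrDl -natrD.
  apply: lerD.
    under eq_bigr => i _ do rewrite -mulrA -exprMn.
    rewrite -mulr_sumr mulrC ler_wpM2r ?(ltW M0) //.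
    apply: le_trans (_ : \sum_(i < n.+1) 2^-1 ^+ i <= _).
      by apply: ler_sum => i _; rewrite lerXn2r ?nnegrE ?mulr_ge0 ?(ltW rho0) ?invr_ge0.
    have := geom_conv (2^-1 : K) n; rewrite mulfV ?pnatr_eq0 //.
    under eq_bigr => k _ do rewrite expr1n mulr1.
    by rewrite expr1n mulr1 => ->; rewrite gerBl exprn_ge0 ?invr_ge0.
  under eq_bigr => i _ do rewrite -mulrA.
  rewrite -mulr_sumr.
  have a0 k : 0 <= a k by exact: normr_ge0.
  apply: le_trans (ler_wpM2l r0 (ler_sum_conv n (ltW rho0) a0 d0)) _.
  rewrite !mulrA.
  apply: le_trans (_ : 2^-1 * (4 * M) <= _); last first.
    by rewrite mulrA (_ : 2^-1 * 4 = 2) // -[4]/((2 * 2)%:R) natrM mulKf // pnatr_eq0.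
  apply: ler_pM => //; last exact: hX.
  rewrite !mulr_ge0 ?(ltW rho0) // sumr_ge0 // => k _.
  by rewrite mulr_ge0 ?exprn_ge0 ?(ltW rho0).
move=> i; rewrite exprVn ler_pdivlMr ?exprn_gt0 //.
apply: le_trans (dsum i.+1); rewrite big_ord_recr lerDr.
by apply: sumr_ge0 => k _; rewrite mulr_ge0 ?exprn_ge0 // ltW.
Qed.

Lemma division F (s : fps K) : convergent F -> convergent (xser s) -> s 0%N = 0 ->
  exists Q, exists2 R : fps K, convergent Q /\ convergent (xser R) &
    F = (vary K - xser s) * Q + xser R.
Proof.
move=> cF cs s0; have [M [r [M0 r1 FM sM]]] := convergent_common cF cs.
have r0 : 0 < r by apply: lt_le_trans r1.
pose e (k : nat) (_ : K) : K := s k.+1.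
have [G GE] := division_rec e F.
have [d [d0 Gd]] := @division_bound e F G M r M0 r1 FM GE.
have A0 : 0 < 1 + M * r by rewrite addr_gt0 ?mulr_gt0.
(* With [r rho <= 1/2] the weighted sum of [|s k.+1|] is at most [2 M r], and [r rho] times this is
   [1/2] times [M r / (1 + M r)]. *)
pose rho := (4 * r * (1 + M * r))^-1.
have rho0 : 0 < rho by rewrite invr_gt0 !mulr_gt0.
have rrho : r * rho = 4^-1 * (1 + M * r)^-1.
  by rewrite /rho; field; rewrite ?(gt_eqF r0) ?(gt_eqF A0).
have A1 : (1 + M * r)^-1 <= 1.
  by rewrite invf_le1 // lerDl ltW // mulr_gt0.
have rr2 : r * rho <= 2^-1.
  rewrite rrho -[2^-1]mulr1 ler_pM ?invr_ge0 ?(ltW A0) //.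
  by rewrite lef_pV2 ?posrE // ler_nat.
move/(_ rho rho0 rr2) => dle.
have {}dle i : d i <= 4 * M * rho^-1 ^+ i.
  apply: dle => n _; apply: le_trans (_ : r * rho * (M * r * 2) <= _).
    apply: ler_wpM2l; first by rewrite mulr_ge0 ?ltW.
    apply: le_trans (_ : \sum_(k < n) M * r * 2^-1 ^+ k <= _).
      apply: ler_sum => k _; have := sM k.+1 0%N; rewrite xserE addn0 => sk.
      apply: le_trans (ler_wpM2r _ sk) _; first by rewrite exprn_ge0 // ltW.
      rewrite (_ : M * r ^+ k.+1 * rho ^+ k = M * r * (r * rho) ^+ k); last first.
        by rewrite exprS exprMn; ring.
      rewrite ler_wpM2l ?mulr_ge0 ?(ltW M0) ?(ltW r0) //.
      by rewrite lerXn2r ?nnegrE ?mulr_ge0 ?(ltW r0) ?(ltW rho0) ?invr_ge0.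
    rewrite -mulr_sumr ler_wpM2l ?mulr_ge0 ?(ltW M0) ?(ltW r0) //.
    case: n => [|n]; first by rewrite big_ord0.
    have := geom_conv (2^-1 : K) n; rewrite mulfV ?pnatr_eq0 //.
    under eq_bigr => k _ do rewrite expr1n mulr1.
    by rewrite expr1n mulr1 => ->; rewrite gerBl exprn_ge0 ?invr_ge0.
  rewrite rrho (_ : _ * (M * r * 2) = 2^-1 * (M * r / (1 + M * r))); last first.
    by field; rewrite ?(gt_eqF A0).
  rewrite ler_piMr ?invr_ge0 // ler_pdivrMr // mul1r lerDr //.
exists (fps2_of (fun i j => G i j.+1)), (Fps (fun i => G i 0%N)).
  have irho : 0 <= rho^-1 by rewrite invr_ge0 ltW.
  split.
    apply: (@convergent_rates _ _ (4 * M * r) rho^-1 r) => [//||i j]; first exact: ltW.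
    apply: le_trans (Gd i j.+1) _; rewrite exprS.
    apply: le_trans (ler_wpM2r _ (dle i)) _; first by rewrite mulr_ge0 ?exprn_ge0 ?ltW.
    by rewrite le_eqVlt; apply/orP; left; apply/eqP; ring.
  apply: (@convergent_xser _ (4 * M) rho^-1) => // i.
  by apply: le_trans (Gd i 0%N) _; rewrite expr0 mulr1.
rewrite [LHS](@division_eq e F G GE); congr ((_ - map_fps _ _) * _ + _).
by apply/fpsP => -[|k] //=; rewrite s0.
Qed.

(** The quotient is an arbitrary formal series. It is applied in a chart, with a quotient involving
    [tau], so convergence after substitution never has to be established. *)
Lemma division_unique (s R : fps K) Q : s 0%N = 0 ->
  (vary K - xser s) * Q = xser R -> R = 0.
Proof.
move=> s0 E; suff QR i : Q i = 0 /\ R i = 0 by apply/fpsP => i; case: (QR i).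
elim/ltn_ind: i => i IHi.
have : (vary K * Q) i - (xser s * Q) i = xser R i.
  by rewrite -E mulrBl.
rewrite varyE fps_constM fpsM big_ord_recl subn0.
have -> : xser s (ord0 : 'I_i.+1) = 0 by apply/fpsP => -[].
rewrite mul0r add0r big1 ?subr0 => [/fpsP QE|k _]; last first.
  rewrite (_ : Q _ = 0) ?mulr0 //.
  have ki := ltn_ord k; have /IHi[] // : (i - lift ord0 k < i)%N by rewrite lift0; lia.
split; last by have := QE 0%N; rewrite fmonoM /= => <-.
by apply/fpsP => j; have := QE j.+1; rewrite fmonoM /= subn1.
Qed.

(** The remainder of [F] modulo [y - u] is [F(x, u(x))], so the identity says [u' = F(x, u)]. The
    quotient is kept because it shows that [y - u] divides the pulled back derivative. *)
Lemma ode_solution F : convergent F -> exists Q, exists2 u : fps K,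
  [/\ convergent Q, convergent (xser u) & u 0%N = 0] &
  F = (vary K - xser u) * Q + xser (fder u).
Proof.
move=> cF; have [M [r [M0 r1 FM]]] := convergent_pos cF.
have r0 : 0 < r by apply: lt_le_trans r1.
pose e (k : nat) (z : K) : K := z / k.+1%:R.
have [G GE] := division_rec e F.
have [d [d0 Gd]] := @division_bound e F G M r M0 r1 FM GE.
(* Here the coefficients of [u] are bounded by the majorant [d] itself, hence their weighted sum by
   the inductive bound [4 M]; and [4 M r rho] is [1/2] times [M / (1 + M)]. *)
pose rho := (8 * r * (1 + M))^-1.
have A0 : 0 < 1 + M by rewrite addr_gt0.
have rho0 : 0 < rho by rewrite invr_gt0 !mulr_gt0.
have rrho : r * rho = 8^-1 * (1 + M)^-1.
  by rewrite /rho; field; rewrite ?(gt_eqF r0) ?(gt_eqF A0).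
have A1 : (1 + M)^-1 <= 1 by rewrite invf_le1 // lerDl ltW.
have rr2 : r * rho <= 2^-1.
  rewrite rrho -[2^-1]mulr1 ler_pM ?invr_ge0 ?(ltW A0) //.
  by rewrite lef_pV2 ?posrE // ler_nat.
move/(_ rho rho0 rr2) => dle.
have ud k : `|G k 0%N / k.+1%:R| <= d k.
  rewrite normrM; apply: le_trans (_ : `|G k 0%N| * 1 <= _).
    by rewrite ler_wpM2l // normfV normr_nat invf_le1 ?ltr0n // ler1n.
  by rewrite mulr1; have := Gd k 0%N; rewrite mulr1.
have {}dle i : d i <= 4 * M * rho^-1 ^+ i.
  apply: dle => n dn; apply: le_trans (_ : r * rho * (4 * M) <= _).
    apply: ler_wpM2l; first by rewrite mulr_ge0 ?ltW.
    apply: le_trans dn; apply: ler_sum => k _.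
    by apply: ler_wpM2r; [rewrite exprn_ge0 // ltW|exact: ud].
  rewrite rrho (_ : _ * (4 * M) = 2^-1 * (M / (1 + M))); last first.
    by field; rewrite ?(gt_eqF A0).
  rewrite ler_piMr ?invr_ge0 // ler_pdivrMr // mul1r lerDr //.
have irho : 0 <= rho^-1 by rewrite invr_ge0 ltW.
exists (fps2_of (fun i j => G i j.+1)),
  (Fps (fun i => if i is k.+1 then G k 0%N / k.+1%:R else 0)).
  split => //.
    apply: (@convergent_rates _ _ (4 * M * r) rho^-1 r) => [//||i j]; first exact: ltW.
    apply: le_trans (Gd i j.+1) _; rewrite exprS.
    apply: le_trans (ler_wpM2r _ (dle i)) _; first by rewrite mulr_ge0 ?exprn_ge0 ?ltW.
    by rewrite le_eqVlt; apply/orP; left; apply/eqP; ring.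
  apply: (@convergent_xser _ (4 * M * rho) rho^-1) => // -[|i] /=.
    by rewrite normr0 expr0 mulr1 !mulr_ge0 ?(ltW M0) ?(ltW rho0).
  apply: le_trans (ud i) _; apply: le_trans (dle i) _.
  by rewrite exprS mulrA mulfK // gt_eqF // invr_gt0.
rewrite [LHS](@division_eq e F G GE); congr (_ + map_fps _ _).
apply/fpsP => i /=; by rewrite -[RHS]mulr_natr divfK // pnatr_eq0.
Qed.

End Division.

(** * Smooth separatrices *)

Section Separatrices.
Variable K : numFieldType.
Implicit Types (f g F G : {fps2 K}) (w eta : germ2 K).

(** The derivation along the dual vector field, equal to the coefficient of the 2-form in the
    definition of [separatrix]. *)
Definition vf w f : {fps2 K} := w.1 * dy f - w.2 * dx f.

Lemma vfM w f g : vf w (f * g) = vf w f * g + f * vf w g.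
Proof. by rewrite /vf dxM dyM; ring. Qed.

Lemma convergent_vf w f : convergent w.1 -> convergent w.2 -> convergent f ->
  convergent (vf w f).
Proof.
move=> c1 c2 cf; apply: convergentB; apply: convergentM => //.
  exact: convergent_dy.
exact: convergent_dx.
Qed.

(** [ell] is the linear part at [x = 1]: ['X - t%:P] for the tangent [y = t x], and [1] for the
    tangent [x = 0]. The last clause asks for primality rather than irreducibility, since it is
    primality that locates the irreducible divisors of a product of such curves. *)
Definition smooth_separatrix w (ell : {poly K}) f : Prop :=
  [/\ convergent f, hpart f 0%N = 0 /\ hpart f 1%N = ell, germ_dvd f (vf w f) &
      forall F G, convergent F -> convergent G -> germ_dvd f (F * G) ->
        germ_dvd f F \/ germ_dvd f G].

Lemma hpart_xser (s : fps K) d : hpart (xser s) d = (s d)%:P.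
Proof.
apply/polyP => j; rewrite coef_hpart coefC xserE.
by case: j => [|j] /=; rewrite ?subn0 ?if_same.
Qed.

Lemma tau_xser t (s : fps K) : tau t (xser s) = xser s.
Proof.
apply/fpsP => i; rewrite tauE hpart_xser comp_polyC fps_of_polyC.
exact/fpsP.
Qed.

Lemma dx_xser (s : fps K) : dx (xser s) = xser (fder s).
Proof.
by apply/fpsP => i; apply/fpsP => j /=; case: (j == 0%N); rewrite ?mul0rn.
Qed.

Lemma dy_xser (s : fps K) : dy (xser s) = 0.
Proof. by apply/fpsP => i; apply/fpsP => j /=; rewrite mul0rn. Qed.

Lemma varxM_eq0_coef f : (varx K * f) 0%N 0%N = 0.
Proof. by rewrite varxE fmonoM. Qed.

(** Modulo [y - s] a germ is represented by its remainder, a series in [x]; remainders multiply, and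
    one of two vanishes when their product does. *)
Lemma graph_prime (s : fps K) F G : convergent (xser s) -> s 0%N = 0 ->
  convergent F -> convergent G -> germ_dvd (vary K - xser s) (F * G) ->
  germ_dvd (vary K - xser s) F \/ germ_dvd (vary K - xser s) G.
Proof.
move=> cs s0 cF cG [H _ FGH].
have [Q [R [cQ _] FE]] := division cF cs s0.
have [Q' [R' [cQ' _] GE]] := division cG cs s0.
have /(division_unique s0) RR : (vary K - xser s) *
    (H - (vary K - xser s) * Q * Q' - Q * xser R' - Q' * xser R) = xser (R * R').
  rewrite rmorphM /=; apply/eqP; rewrite -subr_eq0; apply/eqP.
  transitivity ((vary K - xser s) * H - F * G); last by rewrite FGH subrr.
  by rewrite FE GE; ring.
have nzdK : nzd K by move=> a b /eqP; rewrite mulf_eq0 => /orP[] /eqP; [left|right].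
have [R0|R0] := fps_nzd nzdK RR; [left|right].
  by exists Q => //; rewrite FE R0 rmorph0 addr0.
by exists Q' => //; rewrite GE R0 rmorph0 addr0.
Qed.

(** As [eta.2] does not vanish at the point, the leaf through it is a graph [y = u(x)] with
    [u' = - eta.1 / eta.2]; its image under the blow-down is the separatrix. *)
Lemma separatrix_fin w eta t k : convergent w.1 -> convergent w.2 ->
  convergent eta.1 -> convergent eta.2 -> eta.2 0%N 0%N <> 0 ->
  pullback (chart_fin t) w = (varx K ^+ k * eta.1, varx K ^+ k * eta.2) ->
  exists f, smooth_separatrix w ('X - t%:P) f.
Proof.
move=> cw1 cw2 ce1 ce2 e2; rewrite pullback_fin => E.
have E1 : tau t w.1 + tau t w.2 * (fconst t + vary K) = varx K ^+ k * eta.1 := congr1 fst E.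
have {E} E2 : tau t w.2 * varx K = varx K ^+ k * eta.2 := congr1 snd E.
have [i ci ei] := convergent_inv ce2 e2.
have cF : convergent (- (eta.1 * i)) by apply/convergentN/convergentM.
have [Q [u [cQ cu u0] ode]] := ode_solution cF.
have {}ode : eta.1 + eta.2 * xser (fder u) = - (eta.2 * (vary K - xser u) * Q).
  have : eta.2 * - (eta.1 * i) = eta.2 * ((vary K - xser u) * Q + xser (fder u)).
    by rewrite -ode.
  have -> : eta.2 * - (eta.1 * i) = - (eta.2 * i * eta.1) by ring.
  by rewrite ei mul1r => E; rewrite -[eta.1]opprK E; ring.
(* The image of [y = u(x)] under [(x, y) -> (x, x (t + y))]. *)
pose s : fps K := fmono K 1 * (fps_const t + u).
have s0 : s 0%N = 0 by rewrite /s fmonoM.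
have s1 : s 1%N = t by rewrite /s fmonoM subnn fpsD u0 addr0.
have xE : varx K = xser (fmono K 1) by rewrite map_fps_fmono varxE.
have tE : fconst t = xser (fps_const t) by rewrite map_fps_const fconstE.
have sE : xser s = varx K * (fconst t + xser u) by rewrite /s rmorphM rmorphD /= xE tE.
have ds : xser (fder s) = fconst t + xser u + varx K * xser (fder u).
  rewrite -!dx_xser sE dxM dx_varx raddfD /= fconstE dx_fps_const; ring.
have cs : convergent (xser s).
  rewrite sE; apply: convergentM; first exact: convergent_varx.
  by apply: convergentD => //; apply: convergent_fconst.
pose f := vary K - xser s.
have cf : convergent f by apply: convergentB => //; exact: convergent_vary.
have vE : vf w f = w.1 + w.2 * xser (fder s).
  rewrite /vf /f raddfB raddfB /= dy_vary dx_vary dx_xser dy_xser; ring.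
have [Q1 [R [cQ1 _] vR]] := division (convergent_vf cw1 cw2 cf) cs s0.
exists f; split => //.
- have hf : hpart f = hpart (vary K) - hpart (xser s) by rewrite /f rmorphB.
  by split; rewrite hf fpsD fpsN hpart_vary fps_constM hpart_xser ?s0 ?s1 /= ?mulr0 ?mulr1 ?subr0.
(* The remainder [R] depends on [x] only, so the chart leaves it unchanged. Upstairs both [tau t f]
   and [tau t (vf w f)] are multiples of [y - u], hence so is [R], which must vanish by uniqueness
   of the division. *)
- exists Q1 => //; rewrite vR.
  suff -> : R = 0 by rewrite rmorph0 addr0.
  case: k E1 E2 => [|k] E1 E2.
    by case: e2; rewrite -[eta.2]mul1r -E2 mulrC varxM_eq0_coef.
  have {}E2 : tau t w.2 = varx K ^+ k * eta.2.
    apply: (@fmonoI _ 1); rewrite -varxE mulrC E2 exprS; ring.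
  have tf : tau t f = varx K * (vary K - xser u).
    rewrite /f rmorphB /= tau_vary tau_xser sE; ring.
  have : tau t (vf w f) = varx K * (vary K - xser u) * tau t Q1 + xser R.
    by rewrite vR rmorphD rmorphM /= -tf tau_xser.
  rewrite vE rmorphD rmorphM /= tau_xser ds => E.
  apply: (@division_unique _ u R (- (varx K ^+ k.+1 * eta.2 * Q) - varx K ^+ k * eta.2
     - varx K * tau t Q1)) => //.
  have -> : xser R = (tau t w.1 + tau t w.2 * (fconst t + vary K))
     + tau t w.2 * (xser u - vary K) + varx K * tau t w.2 * xser (fder u)
     - varx K * (vary K - xser u) * tau t Q1.
    rewrite -[xser R](addKr (varx K * (vary K - xser u) * tau t Q1)) -E; ring.
  rewrite E1 E2; have -> : varx K ^+ k.+1 * eta.1 + varx K ^+ k * eta.2 * (xser u - vary K)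
     + varx K * (varx K ^+ k * eta.2) * xser (fder u) =
     varx K ^+ k.+1 * (eta.1 + eta.2 * xser (fder u)) + varx K ^+ k * eta.2 * (xser u - vary K).
    by rewrite exprS; ring.
  by rewrite ode; ring.
- by move=> F G cF' cG; exact: graph_prime.
Qed.

Lemma germ_dvd_swap f g : germ_dvd f g -> germ_dvd (swap f) (swap g).
Proof.
by move=> [h ch ->]; exists (swap h); [exact: convergent_swap|rewrite rmorphM].
Qed.

Lemma vf_swap w f : vf w (swap f) = - swap (vf (swapg w) f).
Proof.
by rewrite /vf rmorphB !rmorphM /= !swapK swap_dx swap_dy; ring.
Qed.

Lemma separatrix_inf w eta k : convergent w.1 -> convergent w.2 ->
  convergent eta.1 -> convergent eta.2 -> eta.2 0%N 0%N <> 0 ->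
  pullback (chart_inf K) w = (varx K ^+ k * eta.1, varx K ^+ k * eta.2) ->
  exists f, smooth_separatrix w 1 f.
Proof.
move=> cw1 cw2 ce1 ce2 e2; rewrite pullback_inf => E.
have [||f [cf [f0 f1] [g cg fg] fp]] := separatrix_fin _ _ ce1 ce2 e2 E.
- exact: convergent_swap.
- exact: convergent_swap.
exists (swap f); split.
- exact: convergent_swap.
- have f00 : f 0%N 0%N = 0 by rewrite hpartE f0 coef0.
  have f01 : f 0%N 1%N = 1 by rewrite hpartE f1 coefB coefX coefC subr0.
  have f10 : f 1%N 0%N = 0 by rewrite hpartE f1 coefB coefX coefC subr0.
  by split; apply/polyP => -[|[|j]]; rewrite coef_hpart ?coef0 ?coef1 //=.
- rewrite vf_swap fg; exists (- swap g); first exact/convergentN/convergent_swap.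
  by rewrite rmorphM mulrN.
- move=> F G cF cG /germ_dvd_swap; rewrite rmorphM /= swapK => /fp.
  case=> [||/germ_dvd_swap|/germ_dvd_swap]; rewrite ?swapK; [| |by left|by right];
  exact: convergent_swap.
Qed.

End Separatrices.

Notation tang := Defs.contract.

(** * The ideal of a form *)

Section Vanish.
Variable K : numFieldType.
Implicit Types (f g F G T : {fps2 K}) (w X Y : germ2 K).

Definition vanish n f := forall d, (d < n)%N -> hpart f d = 0.

Lemma vanish_coef n f i j : vanish n f -> (i + j < n)%N -> f i j = 0.
Proof. by move=> fn ij; rewrite hpartE fn // coef0. Qed.

Lemma vanishW n k f : (k <= n)%N -> vanish n f -> vanish k f.
Proof. by move=> kn fn d dk; apply: fn; apply: leq_trans kn. Qed.

Lemma vanishS n f : vanish n f -> hpart f n = 0 -> vanish n.+1 f.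
Proof. by move=> fn f0 d; rewrite ltnS leq_eqVlt => /predU1P[->|/fn]. Qed.

Lemma vanishD n f g : vanish n f -> vanish n g -> vanish n (f + g).
Proof. by move=> fn gn d dn; rewrite raddfD fpsD fn // gn // addr0. Qed.

Lemma vanishN n f : vanish n f -> vanish n (- f).
Proof. by move=> fn d dn; rewrite raddfN fpsN fn // oppr0. Qed.

Lemma vanishM n k f g : vanish n f -> vanish k g -> vanish (n + k) (f * g).
Proof. by move=> fn gk d dn; rewrite rmorphM; exact: (fps_lead fn gk).2. Qed.

Lemma vanish0 f : vanish 0 f. Proof. by []. Qed.

Lemma vanishMr n f g : vanish n f -> vanish n (f * g).
Proof. by move=> /vanishM/(_ (@vanish0 g)); rewrite addn0. Qed.

Lemma vanish_sum n I (r : seq I) (P : pred I) (F : I -> {fps2 K}) :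
  (forall i, P i -> vanish n (F i)) -> vanish n (\sum_(i <- r | P i) F i).
Proof.
move=> Fn; apply: big_ind => //; last exact: vanishD.
by move=> d _; rewrite raddf0.
Qed.

Lemma hpartM_shift n k e f g : vanish n f -> vanish k g ->
  hpart (f * g) (n + k + e)%N =
  \sum_(i < e.+1) hpart f (n + i)%N * hpart g (k + (e - i))%N.
Proof.
move=> fn gk; have -> : hpart (f * g) = hpart f * hpart g by rewrite rmorphM.
rewrite {1}(fmono_dvd fn) {1}(fmono_dvd gk) mulrACA fmonoD fmonoM leq_addr addKn.
rewrite fpsM; apply: eq_bigr => i _ /=.
by rewrite addnC [(e - i + k)%N]addnC.
Qed.

Lemma hpartM_shift0 n k f g : vanish n f -> vanish k g ->
  hpart (f * g) (n + k)%N = hpart f n * hpart g k.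
Proof.
move=> fn gk; rewrite -[(n + k)%N]addn0 hpartM_shift // big_ord_recl big_ord0.
by rewrite !addn0 addr0.
Qed.

Lemma hpartM_shift1 n k f g : vanish n f -> vanish k g ->
  hpart (f * g) (n + k).+1 = hpart f n * hpart g k.+1 + hpart f n.+1 * hpart g k.
Proof.
move=> fn gk; rewrite -[(n + k).+1]addn1 hpartM_shift // !big_ord_recl big_ord0.
by rewrite /= /bump /= !addn0 !addn1 addr0.
Qed.

Lemma hpartM_shift2 n k f g : vanish n f -> vanish k g ->
  hpart (f * g) (n + k).+2 = hpart f n * hpart g k.+2
    + hpart f n.+1 * hpart g k.+1 + hpart f n.+2 * hpart g k.
Proof.
move=> fn gk; rewrite -[(n + k).+2]addn2 hpartM_shift // !big_ord_recl big_ord0.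
by rewrite /= /bump /= !addn0 !addn1 !addn2 addr0 addrA.
Qed.

Lemma hpartM_shift3 n k f g : vanish n f -> vanish k g ->
  hpart (f * g) (n + k).+3 = hpart f n * hpart g k.+3
    + hpart f n.+1 * hpart g k.+2 + hpart f n.+2 * hpart g k.+1
    + hpart f n.+3 * hpart g k.
Proof.
move=> fn gk; rewrite -[(n + k).+3]addn3 hpartM_shift // !big_ord_recl big_ord0.
by rewrite /= /bump /= !addn0 !addn1 !addn2 !addn3 addr0 !addrA.
Qed.

Lemma fps2_nzd f g : f * g = 0 -> f = 0 \/ g = 0.
Proof.
apply: fps_nzd; apply: fps_nzd => a b /eqP.
by rewrite mulf_eq0 => /orP[] /eqP; [left|right].
Qed.

Lemma poly_nzd (p q : {poly K}) : p * q = 0 -> p = 0 \/ q = 0.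
Proof. by move/eqP; rewrite mulf_eq0 => /orP[] /eqP; [left|right]. Qed.

Lemma vanish_cancel n k f g : vanish n f -> hpart f n <> 0 ->
  vanish (n + k) (f * g) -> vanish k g.
Proof.
move=> fn f0 fg; elim/ltn_ind: k fg => k IHk fg d dk.
have gd : vanish d g by apply: IHk => //; apply: vanishW fg; rewrite leq_add2l ltnW.
have := fg (n + d)%N; rewrite ltn_add2l => /(_ dk).
by rewrite hpartM_shift0 // => /poly_nzd[].
Qed.

Definition homform d (p : {poly K}) : {fps2 K} :=
  fps2_of (fun i j => if (i + j == d)%N then p`_j else 0).

Lemma hpart_homform d (p : {poly K}) e : (size p <= d.+1)%N ->
  hpart (homform d p) e = if e == d then p else 0.
Proof.
move=> sp; apply/polyP => j; rewrite coef_hpart /=.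
case: leqP => je; first by rewrite subnK //; case: ifP; rewrite ?coef0.
case: eqP => [ed|_]; last by rewrite coef0.
by rewrite nth_default //; apply: leq_trans sp _; rewrite -ed.
Qed.

Lemma vanish_homform d (p : {poly K}) n : (n <= d)%N -> vanish n (homform d p).
Proof.
move=> nd e en; apply/polyP => j; rewrite coef_hpart coef0 /=.
by case: leqP => je //; rewrite subnK //; case: eqP => // ed; move: en; rewrite ed ltnNge nd.
Qed.

Lemma convergent_homform d (p : {poly K}) : convergent (homform d p).
Proof.
apply: (@convergent_fin _ _ d.+1) => i j dij /=.
by case: eqP => // ij; move: dij; rewrite ij ltnn.
Qed.

Lemma hpart_monomial N (j : nat) d : (j <= N)%N ->
  hpart (varx K ^+ (N - j) * vary K ^+ j) d = if d == N then 'X^j else 0.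
Proof.
move=> jN; have -> : hpart (varx K ^+ (N - j) * vary K ^+ j) =
    hpart (varx K) ^+ (N - j) * hpart (vary K) ^+ j by rewrite rmorphM !rmorphXn.
have cX : fps_const 'X ^+ j = fps_const 'X^j :> fps {poly K} by rewrite rmorphXn.
rewrite hpart_varx hpart_vary exprMn cX.
rewrite !fmonoX !mul1n mulrCA fmonoD subnK // fps_constM /=.
by case: eqP; rewrite ?mulr1 ?mulr0.
Qed.

(** A monomial [x^a y^b] of degree at least [N] is charged to [x^(N-b) y^b] if [b < N] and to [y^N]
    otherwise. The coefficients are then explicit, with the same rate of convergence as [f]. *)
Definition mono_coef N (j : nat) f : {fps2 K} := fps2_of (fun a b =>
  if (j < N)%N then (if b == 0%N then f (a + (N - j))%N j else 0)
  else f a (b + N)%N).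

Lemma convergent_mono_coef N j f : convergent f -> convergent (mono_coef N j f).
Proof.
move=> /convergent_pos[M [r [M0 r1 fM]]]; have r0 : 0 <= r by apply: le_trans r1.
exists (M * r ^+ N), r => a b /=.
have pos : 0 <= M * r ^+ N * r ^+ (a + b) by rewrite !mulr_ge0 ?exprn_ge0 ?(ltW M0).
case: ifP => jN.
  case: eqP => [->|_]; last by rewrite normr0.
  apply: le_trans (fM _ _) _; rewrite -mulrA -exprD addn0.
  by rewrite (_ : (_ + j)%N = (N + a)%N) //; lia.
apply: le_trans (fM _ _) _; rewrite -mulrA -exprD.
by rewrite (_ : (a + _)%N = (N + (a + b))%N) //; lia.
Qed.

Lemma monomialM a b f i j : (varx K ^+ a * vary K ^+ b * f) i j =
  if (a <= i)%N && (b <= j)%N then f (i - a)%N (j - b)%N else 0.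
Proof.
have cX : fps_const (fmono K 1) ^+ b = fps_const (fmono K 1 ^+ b) by rewrite rmorphXn.
rewrite varxE varyE cX !fmonoX !mul1n -mulrA fmonoM.
by case: leqP => ai //; rewrite fps_constM fmonoM.
Qed.

Lemma mono_coefE N f : vanish N f ->
  f = \sum_(j < N.+1) mono_coef N j f * (varx K ^+ (N - j) * vary K ^+ j).
Proof.
move=> fN; apply/fpsP => a; apply/fpsP => b; rewrite !fps_sum.
under eq_bigr => j _ do rewrite mulrC monomialM.
rewrite big_ord_recr /= ltnn subnn leq0n /= subn0.
case: (leqP N b) => Nb.
  rewrite subnK // big1 ?add0r // => j _ /=; rewrite ltn_ord.
  have jN := ltn_ord j; case: ifP => // _.
  by case: eqP => // bj; lia.
rewrite addr0; case: (leqP N (a + b)) => ab; last first.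
  rewrite (vanish_coef fN ab) big1 // => j _ /=; have jN := ltn_ord j.
  by case: ifP => // /andP[h1 h2]; lia.
rewrite (bigD1 (Ordinal Nb)) //= Nb subnn /= leqnn andbT.
have -> : (N - b <= a)%N by lia.
rewrite subnK; last by lia.
rewrite big1 ?addr0 // => j /eqP jb; rewrite ltn_ord; case: ifP => // /andP[h1 h2].
case: eqP => // bj; case: jb; apply: val_inj => /=; lia.
Qed.

Lemma mono_coef0 N (j : nat) f : (j <= N)%N -> vanish N.+1 f ->
  mono_coef N j f 0%N 0%N = 0.
Proof.
move=> jN fN /=; case: ifP => h; apply: vanish_coef fN _; lia.
Qed.

Lemma convergent_det n (A : 'M[{fps2 K}]_n) :
  (forall i j, convergent (A i j)) -> convergent (\det A).
Proof.
move=> cA; apply: convergent_sum => s _; apply: convergentM.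
  by apply: convergentX; apply: convergentN; exact: convergent1.
exact: convergent_prod.
Qed.

(* Modulo the ideal of [w], the vector [e] of monomials of degree [N] satisfies
   [e = nu e] with [nu] in the maximal ideal, so [det (1 - nu)] is a unit. *)
Lemma ideal_contains_power w N k : convergent w.1 -> convergent w.2 ->
  (forall j, (j <= N)%N -> exists Y : germ2 K,
    [/\ convergent Y.1 /\ convergent Y.2, vanish k Y.1 /\ vanish k Y.2 &
        vanish N.+1 (varx K ^+ (N - j) * vary K ^+ j - tang w Y)]) ->
  forall F, convergent F -> vanish N F -> exists Y : germ2 K,
    [/\ convergent Y.1 /\ convergent Y.2, vanish k Y.1 /\ vanish k Y.2 &
        F = tang w Y].
Proof.
move=> cw1 cw2 hY F cF FN.
pose e (j : nat) := varx K ^+ (N - j) * vary K ^+ j.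
have ce j : convergent (e j).
  by apply: convergentM; apply: convergentX; [exact: convergent_varx|exact: convergent_vary].
have hY' (j : 'I_N.+1) := hY j (leq_ord j).
have {hY hY'} [Y HY] := choice hY'.
pose eps (j : 'I_N.+1) := e j - tang w (Y j).
have ceps j : convergent (eps j).
  have [[c1 c2] _ _] := HY j; apply: convergentB => //.
  by apply: convergentD; apply: convergentM.
pose nu : 'M[{fps2 K}]_N.+1 := \matrix_(i, l) mono_coef N l (eps i).
pose A := 1%:M - nu.
have cA i j : convergent (A i j).
  rewrite !mxE; apply: convergentB; last exact: convergent_mono_coef.
  by case: (i == j); [exact: convergent1|exact: convergent0].
pose v : 'cV[{fps2 K}]_N.+1 := \col_i e i.
have Av : A *m v = \col_i tang w (Y i).
  rewrite mulmxBl mul1mx; apply/matrixP => i j; rewrite !mxE.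
  have [_ _ /vanishW vn] := HY i; have {}vn := vn _ (leqnSn N).
  under eq_bigr => l _ do rewrite !mxE.
  by rewrite -(mono_coefE vn) /eps opprB addrC subrK.
have dA : (\det A) 0%N 0%N = 1.
  pose c00 : {rmorphism {fps2 K} -> K} := fps_coef0 (R := K) \o fps_coef0 (R := fps K).
  have -> : (\det A) 0%N 0%N = c00 (\det A) by [].
  rewrite -(det_map_mx c00) (_ : map_mx _ A = 1%:M) ?det1 //.
  apply/matrixP => i j; rewrite !mxE rmorphB; have [_ _ vn] := HY i.
  have -> : c00 (mono_coef N j (eps i)) = 0 by exact: (mono_coef0 (leq_ord j) vn).
  by rewrite subr0 rmorph_nat.
have cadj i j : convergent (\adj A i j).
  rewrite mxE /cofactor; apply: convergentM.
    by apply: convergentX; apply: convergentN; exact: convergent1.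
  by apply: convergent_det => a b; rewrite [row' _ _ _ _]mxE [col' _ _ _ _]mxE; exact: cA.
have [|dl cdl dlE] := convergent_inv (convergent_det cA).
  by rewrite dA; apply/eqP; rewrite oner_eq0.
have eE (i : 'I_N.+1) : e i = \sum_l dl * \adj A i l * tang w (Y l).
  have : (dl *: (\adj A *m (A *m v))) i 0 = e i.
    by rewrite mulmxA mul_adj_mx mul_scalar_mx scalerA mulrC dlE scale1r mxE.
  rewrite Av => <-; rewrite !mxE mulr_sumr; apply: eq_bigr => l _.
  by rewrite !mxE mulrA.
pose c i l := mono_coef N (i : 'I_N.+1) F * (dl * \adj A i l).
have cc i l : convergent (c i l).
  apply: convergentM; first exact: convergent_mono_coef.
  exact: convergentM.
exists (\sum_i \sum_l (Y l).1 * c i l, \sum_i \sum_l (Y l).2 * c i l); split.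
- split; apply: convergent_sum => i _; apply: convergent_sum => l _;
    by have [[c1 c2] _ _] := HY l; apply: convergentM.
- split; apply: vanish_sum => i _; apply: vanish_sum => l _;
    by have [_ [c1 c2] _] := HY l; apply: vanishMr.
rewrite (mono_coefE FN) /tang /= !mulr_sumr -big_split; apply: eq_bigr => i _ /=.
rewrite -/(e i) eE !mulr_sumr -big_split; apply: eq_bigr => l _ /=.
by rewrite /tang /c; ring.
Qed.

End Vanish.

(** * Products of smooth separatrices *)

Section InvariantProducts.
Variable K : numFieldType.
Implicit Types (f g T : {fps2 K}) (w : germ2 K) (l : seq {fps2 K}).

Lemma coef00M f g : (f * g) 0%N 0%N = f 0%N 0%N * g 0%N 0%N.
Proof. by rewrite fpsM big_ord_recl big_ord0 addr0 fpsM big_ord_recl big_ord0 addr0. Qed.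

Lemma germ_unit_coef00 f : germ_unit f -> f 0%N 0%N <> 0.
Proof.
move=> [g _ fg] f0; have := coef00M f g.
by rewrite fg f0 mul0r => /eqP; rewrite /= oner_eq0.
Qed.

Lemma smooth_separatrix_coef00 w ell f : smooth_separatrix w ell f -> f 0%N 0%N = 0.
Proof. by case=> _ [f0 _] _ _; rewrite hpartE f0 coef0. Qed.

Lemma smooth_separatrix_neq0 w ell f :
  smooth_separatrix w ell f -> ell <> 0 -> f <> 0.
Proof. by case=> _ [_ f1] _ _ + f0; rewrite -f1 f0 raddf0. Qed.

(** By primality each factor [g] divides either [f] or the cofactor. In the first case [f] is [g]
    times a unit and inherits its invariance; in the second [g] is cancelled and the induction
    continues. *)
Lemma irreducible_dvd_prod w l u f : convergent w.1 -> convergent w.2 ->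
  convergent u -> germ_unit u ->
  (forall g, g \in l -> exists2 ell, ell <> 0 & smooth_separatrix w ell g) ->
  germ_irreducible f -> germ_dvd f (u * \prod_(g <- l) g) -> separatrix w f.
Proof.
move=> cw1 cw2 cu uu + irf; elim: l => [|g l IHl] sl [h ch E].
  case: irf => _ _ nu _; case: nu; case: uu => v cv uv.
  exists (h * v); first exact: convergentM.
  by rewrite mulrA -E big_nil mulr1.
have [ell ell0 sg] := sl g (mem_head _ _); have [cg _ [k ck gk] gprime] := sg.
have cf : convergent f by case: irf.
have slw g' : g' \in l -> exists2 ell, ell <> 0 & smooth_separatrix w ell g'.
  by move=> g'l; apply: sl; rewrite inE g'l orbT.
have cl : convergent (\prod_(g' <- l) g').
  rewrite big_seq; apply: convergent_prod => g' g'l.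
  by have [? _ []] := slw _ g'l.
have [] := gprime f h cf ch.
- by exists (u * \prod_(g' <- l) g'); [exact: convergentM|rewrite -E big_cons; ring].
- case=> q cq fq; split=> //; case: (irf) => _ _ _ /(_ g q cg cq fq) [|].
    by move=> /germ_unit_coef00; rewrite (smooth_separatrix_coef00 sg).
  case=> q' cq' qq'; exists (q' * (k * q + vf w q)).
    by apply: convergentM => //; apply: convergentD; [exact: convergentM|exact: convergent_vf].
  rewrite -/(vf w f) fq vfM gk.
  transitivity (g * (q * q') * (k * q + vf w q)); last by ring.
  by rewrite qq'; ring.
case=> q cq hq; apply: IHl => //; exists q => //.
have : g * (u * \prod_(g' <- l) g' - f * q) = 0.
  transitivity (u * \prod_(g' <- g :: l) g' - f * h); first by rewrite big_cons hq; ring.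
  by rewrite E subrr.
by case/fps2_nzd => [/(smooth_separatrix_neq0 sg ell0)//|/eqP]; rewrite subr_eq0 => /eqP.
Qed.

Lemma fconstM (a b : K) : fconst a * fconst b = fconst (a * b) :> {fps2 K}.
Proof. by rewrite !fconstE !rmorphM. Qed.

Lemma fconst1 : fconst 1 = 1 :> {fps2 K}.
Proof. by rewrite fconstE !rmorph1. Qed.

Lemma germ_unit_fconst (c : K) : c <> 0 -> germ_unit (fconst c : {fps2 K}).
Proof.
move=> /eqP c0; exists (fconst c^-1); first exact: convergent_fconst.
by rewrite fconstM divff // fconst1.
Qed.

Lemma hpart_fconst (c : K) : hpart (fconst c) = fps_const c%:P.
Proof.
apply/fpsP => d; apply/polyP => j; rewrite coef_hpart /=.
by case: d j => [|d] [|j]; rewrite ?coefC ?coef0 //= andbF if_same.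
Qed.

Definition invariant_product w n (r : {poly K}) l : Prop :=
  let T := \prod_(g <- l) g in
  [/\ convergent T, vanish n T /\ hpart T n = r, germ_dvd T (vf w T) &
      forall g, g \in l -> exists2 ell, ell <> 0 & smooth_separatrix w ell g].

Lemma invariant_product_nil w : invariant_product w 0 1 [::].
Proof.
rewrite /invariant_product big_nil; split => //; first exact: convergent1.
  by split=> //; rewrite rmorph1.
exists 0; first exact: convergent0.
by rewrite /vf -fconst1 dy_fconst fconstE dx_fps_const !mulr0 subr0.
Qed.

Lemma invariant_product_cons w ell f n r l : convergent w.1 -> convergent w.2 ->
  smooth_separatrix w ell f -> ell <> 0 -> invariant_product w n r l ->
  invariant_product w n.+1 (ell * r) (f :: l).
Proof.
move=> cw1 cw2 sf ell0 [cT [vT hT] [k ck kT] sl]; rewrite /invariant_product big_cons.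
set T := \prod_(g <- l) g in cT vT hT kT *.
have [cf [f0 f1] [h ch hf] _] := sf.
have vf1 : vanish 1 f by move=> [|d].
split; first exact: convergentM.
- split; first by rewrite -add1n; exact: vanishM.
  by rewrite -add1n hpartM_shift0 // f1 hT.
- exists (h + k); first exact: convergentD.
  by rewrite vfM kT hf; ring.
by move=> g; rewrite inE => /predU1P[->|/sl //]; exists ell.
Qed.

End InvariantProducts.

Section InvariantForm.
Variable K : numClosedFieldType.
Implicit Types (f T : {fps2 K}) (w : germ2 K).

Lemma invariant_with_initial_form w n (r : {poly K}) :
  convergent w.1 -> convergent w.2 -> (size r <= n.+1)%N -> r != 0 ->
  (forall t, root r t -> exists f, smooth_separatrix w ('X - t%:P) f) ->
  (r`_n = 0 -> exists f, smooth_separatrix w 1 f) ->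
  exists T, [/\ convergent T, vanish n T /\ hpart T n = r, germ_dvd T (vf w T) &
    forall f, germ_irreducible f -> germ_dvd f T -> separatrix w f].
Proof.
move=> cw1 cw2 sr r0 sfin sinf.
have [rs rE] := closed_field_poly_normal r.
have lc0 : lead_coef r != 0 by rewrite lead_coef_eq0.
have szr : size r = (size rs).+1.
  by rewrite [in LHS]rE size_scale // size_prod_XsubC.
have rrs t : t \in rs -> root r t.
  by move=> trs; rewrite rE rootZ // root_prod_XsubC.
have [l1 Hl1] : exists l, invariant_product w (size rs) (\prod_(z <- rs) ('X - z%:P)) l.
  have : {subset rs <= rs} by [].
  elim: {1 3 4}rs => [|z s IHs] zs.
    by exists [::]; rewrite big_nil; exact: invariant_product_nil.
  have [|l Hl] := IHs; first by move=> y ys; apply: zs; rewrite inE ys orbT.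
  have [f sf] := sfin z (rrs z (zs z (mem_head _ _))).
  exists (f :: l); rewrite big_cons; apply: invariant_product_cons => //.
  by apply/eqP; rewrite polyXsubC_eq0.
(* The gap between [n] and the number of roots is the multiplicity of [x] in the form [r]; it is
   filled by separatrices tangent to [x = 0], whose linear part is 1 at [x = 1]. *)
have [l Hl] : exists l, invariant_product w n (\prod_(z <- rs) ('X - z%:P)) l.
  have [k nE] : exists k, n = (k + size rs)%N.
    by exists (n - size rs)%N; rewrite subnK // -ltnS -szr.
  case: k nE => [->|k nE]; first by exists l1.
  have [|f sf] := sinf.
    by rewrite nth_default // szr nE ltnS leq_addl.
  rewrite nE; elim: k.+1 => [|i [l Hl]]; first by exists l1.
  exists (f :: l); rewrite -[\prod_(z <- _) _]mul1r addSn.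
  by apply: invariant_product_cons => //; apply/eqP; exact: oner_neq0.
have [cT [vT hT] [k ck kT] sl] := Hl.
set T := \prod_(g <- l) g in cT vT hT kT.
exists (fconst (lead_coef r) * T); split.
- by apply: convergentM => //; exact: convergent_fconst.
- split; first by rewrite mulrC; exact: vanishMr.
  have -> := hpartM_shift0 (@vanish0 _ (fconst (lead_coef r))) vT.
  by rewrite hpart_fconst hT /= mul_polyC -rE.
- exists k => //; rewrite vfM kT /vf fconstE dx_fps_const -fconstE dy_fconst; ring.
move=> f irf fT; apply: (irreducible_dvd_prod cw1 cw2 _ _ sl irf fT).
  exact: convergent_fconst.
by apply: germ_unit_fconst; apply/eqP.
Qed.

End InvariantForm.

(** * Binary forms *)

Section BinaryForms.
Variable K : numFieldType.
Implicit Types P Q A B g h r : {poly K}.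

Lemma size_mulS a b P Q : (size P <= a.+1)%N -> (size Q <= b.+1)%N ->
  (size (P * Q)%R <= (a + b).+1)%N.
Proof.
move=> sP sQ; apply: leq_trans (size_polyMleq _ _) _.
move: sP sQ; case: (size P) (size Q) => [|p] [|q]; lia.
Qed.

(** The exact size of [P] says that the form [P] is not divisible by [x]; otherwise the degree of a
    quotient cannot be read off at [x = 1]. *)
Lemma size_divS a b P Q : size P = a.+1 -> (size (P * Q)%R <= (a + b).+1)%N ->
  (size Q <= b.+1)%N.
Proof.
move=> sP; have [-> _|Q0] := eqVneq Q 0; first by rewrite size_poly0.
have P0 : P != 0 by rewrite -size_poly_eq0 sP.
by rewrite size_mul // sP addSn /= -addnS leq_add2l.
Qed.

Lemma size_addS a P Q : (size P <= a)%N -> (size Q <= a)%N -> (size (P + Q)%R <= a)%N.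
Proof. by move=> sP sQ; rewrite (leq_trans (size_polyD _ _)) // geq_max sP. Qed.

Lemma size_subS a P Q : (size P <= a)%N -> (size Q <= a)%N -> (size (P - Q)%R <= a)%N.
Proof. by move=> sP sQ; apply: size_addS; rewrite ?size_polyN. Qed.

Lemma size_scaleS a c P : (size P <= a)%N -> (size (c *: P)%R <= a)%N.
Proof. by apply: leq_trans; exact: size_scale_leq. Qed.

Lemma size_derivS a P : (size P <= a.+1)%N -> (size P^`() <= a)%N.
Proof.
move=> sP; apply/leq_sizeP => j aj; rewrite coef_deriv nth_default ?mul0rn //.
by apply: leq_trans sP _.
Qed.

Lemma size_lead0 a P : (size P <= a.+1)%N -> P`_a = 0 -> (size P <= a)%N.
Proof.
move=> sP Pa; apply/leq_sizeP => j; rewrite leq_eqVlt => /predU1P[<- //|aj].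
by rewrite nth_default // (leq_trans sP).
Qed.

Lemma size_lead a P : (size P <= a.+1)%N -> P`_a <> 0 -> size P = a.+1.
Proof.
move=> sP Pa; apply/eqP; rewrite eqn_leq sP ltnNge; apply/negP => sa.
by apply: Pa; rewrite nth_default.
Qed.

(** By Euler's relation the polynomial is the derivative in [x] of the form [P], which has degree
    [d - 1]. *)
Lemma size_xpart d P : (size P <= d.+1)%N ->
  (size (P *+ d - 'X * P^`())%R <= d)%N.
Proof.
move=> sP; apply: size_lead0.
  apply: size_subS; first by rewrite -scaler_nat size_scaleS.
  case: d sP => [|d] sP; last by apply: (@size_mulS 1 d); rewrite ?size_polyX ?size_derivS.
  by have := size_derivS sP; rewrite leqn0 size_poly_eq0 => /eqP ->; rewrite mulr0 size_poly0.
rewrite coefB coefMn coefXM; case: d sP => [|d] _; first by rewrite mulr0n subrr.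
by rewrite coef_deriv /= subrr.
Qed.

Lemma bezout_eq1 P Q : coprimep P Q -> exists U V, U * P + V * Q = 1.
Proof.
case/Bezout_coprimepP => -[U V] /=; rewrite -size_poly_eq1 => /size_poly1P[c c0 E].
exists (c^-1 *: U), (c^-1 *: V).
by rewrite -!scalerAl -scalerDr E -mul_polyC -polyCM mulVf.
Qed.

(* Forms are given at [x = 1]; the condition on top coefficients says that [P]
   and [Q] do not both vanish in the direction [x = 0]. *)
Lemma forms_span m e P Q g : (m <= e.+2)%N -> (size P <= m.+1)%N ->
  (size Q <= m.+4)%N -> coprimep P Q -> P`_m <> 0 \/ Q`_m.+3 <> 0 ->
  (size g <= (m + e).+4.+1)%N ->
  exists A B, [/\ (size A <= e.+4.+1)%N, (size B <= e.+2)%N & g = P * A + Q * B].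
Proof.
move=> me sP sQ /bezout_eq1[U [V UV]] top sg.
have gE : g = P * (g * U) + Q * (g * V).
  by rewrite -[LHS]mulr1 -UV; ring.
case: top => [/(size_lead sP) sPm|/(size_lead sQ) sQm].
  (* Reducing modulo whichever of [P], [Q] is not divisible by [x] bounds one coefficient; the other
     is then bounded by division. *)
  pose B := (g * V) %% P; pose A := g * U + (g * V) %/ P * Q.
  have P0 : P != 0 by rewrite -size_poly_eq0 sPm.
  have sB : (size B <= m)%N by rewrite -ltnS -sPm ltn_modp.
  have E : g = P * A + Q * B.
    by rewrite [LHS]gE {1}(divp_eq (g * V) P) /A /B; ring.
  exists A, B; split=> //; last exact: leq_trans me.
  apply: (size_divS sPm); have -> : P * A = g - Q * B by rewrite {1}E addrK.
  apply: size_subS; first by apply: leq_trans sg _; lia.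
  case: m sB me {sP sPm sg} sQ => [|m] sB me sQ.
    by move: sB; rewrite leqn0 size_poly_eq0 => /eqP ->; rewrite mulr0 size_poly0.
  by apply: leq_trans (size_mulS sQ sB) _; lia.
pose A := (g * U) %% Q; pose B := g * V + (g * U) %/ Q * P.
have Q0 : Q != 0 by rewrite -size_poly_eq0 sQm.
have sA : (size A <= m.+3)%N by rewrite -ltnS -sQm ltn_modp.
have E : g = P * A + Q * B.
  by rewrite [LHS]gE {1}(divp_eq (g * U) Q) /A /B; ring.
exists A, B; split=> //; first by apply: leq_trans sA _; lia.
apply: (size_divS sQm); have -> : Q * B = g - P * A by rewrite {1}E addrAC subrr add0r.
apply: size_subS; first by apply: leq_trans sg _; lia.
by apply: leq_trans (size_mulS sP sA) _; lia.
Qed.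

(* The Jacobian determinant of forms of degrees 3 and 6, at x = 1. *)
Definition jac P Q := 3 *: (P * Q^`()) - 6 *: (P^`() * Q).

Lemma size_jac P Q : (size P <= 4)%N -> (size Q <= 7)%N -> (size (jac P Q) <= 8)%N.
Proof.
move=> sP sQ; have -> : jac P Q = (P *+ 3 - 'X * P^`()) * Q^`() - P^`() * (Q *+ 6 - 'X * Q^`()).
  by rewrite /jac -!mul_polyC !rmorph_nat; ring.
have sP' := size_derivS sP; have sQ' := size_derivS sQ.
by apply: size_subS; [apply: (@size_mulS 2 5)|apply: (@size_mulS 2 5)] => //; exact: size_xpart.
Qed.

(** Degree [7 = 3 + 6 - 2] is the socle degree of [(P, Q)]: reduction leaves a coefficient one
    degree too high, and a multiple of the Jacobian removes its top term. *)
Lemma jac_span P Q g : (size P <= 4)%N -> (size Q <= 7)%N -> coprimep P Q ->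
  P`_3 <> 0 \/ Q`_6 <> 0 -> (size g <= 8)%N ->
  exists c A B, [/\ (size A <= 5)%N, (size B <= 2)%N &
    g = c *: jac P Q + P * A + Q * B].
Proof.
move=> sP sQ /bezout_eq1[U [V UV]] top sg.
have gE : g = P * (g * U) + Q * (g * V).
  by rewrite -[LHS]mulr1 -UV; ring.
have sP' := size_derivS sP; have sQ' := size_derivS sQ.
have sJ := size_jac sP sQ.
case: top => [P3|Q6].
  have sPm := size_lead sP P3.
  pose B0 := (g * V) %% P; pose A0 := g * U + (g * V) %/ P * Q.
  have P0 : P != 0 by rewrite -size_poly_eq0 sPm.
  have sB0 : (size B0 <= 3)%N by rewrite -ltnS -sPm ltn_modp.
  (* Modulo [P] the Jacobian is [- 6 P' Q], and [6 P'] has top coefficient [18 P_3]. *)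
  pose c := - (B0`_2 / (18 * P`_3)).
  pose B := B0 + (6 * c) *: P^`(); pose A := A0 - (3 * c) *: Q^`().
  have E : g = c *: jac P Q + P * A + Q * B.
    rewrite [LHS]gE {1}(divp_eq (g * V) P) /A /B /A0 -/B0 /jac -!mul_polyC.
    by rewrite !rmorphM !rmorph_nat; ring.
  have sB : (size B <= 2)%N.
    apply: size_lead0; first by apply: size_addS => //; exact: size_scaleS.
    rewrite coefD coefZ coef_deriv /c -[P`_3 *+ 3]mulr_natr.
    by field; apply/eqP.
  exists c, A, B; split=> //; apply: (size_divS sPm).
  have -> : P * A = g - c *: jac P Q - Q * B by rewrite {1}E; ring.
  apply: size_subS; last exact: (@size_mulS 6 1).
  by apply: size_subS => //; exact: size_scaleS.
have sQm := size_lead sQ Q6.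
pose A0 := (g * U) %% Q; pose B0 := g * V + (g * U) %/ Q * P.
have Q0 : Q != 0 by rewrite -size_poly_eq0 sQm.
have sA0 : (size A0 <= 6)%N by rewrite -ltnS -sQm ltn_modp.
pose c := A0`_5 / (18 * Q`_6).
pose B := B0 + (6 * c) *: P^`(); pose A := A0 - (3 * c) *: Q^`().
have E : g = c *: jac P Q + P * A + Q * B.
  rewrite [LHS]gE {1}(divp_eq (g * U) Q) /A /B /B0 -/A0 /jac -!mul_polyC.
  by rewrite !rmorphM !rmorph_nat; ring.
have sA : (size A <= 5)%N.
  apply: size_lead0; first by apply: size_subS => //; exact: size_scaleS.
  rewrite coefB coefZ coef_deriv /c -[Q`_6 *+ 6]mulr_natr.
  by field; apply/eqP.
exists c, A, B; split=> //; apply: (size_divS sQm).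
have -> : Q * B = g - c *: jac P Q - P * A by rewrite {1}E; ring.
apply: size_subS; last exact: (@size_mulS 3 4).
by apply: size_subS => //; exact: size_scaleS.
Qed.

(** Every form of positive degree is the contraction of [x dy - y dx] with some homogeneous vector
    field. *)
Lemma euler_split n h : (size h <= n.+2)%N -> exists A B,
  [/\ (size A <= n.+1)%N, (size B <= n.+1)%N & B - 'X * A = h].
Proof.
move=> sh; exists (- (\poly_(i < n.+1) h`_i.+1)), (h`_0)%:P; split.
- by rewrite size_polyN size_poly.
- by apply: leq_trans (size_polyC_leq1 _) _.
apply/polyP => -[|i]; rewrite coefB coefXM coefC /= ?subr0 //.
rewrite sub0r coefN opprK coef_poly; case: ltnP => // ni.
by rewrite nth_default // (leq_trans sh).
Qed.

(** As forms, [Q = x a + y b] and [6 Q = x Q_x + y Q_y], so [6 a - Q_x = - y k] and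
    [6 b - Q_y = x k] for some form [k] of degree 4. Hence [6 (b P_x - a P_y)] is the Jacobian plus
    [k (x P_x + y P_y) = 3 k P], and [U] is [3 k]. *)
Lemma jac_wedge P Q (a b : {poly K}) : (size a <= 6)%N -> (size b <= 6)%N -> a + 'X * b = Q ->
  (size P <= 4)%N -> exists2 U : {poly K}, (size U <= 5)%N &
  6 *: (b * (P *+ 3 - 'X * P^`()) - a * P^`()) = jac P Q + P * U.
Proof.
move=> sa sb <- sP; exists (18 *: b - 3 *: (a + 'X * b)^`()).
  apply: size_lead0.
    apply: size_subS; apply: size_scaleS => //; apply: size_derivS.
    apply: size_addS; first exact: leq_trans sa _.
    by apply: (@size_mulS 1 5); rewrite ?size_polyX.
  rewrite coefB !coefZ coef_deriv coefD coefXM /= [a`_6]nth_default // add0r.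
  by rewrite -mulr_natr; ring.
by rewrite /jac -!mul_polyC !rmorph_nat; ring.
Qed.

(* [r] and [r1] are the two lowest homogeneous parts of an invariant curve [T],
   and the last hypothesis is the part of degree 10 of [v(T) = g T]. *)
Lemma invariant_second_part P Q (a b r r1 g : {poly K}) (lam : K) :
  (size P <= 4)%N -> (size Q <= 7)%N -> coprimep P Q -> P`_3 <> 0 \/ Q`_6 <> 0 ->
  (size a <= 6)%N -> (size b <= 6)%N -> a + 'X * b = Q ->
  r = Q + lam *: P ^+ 2 -> r <> 0 -> (size r1 <= 8)%N -> (size g <= 5)%N ->
  P * r1 = a * r^`() - b * (r *+ 6 - 'X * r^`()) - r * g ->
  exists2 L : {poly K}, (size L <= 2)%N & r1 = - (lam / 3) *: jac P Q + L * r.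
Proof.
move=> sP sQ cPQ top sa sb abQ rE r0 sr1 sg E.
have P0 : P <> 0.
  move=> P0; case: top => [|Q6]; first by rewrite P0 coef0.
  move: cPQ; rewrite P0 coprime0p => /eqp_size; rewrite size_poly1.
  by rewrite (size_lead sQ Q6).
have sr : (size r <= 7)%N.
  by rewrite rE; apply: size_addS => //; apply: size_scaleS; apply: (@size_mulS 3 3).
have cPr : coprimep P r.
  by rewrite rE expr2 scalerAl addrC coprimep_addl_mul.
(* Eliminating [a] and [Q] in favour of [r] makes [r] a factor of the right side; being coprime to
   [r], [P] divides the other factor. *)
have E1 : P * (r1 + lam *: (P * r^`())) = (r^`() - 6 *: b - g) * r.
  have QE : Q = r - lam *: P ^+ 2 by rewrite rE addrK.
  have -> : P * (r1 + lam *: (P * r^`())) = P * r1 + lam *: P ^+ 2 * r^`().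
    by rewrite -!mul_polyC; ring.
  rewrite E -!mul_polyC !rmorph_nat.
  have -> : a = Q - 'X * b by rewrite -abQ addrK.
  by rewrite QE -!mul_polyC; ring.
have : P %| (r^`() - 6 *: b - g) * r by rewrite -E1 dvdp_mulIl.
rewrite Gauss_dvdpl // => /dvdpP[k kE].
have E2 : r1 + lam *: (P * r^`()) = k * r.
  have : P * (r1 + lam *: (P * r^`()) - k * r) = 0.
    by rewrite mulrBr E1 kE; ring.
  by move/eqP; rewrite mulf_eq0 => /orP[/eqP //|]; rewrite subr_eq0 => /eqP.
pose L := k - (2 * lam) *: P^`().
have jr : jac P Q = 3 *: (P * r^`()) - 6 *: (P^`() * r).
  by rewrite /jac rE derivD derivZ expr2 derivM -!mul_polyC !rmorph_nat; ring.
have [mu muE] : exists mu, mu = lam / 3 by exists (lam / 3).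
have lamE : lam = 3 * mu by rewrite muE; field.
have r1E : r1 = - mu *: jac P Q + L * r.
  have -> : r1 = k * r - lam *: (P * r^`()) by rewrite -E2 addrK.
  by rewrite /L jr lamE -!mul_polyC !rmorphM !rmorphN /= !rmorph_nat; ring.
exists L; last by rewrite -muE.
(* If [r] is divisible by [x], the size of [r L] says nothing about that of [L]. Then [P] is not
   divisible by [x], and the same argument on the derivative in [x] expresses [y L] by a quotient by
   [P]. *)
case: (eqVneq r`_6 0) => [r6|/eqP r6]; last first.
  apply: (size_divS (size_lead sr r6)).
  have -> : r * L = r1 + mu *: jac P Q by rewrite r1E scaleNr; ring.
  by apply: size_addS => //; apply: size_scaleS; exact: size_jac.
have P3 : P`_3 <> 0.
  case: top => // Q6 P3; apply: Q6; move: r6; rewrite rE coefD coefZ.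
  have sP3 := size_lead0 sP P3.
  by rewrite [(P ^+ 2)`_6]nth_default ?mulr0 ?addr0 // (leq_trans (@size_mulS 2 2 _ _ _ _)).
have sPm := size_lead sP P3.
pose rx := r *+ 6 - 'X * r^`().
have E3 : (6 *: a - 'X * g - rx) = P * ('X * L - (2 * lam) *: (P *+ 3 - 'X * P^`())).
  have : r * ((6 *: a - 'X * g - rx) - P * ('X * L - (2 * lam) *: (P *+ 3 - 'X * P^`()))) = 0.
    have XE : 'X * (P * r1) = 'X * (a * r^`() - b * rx - r * g) by rewrite E.
    have aE : a = r - lam *: P ^+ 2 - 'X * b by rewrite rE addrK -abQ addrK.
    apply: (addrI ('X * (P * r1))); rewrite addr0 [RHS]XE r1E jr lamE.
    by rewrite aE /rx lamE -!mul_polyC !rmorphM !rmorphN /= !rmorph_nat; ring.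
  by move/eqP; rewrite mulf_eq0 => /orP[/eqP //|]; rewrite subr_eq0 => /eqP.
have sX n (p : {poly K}) : (size p <= n.+1)%N -> (size ('X * p)%R <= n.+2)%N.
  by move=> sp; apply: (@size_mulS 1 n); rewrite ?size_polyX.
have sW : (size ('X * L - (2 * lam) *: (P *+ 3 - 'X * P^`()))%R <= 3)%N.
  apply: (size_divS sPm); rewrite -E3; apply: size_subS; last exact: size_xpart.
  by apply: size_subS; [exact: size_scaleS|exact: sX].
have sXL : (size ('X * L)%R <= 3)%N.
  rewrite -['X * L](subrK ((2 * lam) *: (P *+ 3 - 'X * P^`()))).
  by apply: size_addS => //; apply: size_scaleS; exact: size_xpart.
by apply: (@size_divS 1 1 'X) => //; rewrite size_polyX.
Qed.

End BinaryForms.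

Local Arguments fps_coef : simpl never.
(** * Foliations that are regular after one blow-up *)

Section Regularity.
Variable K : numClosedFieldType.
Implicit Types (f : {fps2 K}) (w eta : germ2 K).

(** The part of degree [d.+1] of [x a + y b]; in a chart it gives the coefficient of [x^d] in the
    [dx] component of the pull-back. *)
Definition dpart w d : {poly K} := hpart w.1 d + 'X * hpart w.2 d.

Lemma size_dpart w d : (size (dpart w d) <= d.+2)%N.
Proof.
apply: size_addS; first exact: leqW (size_hpart _ _).
by apply: (@size_mulS _ 1 d); rewrite ?size_polyX ?size_hpart.
Qed.

Lemma fps_of_polyE (p : {poly K}) i : fps_of_poly p i = p`_i.
Proof. by []. Qed.

Lemma tau_coef0 t f i : tau t f i 0%N = (hpart f i).[t].
Proof.
by rewrite tauE fps_of_polyE -horner_coef0 horner_comp !hornerE.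
Qed.

Lemma tau_dpart t w i : (tau t w.1 + tau t w.2 * (fconst t + vary K)) i =
  fps_of_poly (dpart w i \Po ('X + t%:P)).
Proof.
rewrite fpsD chart_fin_direction mulrC fps_constM !tauE -rmorphM -rmorphD /=.
by rewrite /dpart comp_polyD comp_polyM comp_polyX.
Qed.

Lemma fps_of_poly_comp_eq0 t (p : {poly K}) :
  fps_of_poly (p \Po ('X + t%:P)) = 0 -> p = 0.
Proof.
move=> /fpsP p0; apply/eqP; rewrite -(@comp_poly2_eq0 _ p ('X + t%:P)) ?size_XaddC //.
by apply/eqP/polyP => j; have := p0 j; rewrite fps_of_polyE coef0.
Qed.

(** The pull-back has components [dpart w i] at [t + y] times [x^i], and [hpart w.2 i] at [t + y]
    times [x^(i+1)]. Comparing with [x^k eta] bounds [k] and gives [eta] at the origin; the shift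
    between the two components is why [k = 0] forces [eta.2] to vanish there. *)
Lemma regular_at_fin w t : regular_at (chart_fin t) w -> exists eta k,
  [/\ convergent eta.1 /\ convergent eta.2,
      pullback (chart_fin t) w = (varx K ^+ k * eta.1, varx K ^+ k * eta.2) /\
        nonsingular eta,
      (forall i, (i < k)%N -> dpart w i = 0) /\ eta.1 0%N 0%N = (dpart w k).[t],
      (forall i, (i.+1 < k)%N -> hpart w.2 i = 0) &
      eta.2 0%N 0%N = if k is k'.+1 then (hpart w.2 k').[t] else 0].
Proof.
move=> [eta [[ce1 ce2 _] [k E]] ns]; exists eta, k; split=> //.
- move: E; rewrite pullback_fin => E.
  have E1 : tau t w.1 + tau t w.2 * (fconst t + vary K) = varx K ^+ k * eta.1 := congr1 fst E.
  have E1i i : fps_of_poly (dpart w i \Po ('X + t%:P)) = (varx K ^+ k * eta.1) i.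
    by rewrite -E1 tau_dpart.
  split=> [i ik|].
    have := E1i i; rewrite varxE fmonoX mul1n fmonoM leqNgt ik.
    exact: fps_of_poly_comp_eq0.
  have := E1i k; rewrite varxE fmonoX mul1n fmonoM leqnn subnn => <-.
  by rewrite fps_of_polyE -horner_coef0 horner_comp !hornerE.
all: move: E; rewrite pullback_fin => E.
all: have E2 : tau t w.2 * varx K = varx K ^+ k * eta.2 := congr1 snd E.
all: have E2i i : (varx K * tau t w.2) i = (varx K ^+ k * eta.2) i by rewrite -E2 mulrC.
- move=> i ik; have := E2i i.+1.
  rewrite varxE fmonoX mul1n !fmonoM subn1 [(k <= _)%N]leqNgt ik.
  exact: fps_of_poly_comp_eq0.
case: k {E E2} E2i => [|k] E2i.
  by have := E2i 0%N; rewrite varxE fmonoX mul1n !fmonoM subn0 /= => <-.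
have := E2i k.+1; rewrite varxE fmonoX mul1n !fmonoM leqnn subnn subn1 => <-.
exact: tau_coef0.
Qed.

(** The non-dicritical case: the exceptional divisor is invariant, and the zeros of [dpart w m] are
    singular points on it. *)
Lemma regular_dpart w t m : vanish m w.1 -> vanish m w.2 -> dpart w m != 0 ->
  regular_at (chart_fin t) w -> (dpart w m).[t] != 0.
Proof.
move=> v1 v2 /eqP d0 /regular_at_fin[eta [k [_ [_ ns] [dk e1] _ e2]]].
have km : (k <= m)%N by rewrite leqNgt; apply/negP => /dk.
have eta2 : eta.2 0%N 0%N = 0.
  by rewrite e2; case: k km {dk e1 e2} => // k km; rewrite v2 ?horner0.
case: ns; rewrite ?eta2 // e1; move: km; rewrite leq_eqVlt => /predU1P[-> /eqP //|km].
by rewrite /dpart v1 // v2 // mulr0 addr0 horner0.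
Qed.

(** Here exactly [x^(m+1)] is divided out, so that [eta] at the point has components [dpart w m.+1]
    and [hpart w.2 m] evaluated at [t]; where the second is nonzero, the foliation is transversal to
    the exceptional divisor. *)
Lemma regular_dicritical w t m : vanish m w.1 -> vanish m w.2 -> dpart w m = 0 ->
  hpart w.2 m <> 0 -> regular_at (chart_fin t) w ->
  ((dpart w m.+1).[t] != 0 \/ (hpart w.2 m).[t] != 0) /\
  ((hpart w.2 m).[t] != 0 -> exists eta k, [/\ convergent eta.1, convergent eta.2,
    eta.2 0%N 0%N <> 0 &
    pullback (chart_fin t) w = (varx K ^+ k * eta.1, varx K ^+ k * eta.2)]).
Proof.
move=> v1 v2 d0 b0 /regular_at_fin[eta [k [[ce1 ce2] [E ns] [dk e1] bk e2]]].
have km : (k <= m.+1)%N by rewrite leqNgt; apply/negP => /bk.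
have kE : k = m.+1.
  apply/eqP; rewrite eqn_leq km /= ltnNge; apply/negP => {}km.
  have eta2 : eta.2 0%N 0%N = 0.
    by rewrite e2; case: k km {dk e1 e2 bk E} => // k km; rewrite v2 ?horner0.
  case: ns; rewrite ?eta2 // e1; move: km; rewrite leq_eqVlt => /predU1P[->|km].
    by rewrite d0 horner0.
  by rewrite /dpart v1 // v2 // mulr0 addr0 horner0.
rewrite kE in e1 e2; split; first by case: ns; rewrite ?e1 ?e2 => /eqP; [left|right].
by move=> P0; exists eta, k; split=> //; rewrite e2; apply/eqP.
Qed.

Lemma coef_dpart_swap w d j : (j <= d.+1)%N ->
  (dpart (swapg w) d)`_j = (dpart w d)`_(d.+1 - j)%N.
Proof.
rewrite /dpart /= !coefD !coefXM; case: j => [_|j].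
  rewrite subn0 /= [X in _ = X + _]nth_default ?size_hpart // addr0 add0r.
  by rewrite coef_hpart_swap ?subn0.
rewrite ltnS => jd; rewrite subSS /= [(hpart (swap w.1) d)`_j]coef_hpart_swap //.
rewrite addrC; congr (_ + _); move: jd; rewrite leq_eqVlt => /predU1P[->|jd].
  by rewrite subnn /= nth_default ?size_hpart.
by rewrite subn_eq0 leqNgt jd /= coef_hpart_swap // subnS.
Qed.

Lemma vanish_swap n f : vanish n f -> vanish n (swap f).
Proof.
move=> fn d dn; apply/polyP => j; rewrite coef0; case: (leqP j d) => jd.
  by rewrite coef_hpart_swap // fn // coef0.
by rewrite coef_hpart leqNgt jd.
Qed.

(* Here the multiplicity is [m.+1]. *)
Record dicritical_data w m : Prop := DicriticalData {
  dd_conv1 : convergent w.1;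
  dd_conv2 : convergent w.2;
  dd_vanish1 : vanish m.+1 w.1;
  dd_vanish2 : vanish m.+1 w.2;
  dd_cone : hpart w.1 m.+1 = - ('X * hpart w.2 m.+1);
  dd_size : (size (hpart w.2 m.+1) <= m.+1)%N;
  dd_neq0 : hpart w.2 m.+1 != 0;
  dd_coprime : coprimep (hpart w.2 m.+1) (dpart w m.+2);
  dd_top : (hpart w.2 m.+1)`_m <> 0 \/ (dpart w m.+2)`_m.+3 <> 0;
  dd_sep_fin : forall t, (hpart w.2 m.+1).[t] != 0 ->
    exists f, smooth_separatrix w ('X - t%:P) f;
  dd_sep_inf : (hpart w.2 m.+1)`_m <> 0 -> exists f, smooth_separatrix w 1 f }.

Lemma regular_dicritical_data w m : foliation w -> multiplicity w m ->
  regular_after_blowup w -> exists2 m', m = m'.+1 & dicritical_data w m'.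
Proof.
move=> [cw1 cw2 _] [wm [i0 [j0 [ijm ij0]]]] [regfin reginf].
have v1 : vanish m w.1.
  move=> d dm; apply/polyP => j; rewrite coef_hpart coef0; case: leqP => // jd.
  by case: (wm (d - j)%N j); rewrite ?subnK.
have v2 : vanish m w.2.
  move=> d dm; apply/polyP => j; rewrite coef_hpart coef0; case: leqP => // jd.
  by case: (wm (d - j)%N j); rewrite ?subnK.
have {}reginf := (regular_at_inf w).1 reginf.
have dm0 : dpart w m = 0.
  apply/eqP; apply: contraT => d0.
  (* A nonzero form of degree [m + 1 >= 1] vanishes in some direction. Without finite zeros it is a
     multiple of [x^(m+1)], which vanishes in the direction [[0 : 1]]. *)
  have noroot t := regular_dpart v1 v2 d0 (regfin t).
  have : size (dpart w m) == 1%N.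
    by apply: contraT => /closed_rootP[t]; rewrite rootE (negbTE (noroot t)).
  case/size_poly1P => c c0 dc.
  have sd0 : dpart (swapg w) m != 0.
    apply: contraNneq c0 => s0; have := coef_dpart_swap w (leqnn m.+1).
    by rewrite subnn dc coefC eqxx s0 coef0 => <-.
  have := @regular_dpart (swapg w) 0 m (vanish_swap v2) (vanish_swap v1) sd0 reginf.
  by rewrite horner_coef0 coef_dpart_swap // subn0 dc coefC eqxx.
have aE : hpart w.1 m = - ('X * hpart w.2 m).
  by apply/eqP; rewrite -addr_eq0; apply/eqP.
have b0 : hpart w.2 m <> 0.
  move=> b0; move: aE; rewrite b0 mulr0 oppr0 => a0.
  by case: ij0; apply; rewrite hpartE ijm ?a0 ?b0 coef0.
have sb : (size (hpart w.2 m) <= m)%N.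
  rewrite -ltnS -(size_mulX (introN eqP b0)) commr_polyX -size_polyN -aE.
  exact: size_hpart.
(* For [m = 0] the degree [m - 1] of the nonzero form [P] would be negative. *)
case: m v1 v2 dm0 aE b0 sb {wm ijm ij0} => [|m] v1 v2 dm0 aE b0 sb.
  by case: b0; apply/eqP; rewrite -size_poly_eq0 -leqn0.
exists m => //.
have regt t := regular_dicritical v1 v2 dm0 b0 (regfin t).
have sdm0 : dpart (swapg w) m.+1 = 0.
  apply/polyP => j; rewrite coef0; case: (leqP j m.+2) => jm.
    by rewrite coef_dpart_swap // dm0 coef0.
  by rewrite nth_default // (leq_trans (size_dpart _ _)).
have sb0 : hpart (swapg w).2 m.+1 <> 0.
  move=> /= sa0; apply: b0; have : 'X * hpart w.2 m.+1 = 0.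
    rewrite -[LHS]opprK -aE; apply/eqP; rewrite oppr_eq0; apply/eqP/polyP => j.
    rewrite coef0; case: (leqP j m.+1) => jm; last by rewrite coef_hpart leqNgt jm.
    have := coef_hpart_swap w.1 (leq_subr j m.+1).
    by rewrite subKn // => <-; rewrite sa0 coef0.
  by move/eqP; rewrite mulf_eq0 polyX_eq0 => /eqP.
have [reg0 sep0] := @regular_dicritical (swapg w) 0 _ (vanish_swap v2) (vanish_swap v1) sdm0 sb0 reginf.
have E0 : (hpart (swapg w).2 m.+1).[0] = - (hpart w.2 m.+1)`_m.
  rewrite horner_coef0 /= coef_hpart_swap // subn0 aE coefN coefXM //.
split=> //.
- exact/eqP.
- apply/Pdiv.ClosedField.coprimepP => t; rewrite rootE => P0.
  by have [[//|]] := regt t; rewrite P0.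
- case: reg0 => [|]; rewrite ?E0 ?oppr_eq0 => /eqP; last by left.
  by rewrite horner_coef0 coef_dpart_swap // subn0; right.
- move=> t Pt; have [_ /(_ Pt)[eta [k [c1 c2 e2 E]]]] := regt t.
  exact: separatrix_fin E.
move=> /eqP Pm; have [|eta [k [c1 c2 e2 E]]] := sep0; first by rewrite E0 oppr_eq0.
by apply: separatrix_inf c1 c2 e2 _ => //; rewrite pullback_inf; exact: E.
Qed.

End Regularity.

(** * Multiplicity at most four *)

Section LowMultiplicity.
Variable K : numClosedFieldType.
Implicit Types (f T : {fps2 K}) (w X Y : germ2 K).

Lemma vanish_dy n f : vanish n.+1 f -> vanish n (dy f).
Proof. by move=> fn d dn; rewrite hpart_dy fn // linear0. Qed.

Lemma vanish_dx n f : vanish n.+1 f -> vanish n (dx f).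
Proof. by move=> fn d dn; rewrite hpart_dx fn // linear0 mul0rn mulr0 subr0. Qed.

Section Data.
Variables (w : germ2 K) (m : nat).
Hypothesis D : dicritical_data w m.
Let P := hpart w.2 m.+1.
Let Q := dpart w m.+2.

Lemma tang_vanish X k : vanish k X.1 -> vanish k X.2 -> vanish (m.+1 + k) (tang w X).
Proof.
by move=> X1 X2; apply: vanishD; apply: vanishM => //; [exact: dd_vanish1 D|exact: dd_vanish2 D].
Qed.

Lemma tang_hpart0 X k : vanish k X.1 -> vanish k X.2 ->
  hpart (tang w X) (m.+1 + k)%N = P * (hpart X.2 k - 'X * hpart X.1 k).
Proof.
move=> X1 X2; rewrite (hpartD_eq (hpartM_shift0 (dd_vanish1 D) X1)
  (hpartM_shift0 (dd_vanish2 D) X2)).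
by rewrite (dd_cone D) -/P; ring.
Qed.

Lemma tang_hpart1 X k : vanish k X.1 -> vanish k X.2 ->
  hpart (tang w X) (m.+1 + k).+1 = P * (hpart X.2 k.+1 - 'X * hpart X.1 k.+1)
    + (hpart w.1 m.+2 * hpart X.1 k + hpart w.2 m.+2 * hpart X.2 k).
Proof.
move=> X1 X2; rewrite (hpartD_eq (hpartM_shift1 (dd_vanish1 D) X1)
  (hpartM_shift1 (dd_vanish2 D) X2)).
by rewrite (dd_cone D) -/P; ring.
Qed.

Lemma tang_hpart2 X k : vanish k X.1 -> vanish k X.2 ->
  hpart (tang w X) (m.+1 + k).+2 = P * (hpart X.2 k.+2 - 'X * hpart X.1 k.+2)
    + (hpart w.1 m.+2 * hpart X.1 k.+1 + hpart w.2 m.+2 * hpart X.2 k.+1)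
    + (hpart w.1 m.+3 * hpart X.1 k + hpart w.2 m.+3 * hpart X.2 k).
Proof.
move=> X1 X2; rewrite (hpartD_eq (hpartM_shift2 (dd_vanish1 D) X1)
  (hpartM_shift2 (dd_vanish2 D) X2)).
by rewrite (dd_cone D) -/P; ring.
Qed.

Lemma high_order_in_ideal e F : (m <= e.+2)%N -> convergent F ->
  vanish (m + e).+4 F -> exists Y : germ2 K,
    [/\ convergent Y.1 /\ convergent Y.2, vanish 2 Y.1 /\ vanish 2 Y.2 &
        F = tang w Y].
Proof.
move=> me; apply: ideal_contains_power; [exact: dd_conv1 D|exact: dd_conv2 D|].
move=> j jN; have sX : (size ('X^j : {poly K}) <= (m + e).+4.+1)%N by rewrite size_polyXn.
have [A [B [sA sB E]]] := forms_span me (dd_size D) (size_dpart w m.+2)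
  (dd_coprime D) (dd_top D) sX.
have [Y1 [Y2 [sY1 sY2 YE]]] := euler_split sA.
have sXB : (size ('X * B)%R <= e.+3)%N.
  by apply: (@size_mulS _ 1 e.+1); rewrite ?size_polyX.
(* The initial part of [w] kills [B] times the radial field, so this term first contributes one
   degree higher, by [Q B]; there the field [(Y1, Y2)] contributes [P A]. *)
pose Y : germ2 K := (homform e.+3 Y1 + homform e.+2 B, homform e.+3 Y2 + homform e.+2 ('X * B)).
have v1 : vanish e.+2 Y.1 by apply: vanishD; exact: vanish_homform.
have v2 : vanish e.+2 Y.2 by apply: vanishD; exact: vanish_homform.
have hY1 d : hpart Y.1 d = (if d == e.+3 then Y1 else 0) + (if d == e.+2 then B else 0).
  by rewrite raddfD fpsD !hpart_homform // (leq_trans sB).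
have hY2 d : hpart Y.2 d = (if d == e.+3 then Y2 else 0) + (if d == e.+2 then 'X * B else 0).
  by rewrite raddfD fpsD !hpart_homform.
exists Y; split.
- by split; apply: convergentD; exact: convergent_homform.
- by split; [apply: vanishW v1|apply: vanishW v2].
have NE : (m + e).+4 = (m.+1 + e.+2).+1 by lia.
have e23 : (e.+2 == e.+3) = false by lia.
have e32 : (e.+3 == e.+2) = false by lia.
move=> d; rewrite ltnS => dN; rewrite hpartB hpart_monomial //.
move: dN; rewrite leq_eqVlt => /predU1P[->|dN].
  rewrite eqxx NE tang_hpart1 // !hY1 !hY2 !eqxx e23 e32 !add0r !addr0 YE.
  by rewrite E /Q /dpart -/P; ring.
rewrite (ltn_eqF dN) sub0r; move: dN; rewrite NE ltnS leq_eqVlt => /predU1P[->|dN].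
  by rewrite tang_hpart0 // hY1 hY2 eqxx e23 !add0r subrr mulr0 oppr0.
by rewrite (tang_vanish v1 v2) // oppr0.
Qed.

(** Terms of degree [k] enter [w(X)] from degree [m.+1 + k] on, and only degrees up to [m.+4] have
    to be adjusted, so terms of degree at most 3 suffice. *)
Definition radial_field (A2 B2 A3 B3 : {poly K}) : germ2 K :=
  (varx K + homform 2 A2 + homform 3 A3, vary K + homform 2 B2 + homform 3 B3).

(** A difference of high order is itself [w(Y)] with [Y] of order at least 2, and adding [Y] keeps
    the field radial. *)
Lemma homogeneous_dicritical_from e T (A2 B2 A3 B3 : {poly K}) :
  (m <= e.+2)%N -> regular_after_blowup w -> convergent T -> T <> 0 ->
  (forall f, germ_irreducible f -> germ_dvd f T -> separatrix w f) ->
  vanish (m + e).+4 (T - tang w (radial_field A2 B2 A3 B3)) ->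
  homogeneous_dicritical w.
Proof.
move=> me reg cT T0 Tinv; set X0 := radial_field _ _ _ _ => TX0.
have c1 : convergent X0.1.
  by do 2?apply: convergentD; try exact: convergent_homform; exact: convergent_varx.
have c2 : convergent X0.2.
  by do 2?apply: convergentD; try exact: convergent_homform; exact: convergent_vary.
have cTX : convergent (T - tang w X0).
  apply: convergentB => //; apply: convergentD; apply: convergentM => //.
    exact: dd_conv1 D.
  exact: dd_conv2 D.
have [Y [[cY1 cY2] [vY1 vY2] YE]] := high_order_in_ideal me cTX TX0.
have TE : T = tang w (X0.1 + Y.1, X0.2 + Y.2).
  rewrite -[T](subrK (tang w X0)) YE /Defs.contract /=; ring.
split=> //; exists (X0.1 + Y.1, X0.2 + Y.2); rewrite -TE; split=> //.
split; [exact: convergentD|exact: convergentD|].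
have hom_small n (p : {poly K}) i j : (n > 1)%N -> (i + j <= 1)%N -> homform n p i j = 0.
  by move=> n1 ij; rewrite -[LHS]/(if (i + j == n)%N then _ else _) ltn_eqF // (leq_ltn_trans ij).
move=> i j ij; rewrite /= !fpsD !hom_small // !addr0.
by rewrite (vanish_coef vY1) ?ltnS // (vanish_coef vY2) ?ltnS // !addr0.
Qed.

Lemma hpart_radial_field (A2 B2 A3 B3 : {poly K}) :
  (size A2 <= 3)%N -> (size B2 <= 3)%N -> (size A3 <= 4)%N -> (size B3 <= 4)%N ->
  let X0 := radial_field A2 B2 A3 B3 in
  [/\ vanish 1 X0.1 /\ vanish 1 X0.2, hpart X0.1 1 = 1 /\ hpart X0.2 1 = 'X,
      hpart X0.1 2 = A2 /\ hpart X0.2 2 = B2 & hpart X0.1 3 = A3 /\ hpart X0.2 3 = B3].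
Proof.
move=> sA2 sB2 sA3 sB3 X0.
have E1 d : hpart X0.1 d = (if d == 1%N then 1 else 0) + (if d == 2 then A2 else 0)
    + (if d == 3 then A3 else 0).
  have -> : hpart X0.1 = hpart (varx K) + hpart (homform 2 A2) + hpart (homform 3 A3).
    by rewrite !raddfD.
  by rewrite !fpsD !hpart_homform // hpart_varx /fps_coef /=; case: (d == 1%N).
have E2 d : hpart X0.2 d = (if d == 1%N then 'X else 0) + (if d == 2 then B2 else 0)
    + (if d == 3 then B3 else 0).
  have -> : hpart X0.2 = hpart (vary K) + hpart (homform 2 B2) + hpart (homform 3 B3).
    by rewrite !raddfD.
  rewrite !fpsD !hpart_homform // hpart_vary fps_constM /fps_coef /=.
  by case: (d == 1%N); rewrite ?mulr1 ?mulr0.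
by split; split; rewrite ?E1 ?E2 /= ?add0r ?addr0 // => -[|d]; rewrite ?E1 ?E2 /= ?addr0.
Qed.

Lemma tang_radial_field (A2 B2 A3 B3 : {poly K}) :
  (size A2 <= 3)%N -> (size B2 <= 3)%N -> (size A3 <= 4)%N -> (size B3 <= 4)%N ->
  let T0 := tang w (radial_field A2 B2 A3 B3) in
  [/\ vanish m.+3 T0, hpart T0 m.+3 = P * (B2 - 'X * A2) + Q &
      hpart T0 m.+4 = P * (B3 - 'X * A3)
        + (hpart w.1 m.+2 * A2 + hpart w.2 m.+2 * B2) + dpart w m.+3].
Proof.
move=> sA2 sB2 sA3 sB3 T0; have := hpart_radial_field sA2 sB2 sA3 sB3.
rewrite /T0; set X0 := radial_field _ _ _ _ => -[[v1 v2] [h11 h12] [h21 h22] [h31 h32]].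
have mE : m.+2 = (m.+1 + 1)%N by rewrite addn1.
have T1 := tang_hpart0 v1 v2; have T2 := tang_hpart1 v1 v2; have T3 := tang_hpart2 v1 v2.
rewrite -mE h11 h12 h21 h22 ?h31 ?h32 !mulr1 in T1 T2 T3.
split.
- by apply: vanishS; [rewrite mE; exact: tang_vanish|rewrite T1 subrr mulr0].
- by rewrite T2 /Q /dpart; ring.
- by rewrite T3 /dpart; ring.
Qed.

Lemma invariant_curve (r : {poly K}) : (size r <= m.+4)%N -> r != 0 ->
  coprimep P r -> (r`_m.+3 = 0 -> P`_m <> 0) ->
  exists T, [/\ convergent T, vanish m.+3 T /\ hpart T m.+3 = r, germ_dvd T (vf w T) &
    forall f, germ_irreducible f -> germ_dvd f T -> separatrix w f].
Proof.
move=> sr r0 cPr rtop.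
apply: invariant_with_initial_form => //; [exact: dd_conv1 D|exact: dd_conv2 D| |].
  move=> t rt; apply: (dd_sep_fin D); rewrite coprimep_sym in cPr.
  exact: coprimep_root cPr rt.
by move=> /rtop; exact: dd_sep_inf D.
Qed.

Lemma homogeneous_dicritical_le3 : (m <= 2)%N -> regular_after_blowup w ->
  homogeneous_dicritical w.
Proof.
move=> m2 reg.
(* The cubic form is [c x^3]: it makes [r] nonzero when [Q = 0], and leaves the top coefficient of
   [r] equal to that of [Q]. *)
have [c r0] : exists c : K, Q + c%:P * P != 0.
  have [Q0|Q0] := eqVneq Q 0; last by exists 0; rewrite mul0r addr0.
  by exists 1; rewrite Q0 add0r mul1r; exact: dd_neq0 D.
have sP := dd_size D; have sQ := size_dpart w m.+2.
have sc : (size (c%:P * P)%R <= m.+1)%N by rewrite mul_polyC size_scaleS.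
have [||||T [cT [vT hT] _ Tinv]] := @invariant_curve (Q + c%:P * P).
- by apply: size_addS => //; apply: leq_trans sc _; lia.
- exact: r0.
- by rewrite addrC coprimep_addl_mul; exact: dd_coprime D.
- rewrite coefD [(c%:P * P)`_ _]nth_default ?addr0; last by apply: leq_trans sc _; lia.
  by case: (dd_top D).
have [|||| v0 h0 _] := @tang_radial_field 0 c%:P 0 0; rewrite ?size_poly0 //.
  by apply: leq_trans (size_polyC_leq1 _) _.
apply: (@homogeneous_dicritical_from 0 T 0 c%:P 0 0) => //.
  by move=> T0; move/eqP: r0; apply; rewrite -hT T0 raddf0.
rewrite addn0; apply: vanishS; first by apply: vanishD => //; exact: vanishN.
by rewrite hpartB hT h0; ring.
Qed.

End Data.

Lemma homogeneous_dicritical_4 w : dicritical_data w 3 -> regular_after_blowup w ->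
  homogeneous_dicritical w.
Proof.
move=> D reg; pose P := hpart w.2 4; pose Q := dpart w 5.
pose a := hpart w.1 5; pose b := hpart w.2 5.
have sP : (size P <= 4)%N := dd_size D.
have sQ : (size Q <= 7)%N := size_dpart w 5.
have cPQ : coprimep P Q := dd_coprime D.
have top : P`_3 <> 0 \/ Q`_6 <> 0 := dd_top D.
have sa : (size a <= 6)%N := size_hpart _ _.
have sb : (size b <= 6)%N := size_hpart _ _.
have [c [A [B [sA sB qE]]]] := jac_span sP sQ cPQ top (size_dpart w 6).
(* The value for which the multiples of [jac P Q] cancel in degree 7. *)
pose lam := - (18 / 7 * c).
pose r := Q + lam *: P ^+ 2.
have sP2 : (size (P ^+ 2)%R <= 7)%N by apply: (@size_mulS _ 3 3).
have sr : (size r <= 7)%N by apply: size_addS => //; exact: size_scaleS.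
have cPr : coprimep P r by rewrite /r expr2 scalerAl addrC coprimep_addl_mul.
have rtop : r`_6 = 0 -> P`_3 <> 0.
  move=> + P3; case: top => // Q6; rewrite coefD coefZ.
  rewrite [(P ^+ 2)`_6]nth_default ?mulr0 ?addr0 //.
  have sP3 := size_lead0 sP P3.
  by apply: leq_trans (@size_mulS _ 2 2 _ _ sP3 sP3) _.
have r0 : r != 0.
  apply/eqP => r0; have := rtop; rewrite r0 coef0 => /(_ erefl) P3.
  move: cPr; rewrite r0 coprimep0 => /eqp_size.
  by rewrite size_poly1 (size_lead sP P3).
have [T [cT [vT hT] [g cg gT] Tinv]] := invariant_curve D sr r0 cPr rtop.
pose r1 := hpart T 7.
have [v1 v2] := (dd_vanish1 D, dd_vanish2 D).
have [vy vx] := (vanish_dy vT, vanish_dx vT).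
have aE : hpart w.1 4 = - ('X * P) := dd_cone D.
have vg : vanish 3 g.
  apply: (vanish_cancel vT); first by rewrite hT; exact/eqP.
  rewrite -gT; apply: vanishD; first exact: (vanishM v1 vy).
  by apply: vanishN; exact: (vanishM v2 vx).
have hv d : hpart (vf w T) d = hpart (w.1 * dy T) d - hpart (w.2 * dx T) d.
  by rewrite /vf hpartB.
(* The initial part of [v] is [- P] times the radial field, so Euler's relation in degree 6 gives
   the lowest part of the cofactor. In the next degree [- 7 P r1] meets [- 6 P r1], which leaves a
   single [P r1]. *)
have g3 : hpart g 3 = - (6 *: P).
  have := hpartM_shift0 vT vg; rewrite -gT hv.
  rewrite -[(6 + 3)%N]/(4 + 5)%N (hpartM_shift0 v1 vy) (hpartM_shift0 v2 vx).
  rewrite hpart_dy hpart_dx hT aE -/P => E.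
  have : r * (hpart g 3 + 6 *: P) = 0.
    by rewrite mulrDr -E -mul_polyC rmorph_nat; ring.
  by move/eqP; rewrite mulf_eq0 (negbTE r0) addr_eq0 => /eqP.
have E4 : P * r1 = a * r^`() - b * (r *+ 6 - 'X * r^`()) - r * hpart g 4.
  have := hpartM_shift1 vT vg; rewrite -gT hv.
  rewrite -[(6 + 3).+1]/(4 + 5).+1 (hpartM_shift1 v1 vy) (hpartM_shift1 v2 vx).
  rewrite !hpart_dy !hpart_dx hT aE g3 -/P -/a -/b -/r1 => E.
  have -> : r * hpart g 4 = - ('X * P) * r1^`() + a * r^`() - (P * (r1 *+ 7 - 'X * r1^`())
    + b * (r *+ 6 - 'X * r^`())) - r1 * - (6 *: P) by rewrite E addrK.
  by rewrite -mul_polyC rmorph_nat; ring.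
have [L sL r1E] := invariant_second_part sP sQ cPQ top sa sb erefl erefl
  (elimN eqP r0) (size_hpart T 7) (size_hpart g 4) E4.
have [U sU UE] := jac_wedge sa sb erefl sP.
(* Collects all multiples of [P] in degree 7; those of [Q] are balanced by [L2], and those of the
   Jacobian by the choice of [lam]. *)
pose h3 := lam *: (L * P) - (lam / 18) *: U - A.
have sh3 : (size h3 <= 5)%N.
  apply: size_subS => //; apply: size_subS; apply: size_scaleS => //.
  exact: (@size_mulS _ 1 3).
have [A3 [B3 [sA3 sB3 h3E]]] := euler_split sh3.
pose L2 := L - B; have sL2 : (size L2 <= 2)%N by exact: size_subS.
(* [(A2, B2)] is [lam / 3] times the Hamiltonian field [(- P_y, P_x)], which pairs with
   [x dy - y dx] to [lam P] by Euler's relation, plus [L2] times the radial field, which pairs to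
   0. *)
pose A2 := - (lam / 3) *: P^`() + L2.
pose B2 := (lam / 3) *: (P *+ 3 - 'X * P^`()) + 'X * L2.
have sA2 : (size A2 <= 3)%N.
  by apply: size_addS; [apply/size_scaleS/size_derivS|apply: leq_trans sL2 _].
have sB2 : (size B2 <= 3)%N.
  apply: size_addS; first exact/size_scaleS/size_xpart.
  by apply: (@size_mulS _ 1 1); rewrite ?size_polyX.
have [v0 h6 h7] := tang_radial_field D sA2 sB2 sA3 sB3.
apply: (@homogeneous_dicritical_from _ _ D 1 T A2 B2 A3 B3) => //.
  by move=> T0; move/eqP: r0; apply; rewrite -hT T0 raddf0.
have [mu muE] : exists mu, mu = lam / 18 by exists (lam / 18).
have lamE : lam = 18 * mu by rewrite muE; field.
have lam3 : lam / 3 = 6 * mu by rewrite muE; field.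
have cE : c = - (7 * mu) by rewrite muE /lam; field.
apply: vanishS; first apply: vanishS.
- by apply: vanishD => //; exact: vanishN.
- rewrite hpartB hT h6 /A2 /B2 lam3 /r lamE -/P -/Q.
  by rewrite -!mul_polyC !rmorphN !rmorphM /= !rmorph_nat; ring.
change (hpart (T - tang w (radial_field A2 B2 A3 B3)) 7 = 0).
rewrite hpartB h7 h3E r1E -/P -/a -/b qE /h3 /A2 /B2 lam3 -muE cE.
have jE : jac P Q = 6 *: (b * (P *+ 3 - 'X * P^`()) - a * P^`()) - P * U.
  by rewrite UE addrK.
rewrite jE /L2 /r /Q /dpart -/a -/b lamE.
by rewrite -!mul_polyC !rmorphN !rmorphM /= !rmorph_nat; ring.
Qed.

End LowMultiplicity.

(** * Multiplicity at least five *)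

Section NoInvariantCurve.
Variable K : numFieldType.

(* [r], [r1] and [r2] are the lowest homogeneous parts of [T = w(X)]; the two
   equations are the parts of degrees [2m + 2] and [2m + 3] of [v(T) = g T]. *)
Lemma no_invariant_curve m (A2 B2 A3 B3 H5 gam g1 : {poly K}) :
  (5 <= m)%N -> (size A2 <= 3)%N -> (size B2 <= 3)%N -> (size A3 <= 4)%N ->
  (size B3 <= 4)%N -> (size H5 <= 6)%N -> (size gam <= m.+1)%N -> (size g1 <= m.+2)%N ->
  let r := B2 - 'X * A2 + 'X^(m.+2) in
  let r1 := B3 - 'X * A3 + 'X^(m.+1) * B2 in
  let r2 := H5 + 'X^(m.+1) * B3 + 'X^(m.+1) in
  - r1 - 'X^(m.+1) * (r *+ m.+2 - 'X * r^`()) = r * gam ->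
  - (r2 *+ 2) - 'X^(m.+1) * (r1 *+ m.+3 - 'X * r1^`()) = r * g1 + r1 * gam ->
  False.
Proof.
move=> m5 sA2 sB2 sA3 sB3 sH5 sgam sg1 r r1 r2.
have sX n p (q : {poly K}) : (size q <= p)%N -> (size ('X^n * q)%R <= n + p)%N.
  move=> sq; apply: leq_trans (size_polyMleq _ _) _.
  by rewrite size_polyXn /= leq_add2l.
have sX1 p (q : {poly K}) : (size q <= p)%N -> (size ('X * q)%R <= p.+1)%N.
  by move/(sX 1%N).
pose h := B2 - 'X * A2; pose H4 := B3 - 'X * A3.
have sh : (size h <= 4)%N by apply: size_subS; [apply: leq_trans sB2 _|exact: sX1].
have sH4 : (size H4 <= 5)%N by apply: size_subS; [apply: leq_trans sB3 _|exact: sX1].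
have rE : r = h + 'X^(m.+2) by [].
have r1E : r1 = H4 + 'X^(m.+1) * B2 by [].
pose hx := h *+ m.+2 - 'X * h^`().
have shx : (size hx <= 4)%N.
  apply: size_subS; first by rewrite -scaler_nat size_scaleS.
  by apply: sX1; exact: size_derivS.
have rxE : r *+ m.+2 - 'X * r^`() = hx.
  rewrite rE derivD derivXn /= mulrDr mulrnDl /hx mulrnAr -exprS; ring.
rewrite rxE => E1 E2.
have sgam3 : (size gam <= 3)%N.
  apply: (@size_divS _ m.+2 2 'X^(m.+2)); first by rewrite size_polyXn.
  have -> : 'X^(m.+2) * gam = - (r1 + 'X^(m.+1) * hx + h * gam).
    transitivity (r * gam - h * gam); first by rewrite rE; ring.
    by rewrite -E1; ring.
  rewrite size_polyN; apply: size_addS; first apply: size_addS.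
  - apply: size_addS; first by apply: leq_trans sH4 _; lia.
    by apply: leq_trans (sX _ _ _ sB2) _; lia.
  - by apply: leq_trans (sX _ _ _ shx) _; lia.
  by apply: leq_trans (size_mulS sh sgam) _; lia.
have hxi i : hx`_i = h`_i *+ m.+2 - ('X * h^`())`_i by rewrite coefB coefMn.
pose W := B2 + hx + 'X * gam.
have E3 : - (H4 + h * gam) = 'X^(m.+1) * W.
  have E : - (H4 + h * gam) - 'X^(m.+1) * W = - r1 - 'X^(m.+1) * hx - r * gam.
    by rewrite r1E rE /W ['X^(m.+2)]exprS; ring.
  by apply/eqP; rewrite -subr_eq0 E E1 subrr.
have W0 : W = 0.
  (* The left side of [E3] has degree at most 5, and [m >= 5] puts ['X^(m.+1)] beyond it. *)
  apply/eqP; apply: contraT => W0; have : (size ('X^(m.+1) * W)%R <= 6)%N.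
    rewrite -E3 size_polyN; apply: size_addS; first exact: leq_trans sH4 _.
    exact: (@size_mulS _ 3 2).
  rewrite size_monicM ?monicXn // size_polyXn.
  by move: W0; rewrite -size_poly_gt0; lia.
have H4E : H4 = - (h * gam).
  by apply/eqP; rewrite -addr_eq0 -oppr_eq0 E3 W0 mulr0.
have gam2 : gam`_2 = - (h`_3 *+ (m.+2 - 3)).
  have := congr1 (fun p : {poly K} => p`_3) W0.
  rewrite /W coefD coefD hxi !coefXM coef_deriv coef0 /= [B2`_3]nth_default //.
  rewrite -mulrnBr; last by lia.
  by rewrite add0r => /eqP; rewrite addrC addr_eq0 => /eqP.
have hg5 : (h * gam)`_5 = h`_3 * gam`_2.
  rewrite coefM !big_ord_recl big_ord0 /= /bump /=.
  rewrite [gam`_5]nth_default ?[gam`_4]nth_default ?[gam`_3]nth_default ?(leq_trans sgam3) //.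
  by rewrite [h`_4]nth_default ?[h`_5]nth_default ?(leq_trans sh) //; rewrite !mulr0 !mul0r !add0r !addr0.
(* [W = 0] gives [gam_2 = - (m - 1) h_3], while the degree of [H4] gives [h_3 gam_2 = 0]. *)
have h3 : h`_3 = 0.
  have : H4`_5 = 0 by rewrite nth_default.
  rewrite H4E coefN hg5 gam2 mulrN opprK => /eqP.
  rewrite mulf_eq0 mulrn_eq0 => /or3P[/eqP //| |/eqP //].
  by rewrite subn_eq0; lia.
have {gam2}gam2 : gam`_2 = 0 by rewrite gam2 h3 mul0rn oppr0.
have {}sh : (size h <= 3)%N by exact: size_lead0.
have {sgam3}sgam2 : (size gam <= 2)%N by exact: size_lead0.
have h0B : h`_0 = B2`_0 by rewrite coefB coefXM subr0.
have B20 : B2`_0 = 0.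
  have := congr1 (fun p : {poly K} => p`_0) W0.
  rewrite /W coefD coefD hxi !coefXM coef0 /= subr0 addr0 h0B -mulrS => /eqP.
  by rewrite mulrn_eq0 => /eqP.
have H40 : H4`_0 = 0 by rewrite H4E coefN coefM big_ord_recl big_ord0 /= h0B B20 mul0r addr0 oppr0.
have B30 : B3`_0 = 0 by move: H40; rewrite coefB coefXM subr0.
pose B2x := B2 *+ 2 - 'X * B2^`().
have sB2x : (size B2x <= 2)%N by exact: size_xpart.
pose H4x := H4 *+ m.+3 - 'X * H4^`().
have sH4x : (size H4x <= 5)%N.
  apply: size_subS; first by rewrite -scaler_nat size_scaleS.
  by apply: sX1; exact: size_derivS.
have r1xE : r1 *+ m.+3 - 'X * r1^`() = H4x + 'X^(m.+1) * B2x.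
  have -> : r1^`() = H4^`() + ('X^m * B2 *+ m.+1 + 'X^(m.+1) * B2^`()).
    by rewrite r1E derivD derivM derivXn /= mulrnAl.
  have -> : 'X * (H4^`() + ('X^m * B2 *+ m.+1 + 'X^(m.+1) * B2^`())) =
     'X * H4^`() + 'X^(m.+1) * B2 *+ m.+1 + 'X^(m.+1) * ('X * B2^`()).
    by rewrite !mulrDr mulrnAr mulrA -exprS mulrCA addrA.
  rewrite r1E mulrnDl -[in ('X^(m.+1) * B2) *+ m.+3]addn2 mulrnDr /H4x /B2x; ring.
rewrite r1xE in E2.
(* The term of highest order in [E2], ['X^(2m+2)] times [B2x], can only be cancelled by [g1]; what
   remains of [g1] has degree at most 3. *)
pose G := g1 + 'X^m * B2x.
have sr1 : (size r1 <= m.+4)%N.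
  apply: size_addS; first by apply: leq_trans sH4 _; lia.
  by apply: leq_trans (sX _ _ _ sB2) _; lia.
have sG : (size G <= 4)%N.
  apply: (@size_divS _ m.+2 3 'X^(m.+2)); first by rewrite size_polyXn.
  have -> : 'X^(m.+2) * G = - (r2 *+ 2) - 'X^(m.+1) * H4x - h * g1 - r1 * gam.
    have -> : - (r2 *+ 2) - 'X^(m.+1) * H4x = r * g1 + r1 * gam + 'X^(m.+1) * ('X^(m.+1) * B2x).
      by rewrite -E2; ring.
    by rewrite rE /G !exprS; ring.
  apply: size_subS; first apply: size_subS; first apply: size_subS.
  - rewrite size_polyN -scaler_nat; apply: size_scaleS; apply: size_addS.
      apply: size_addS; first by apply: leq_trans sH5 _; lia.
      by apply: leq_trans (sX _ _ _ sB3) _; lia.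
    by rewrite size_polyXn; lia.
  - by apply: leq_trans (sX _ _ _ sH4x) _; lia.
  - by apply: leq_trans (size_mulS sh sg1) _; lia.
  by apply: leq_trans (size_mulS sr1 sgam2) _; lia.
have m6 : (6 <= m.+1)%N by lia.
have cX (p : {poly K}) : ('X^(m.+1) * p)`_m.+1 = p`_0 by rewrite coefXnM ltnn subnn.
have B2x0 : B2x`_0 = 0 by rewrite /B2x coefB coefMn coefXM B20 mul0rn subr0.
(* This 1 is the contribution of the term [x^3 y^m] of the example. In [E2] nothing else has
   [y^(m+1)], which leaves [- 2 = 0]. *)
have e1 : r2`_m.+1 = 1.
  rewrite /r2 2!coefD cX B30 coefXn eqxx [H5`_ _]nth_default ?add0r //.
  exact: leq_trans sH5 m6.
have e2 : ('X^(m.+1) * (H4x + 'X^(m.+1) * B2x))`_m.+1 = 0.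
  by rewrite cX coefD coefXnM /= addr0 /H4x coefB coefMn coefXM H40 mul0rn subr0.
have e3 : (r * g1)`_m.+1 = 0.
  have -> : r * g1 = h * G - 'X^m * (h * B2x) + 'X^(m.+2) * g1.
    by rewrite rE /G; ring.
  rewrite coefD coefB !coefXnM ltnSn ltnNge leqnSn /= subSnn addr0.
  rewrite nth_default; last by apply: leq_trans (@size_mulS _ 2 3 _ _ sh sG) _.
  rewrite coefM !big_ord_recl big_ord0 /= /bump /= B2x0 h0B B20 mul0r mulr0.
  by rewrite !addr0 subr0.
have e4 : (r1 * gam)`_m.+1 = 0.
  rewrite r1E mulrDl -mulrA coefD cX.
  rewrite nth_default; last by apply: leq_trans (@size_mulS _ 4 1 _ _ sH4 sgam2) _; apply: leq_trans m6.
  by rewrite coefM big_ord_recl big_ord0 /= B20 mul0r !addr0.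
have := congr1 (fun p : {poly K} => p`_m.+1) E2.
rewrite coefB coefN coefMn e1 e2 (coefD (r * g1)) e3 e4 subr0 addr0 => /eqP.
by rewrite oppr_eq0 pnatr_eq0.
Qed.

End NoInvariantCurve.

(** * Germs of polynomials *)

Section PolynomialGerms.
Variable K : numFieldType.
Implicit Types (F : {poly {poly K}}).

Definition germ_of_poly : {poly {poly K}} -> {fps2 K} :=
  map_fps (fps_of_poly (R := K)) \o fps_of_poly (R := {poly K}).
HB.instance Definition _ := GRing.RMorphism.copy germ_of_poly
  (map_fps (fps_of_poly (R := K)) \o fps_of_poly (R := {poly K})).

Lemma germ_of_polyE F i j : germ_of_poly F i j = F`_i`_j. Proof. by []. Qed.

Lemma germ_of_polyN (A : {poly {poly K}}) : germ_of_poly (- A) = - germ_of_poly A.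
Proof.
by apply/fpsP => i; apply/fpsP => j; rewrite !fpsN !germ_of_polyE !coefN.
Qed.

Lemma germ_of_polyX : germ_of_poly 'X = varx K.
Proof.
by apply/fpsP => -[|[|i]]; apply/fpsP => -[|[|j]]; rewrite germ_of_polyE coefX ?coef1 ?coef0.
Qed.

Lemma germ_of_polyY : germ_of_poly ('X%:P) = vary K.
Proof.
by apply/fpsP => -[|[|i]]; apply/fpsP => -[|[|j]]; rewrite germ_of_polyE coefC ?coefX ?coef0.
Qed.

Lemma germ_of_polyC t : germ_of_poly (t%:P%:P) = fconst t.
Proof.
by apply/fpsP => -[|[|i]]; apply/fpsP => -[|[|j]]; rewrite germ_of_polyE coefC ?coefC ?coef0.
Qed.

Lemma germ_of_poly_bound F : exists N, forall i j,
  (N <= i)%N \/ (N <= j)%N -> F`_i`_j = 0.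
Proof.
exists (maxn (size F) (\max_(i < size F) size (F`_i)%R)) => i j ij.
case: (leqP (size F) i) => iF; first by rewrite (nth_default _ iF) coef0.
case: ij => [|Nj]; first by rewrite geq_max leqNgt iF.
rewrite nth_default //; apply: leq_trans Nj; rewrite leq_max; apply/orP; right.
exact: (@leq_bigmax _ (fun i : 'I_(size F) => size (F`_i)%R) (Ordinal iF)).
Qed.

Lemma convergent_germ_of_poly F : convergent (germ_of_poly F).
Proof.
have [N HN] := germ_of_poly_bound F.
apply: (@convergent_fin _ _ (N + N)) => i j ij; apply: HN.
by case: (leqP N i); [left|right; lia].
Qed.

(** The partial sums are constant as soon as they contain the whole polynomial. *)
Lemma vanishes_at_germ_of_poly F x y :
  vanishes_at (germ_of_poly F) x y -> F.[x%:P].[y] = 0.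
Proof.
move=> lim0; have [N HN] := germ_of_poly_bound F; set c := F.[x%:P].[y].
have cE n : (N <= n)%N ->
    \sum_(i < n) \sum_(j < n) germ_of_poly F i j * x ^+ i * y ^+ j = c.
  move=> Nn; have sF : (size F <= n)%N.
    apply/leq_sizeP => i ni; apply/polyP => j; rewrite coef0 HN //.
    by left; apply: leq_trans ni.
  rewrite /c (horner_coef_wide _ sF) horner_sum; apply: eq_bigr => i _.
  have sFi : (size (F`_i)%R <= n)%N.
    by apply/leq_sizeP => j nj; rewrite HN //; right; apply: leq_trans nj.
  rewrite hornerM -polyC_exp hornerC (horner_coef_wide _ sFi) mulr_suml.
  by apply: eq_bigr => j _; rewrite mulrAC.
apply/eqP; apply: contraT => c0.
have cpos : 0 < `|c| by rewrite normr_gt0.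
move/cvgrPdist_lt : lim0 => /(_ _ cpos) [M _ HM].
have := HM (maxn M N) (leq_maxl _ _).
by rewrite /= cE ?leq_maxr // sub0r normrN ltxx.
Qed.

Lemma foliation_germ_of_poly (F G : {poly {poly K}}) :
  (forall x y, (x, y) <> (0, 0) -> F.[x%:P].[y] = 0 -> G.[x%:P].[y] <> 0) ->
  foliation (germ_of_poly F, germ_of_poly G).
Proof.
move=> FG; split; [exact: convergent_germ_of_poly|exact: convergent_germ_of_poly|].
exists 1 => // x y _ _ xy [] /vanishes_at_germ_of_poly F0.
by move=> /vanishes_at_germ_of_poly; exact: FG.
Qed.

End PolynomialGerms.

(** * Invariant divisors, and regularity of the example *)

Section Invariant.
Variable K : numFieldType.
Implicit Types (f g F : {fps2 K}) (w : germ2 K).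

Lemma hpart_ord F : F <> 0 -> exists2 n, hpart F n <> 0 & vanish n F.
Proof.
move=> F0; apply: fps_ord => hF; apply: F0; apply: hpart_inj.
by rewrite hF raddf0.
Qed.

(* Induction on the order avoids any appeal to factorization. *)
Lemma invariant_divisor_dvd w F : convergent w.1 -> convergent w.2 ->
  convergent F -> F <> 0 -> invariant_divisor w F -> germ_dvd F (vf w F).
Proof.
move=> cw1 cw2 cF /hpart_ord[n]; elim/ltn_ind: n F cF => n IHn F cF Fn vF inv.
have F0 : F <> 0 by move=> F0; apply: Fn; rewrite F0 raddf0.
have dvdFF : germ_dvd F F by exists 1; [exact: convergent1|rewrite mulr1].
have [[g cg Fg]|nu] := pselect (germ_unit F).
  exists (g * vf w F); last by rewrite mulrA Fg mul1r.
  by apply: convergentM => //; exact: convergent_vf.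
have [irr|] := pselect (germ_irreducible F); first by have [_] := inv F irr dvdFF.
have [[g [h [cg ch Fgh gu hu]]] _|no] := pselect (exists g h,
    [/\ convergent g, convergent h, F = g * h, ~ germ_unit g & ~ germ_unit h]); last first.
  case; split=> // g h cg ch Fgh; apply: contrapT => /not_orP[gu hu].
  by apply: no; exists g, h.
have g0 : g <> 0 by move=> g0; apply: F0; rewrite Fgh g0 mul0r.
have h0 : h <> 0 by move=> h0; apply: F0; rewrite Fgh h0 mulr0.
(* A germ of order 0 is a unit, so both factors have positive order, and each has order less than
   [n]. *)
have [[|a] ga va] := hpart_ord g0.
  case: gu; apply: convergent_inv => // g00; apply: ga.
  by apply/polyP => -[|j]; rewrite coef_hpart coef0.
have [[|b] hb vb] := hpart_ord h0.
  case: hu; apply: convergent_inv => // h00; apply: hb.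
  by apply/polyP => -[|j]; rewrite coef_hpart coef0.
have abn : (a.+1 + b.+1 <= n)%N.
  rewrite leqNgt; apply/negP => nab; apply: Fn; rewrite Fgh.
  exact: (vanishM va vb).
have invg : invariant_divisor w g.
  move=> f irf [k ck gk]; apply: inv => //; exists (k * h); first exact: convergentM.
  by rewrite Fgh gk mulrA.
have invh : invariant_divisor w h.
  move=> f irf [k ck hk]; apply: inv => //; exists (k * g); first exact: convergentM.
  by rewrite Fgh hk; ring.
have [|k ck gk] := IHn a.+1 _ g cg ga va invg; first by lia.
have [|l cl hl] := IHn b.+1 _ h ch hb vb invh; first by lia.
exists (k + l); first exact: convergentD.
by rewrite Fgh vfM gk hl; ring.
Qed.

Lemma hpart_mono a b d :
  hpart (varx K ^+ a * vary K ^+ b) d = if d == (a + b)%N then 'X^b else 0.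
Proof. by have := hpart_monomial K d (leq_addl a b); rewrite addnK. Qed.

(* Its multiplicity is [m.+1]. *)
Definition example_form m : germ2 K :=
  (- (varx K ^+ m * vary K),
   varx K ^+ m.+1 + vary K ^+ m.+2 + varx K ^+ 3 * vary K ^+ m.+1).

Lemma example_germ_of_poly m : example_form m =
  (germ_of_poly (- ('X^m * 'X%:P)),
   germ_of_poly ('X^(m.+1) + 'X%:P ^+ m.+2 + 'X^3 * 'X%:P ^+ m.+1)).
Proof.
have XE n : germ_of_poly ('X^n) = varx K ^+ n by rewrite rmorphXn /= germ_of_polyX.
have YE n : germ_of_poly ('X%:P ^+ n) = vary K ^+ n by rewrite rmorphXn /= germ_of_polyY.
have ME a b : germ_of_poly ('X^a * 'X%:P ^+ b) = varx K ^+ a * vary K ^+ b.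
  by rewrite rmorphM /= XE YE.
have M1 : germ_of_poly ('X^m * 'X%:P) = varx K ^+ m * vary K by rewrite rmorphM /= XE germ_of_polyY.
have D3 A B C : germ_of_poly (A + B + C) = germ_of_poly A + germ_of_poly B + germ_of_poly C.
  by rewrite rmorphD rmorphD.
by rewrite /example_form germ_of_polyN M1 D3 (XE m.+1) (YE m.+2) (ME 3 m.+1).
Qed.

Lemma hpart_example1 m d :
  hpart (example_form m).1 d = if d == m.+1 then - 'X else 0.
Proof.
have := hpart_mono m 1 d; rewrite expr1 addn1 => E.
by rewrite /example_form raddfN fpsN E; case: ifP; rewrite ?expr1 ?oppr0.
Qed.

Lemma hpart_example2 m d : hpart (example_form m).2 d =
  (if d == m.+1 then 1 else 0) + (if d == m.+2 then 'X^(m.+2) else 0)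
  + (if d == m.+4 then 'X^(m.+1) else 0).
Proof.
have E1 := hpart_mono m.+1 0 d; have E2 := hpart_mono 0 m.+2 d.
have E3 := hpart_mono 3 m.+1 d.
rewrite expr0 mulr1 addn0 in E1; rewrite expr0 mul1r add0n in E2.
have D3 A B C : hpart (A + B + C) = hpart A + hpart B + hpart C :> fps {poly K}.
  by rewrite raddfD raddfD.
exact: etrans (congr1 (fun F : fps {poly K} => F d) (D3 _ _ _))
  (congr2 +%R (congr2 +%R E1 E2) E3).
Qed.

Lemma foliation_example m : foliation (example_form m).
Proof.
rewrite example_germ_of_poly; apply: foliation_germ_of_poly => x y xy.
rewrite !(hornerXn, horner_exp, hornerN, hornerD, hornerM, hornerC, hornerX) => /eqP.
rewrite oppr_eq0 mulf_eq0 expf_eq0 => /orP[/andP[_ /eqP x0]|/eqP y0].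
  rewrite x0 !expr0n /= add0r mul0r addr0 => /eqP; rewrite expf_eq0 /= => /eqP y0.
  by apply: xy; rewrite x0 y0.
rewrite y0 !expr0n /= mulr0 !addr0 => /eqP; rewrite expf_eq0 /= => /eqP x0.
by apply: xy; rewrite x0 y0.
Qed.

Lemma multiplicity_example m : multiplicity (example_form m) m.+1.
Proof.
split=> [i j ij|].
  by rewrite !hpartE hpart_example1 hpart_example2 !ltn_eqF ?addr0 ?coef0 //; lia.
exists m.+1, 0%N; rewrite addn0; split=> //; right.
rewrite hpartE addn0 hpart_example2 eqxx !ltn_eqF ?addr0 ?coef1 //; try lia.
by apply/eqP; exact: oner_neq0.
Qed.

Lemma tau_mono t a b : tau t (varx K ^+ a * vary K ^+ b) =
  varx K ^+ (a + b) * (fconst t + vary K) ^+ b.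
Proof. by rewrite rmorphM !rmorphXn /= tau_varx tau_vary exprMn mulrA -exprD. Qed.

Lemma swap_mono a b :
  swap (varx K ^+ a * vary K ^+ b) = varx K ^+ b * vary K ^+ a.
Proof. by rewrite rmorphM !rmorphXn /= swap_varx swap_vary mulrC. Qed.

Lemma example_formE m : example_form m = (- (varx K ^+ m * vary K ^+ 1),
  varx K ^+ m.+1 * vary K ^+ 0 + varx K ^+ 0 * vary K ^+ m.+2
   + varx K ^+ 3 * vary K ^+ m.+1).
Proof. by rewrite /example_form expr1 !expr0 mulr1 mul1r. Qed.

Lemma mono3_morph (phi : {rmorphism {fps2 K} -> {fps2 K}}) f g F :
  phi (f + g + F) = phi f + phi g + phi F.
Proof. by rewrite rmorphD rmorphD. Qed.

Lemma tau_example t m (Y := fconst t + vary K) :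
  tau t (example_form m).1 = - (varx K ^+ m.+1 * Y) /\
  tau t (example_form m).2 =
    varx K ^+ m.+1 + varx K ^+ m.+2 * Y ^+ m.+2 + varx K ^+ m.+4 * Y ^+ m.+1.
Proof.
rewrite example_formE; split.
  have E := tau_mono t m 1; rewrite addn1 expr1 in E.
  by rewrite [_.1]/= rmorphN expr1; congr (- _).
rewrite [_.2]/= mono3_morph.
have E1 : tau t (varx K ^+ m.+1 * vary K ^+ 0) = varx K ^+ m.+1.
  by rewrite tau_mono addn0 expr0 mulr1.
have E2 := tau_mono t 0 m.+2; have E3 := tau_mono t 3 m.+1; rewrite add0n in E2.
exact: (congr2 +%R (congr2 +%R E1 E2) E3).
Qed.

Lemma tau_swap_example t m (Y := fconst t + vary K) :
  tau t (swap (example_form m).1) = - (varx K ^+ m.+1 * Y ^+ m) /\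
  tau t (swap (example_form m).2) =
    varx K ^+ m.+1 * Y ^+ m.+1 + varx K ^+ m.+2 + varx K ^+ m.+4 * Y ^+ 3.
Proof.
rewrite example_formE; split.
  have E := tau_mono t 1 m; rewrite add1n in E.
  by rewrite [_.1]/= [swap _]rmorphN rmorphN /= swap_mono E.
rewrite [_.2]/= [swap _]mono3_morph mono3_morph /= !swap_mono.
have E2 : tau t (varx K ^+ m.+2 * vary K ^+ 0) = varx K ^+ m.+2.
  by rewrite tau_mono addn0 expr0 mulr1.
have E1 := tau_mono t 0 m.+1; have E3 := tau_mono t m.+1 3.
rewrite add0n in E1; rewrite addn3 in E3.
exact: (congr2 +%R (congr2 +%R E1 E2) E3).
Qed.

Lemma germ_of_poly_mono t a b :
  germ_of_poly ('X^a * (t%:P%:P + 'X%:P) ^+ b) =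
  varx K ^+ a * (fconst t + vary K) ^+ b.
Proof.
rewrite rmorphM !rmorphXn rmorphD /=.
by rewrite germ_of_polyX germ_of_polyC germ_of_polyY.
Qed.

Lemma regular_example m : (0 < m)%N -> regular_after_blowup (example_form m).
Proof.
move=> m0; split=> [t|].
  pose Y : {poly {poly K}} := t%:P%:P + 'X%:P.
  pose Z := fconst t + vary K.
  have EF : germ_of_poly ('X^0 * Y ^+ m.+3 + 'X^2 * Y ^+ m.+2) = Z ^+ m.+3 + varx K ^+ 2 * Z ^+ m.+2.
    by rewrite rmorphD /= !germ_of_poly_mono expr0 mul1r.
  have EG : germ_of_poly (1 + 'X^1 * Y ^+ m.+2 + 'X^3 * Y ^+ m.+1) =
      1 + varx K * Z ^+ m.+2 + varx K ^+ 3 * Z ^+ m.+1.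
    by rewrite rmorphD rmorphD rmorph1 /= !germ_of_poly_mono expr1.
  exists (germ_of_poly ('X^0 * Y ^+ m.+3 + 'X^2 * Y ^+ m.+2),
          germ_of_poly (1 + 'X^1 * Y ^+ m.+2 + 'X^3 * Y ^+ m.+1)).
    split.
      apply: foliation_germ_of_poly => x y _; rewrite /Y.
      rewrite !(hornerXn, horner_exp, hornerD, hornerM, hornerC, hornerX) => E.
      have : (t + y) ^+ m.+2 * (t + y + x ^+ 2) = 0.
        by rewrite -E [in RHS]exprS expr0; ring.
      move/eqP; rewrite mulf_eq0 => H.
      (* In this form the second component is 1 wherever [t + y] or [t + y + x^2] vanishes, that is,
         at every zero of the first. *)
      have -> : 1 + x ^+ 1 * (t + y) ^+ m.+2 + x ^+ 3 * (t + y) ^+ m.+1 =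
          1 + x * (t + y) ^+ m.+1 * (t + y + x ^+ 2) by rewrite [(t + y) ^+ m.+2]exprS; ring.
      case/orP: H => [|/eqP ->]; last by rewrite mulr0 addr0; apply/eqP; exact: oner_neq0.
      rewrite expf_eq0 /= => /eqP ->.
      by rewrite expr0n mulr0 mul0r addr0; apply/eqP; exact: oner_neq0.
    exists m.+2; rewrite EF EG pullback_fin.
    have [-> ->] := tau_example t m; rewrite -/Z [_.1]/= [_.2]/=.
    by congr (_, _); rewrite !exprS; ring.
  right; rewrite [_.2]/= EG -[in _ ^+ 3](expr1 (varx K)).
  have -> : 1 + varx K * Z ^+ m.+2 + (varx K ^+ 1) ^+ 3 * Z ^+ m.+1 =
     1 + varx K * (Z ^+ m.+2 + varx K ^+ 2 * Z ^+ m.+1) by rewrite expr1; ring.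
  rewrite !fpsD varxM_eq0_coef addr0; apply/eqP; exact: oner_neq0.
apply/regular_at_inf; pose Z : {fps2 K} := fconst 0 + vary K.
have [Y YE] : exists Y : {poly {poly K}}, Y = 0%:P%:P + 'X%:P by eexists.
have YZ n : germ_of_poly (Y ^+ n) = Z ^+ n.
  by rewrite rmorphXn YE rmorphD /= germ_of_polyC germ_of_polyY.
have EF : germ_of_poly (1 + 'X^2 * Y ^+ 3) = 1 + varx K ^+ 2 * Z ^+ 3.
  have MF A B : germ_of_poly (1 + A * B) = 1 + germ_of_poly A * germ_of_poly B.
    by rewrite rmorphD rmorph1 rmorphM.
  have XE n : germ_of_poly 'X^n = varx K ^+ n by rewrite rmorphXn /= germ_of_polyX.
  by rewrite MF YZ XE.
have EG : germ_of_poly (- Y ^+ m) = - Z ^+ m by rewrite germ_of_polyN YZ.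
(* Since [m > 0], the second component vanishes only for [Y = 0], where the first is 1. *)
exists (germ_of_poly (1 + 'X^2 * Y ^+ 3), germ_of_poly (- Y ^+ m)).
  split.
    apply: foliation_germ_of_poly => x y _; rewrite YE.
    rewrite !(hornerXn, horner_exp, hornerN, hornerD, hornerM, hornerC, hornerX) add0r => E /eqP.
    rewrite oppr_eq0 expf_eq0 m0 /= => /eqP y0; move: E; rewrite y0 expr0n mulr0 addr0.
    by apply/eqP; exact: oner_neq0.
  exists m.+2; rewrite EF EG pullback_fin [(swapg _).1]/= [(swapg _).2]/=.
  have [-> ->] := tau_swap_example 0 m; rewrite -/Z [_.1]/= [_.2]/=.
  by congr (_, _); rewrite !exprS; ring.
left; rewrite [_.1]/= EF.
have -> : 1 + varx K ^+ 2 * Z ^+ 3 = 1 + varx K * (varx K * Z ^+ 3) by ring.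
rewrite !fpsD varxM_eq0_coef addr0; apply/eqP; exact: oner_neq0.
Qed.

End Invariant.

(** * The example is not homogeneous dicritical *)

Section Example.
Variable K : numClosedFieldType.

Lemma hpart_radial (X : germ2 K) : radial X ->
  [/\ vanish 1 X.1, vanish 1 X.2, hpart X.1 1 = 1 & hpart X.2 1 = 'X].
Proof.
move=> [_ _ rX]; split.
- by move=> [|//] _; apply/polyP => -[|j]; rewrite coef_hpart coef0 //= (rX 0%N 0%N _).1.
- by move=> [|//] _; apply/polyP => -[|j]; rewrite coef_hpart coef0 //= (rX 0%N 0%N _).2.
- apply/polyP => -[|[|j]]; rewrite coef_hpart coef1 //=.
    by rewrite (rX 1%N 0%N _).1.
  by rewrite (rX 0%N 1%N _).1.
apply/polyP => -[|[|j]]; rewrite coef_hpart coefX //=.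
  by rewrite (rX 1%N 0%N _).2.
by rewrite (rX 0%N 1%N _).2.
Qed.

Lemma not_homogeneous_dicritical_example m : (4 <= m)%N ->
  ~ homogeneous_dicritical (example_form K m).
Proof.
move=> m4 [reg [X [radX T0 inv]]]; set w := example_form K m in reg T0 inv.
have [cX1 cX2 _] := radX; have [v1 v2 h11 h12] := hpart_radial radX.
have [m' [mE] D] := regular_dicritical_data (foliation_example K m)
  (multiplicity_example K m) reg.
rewrite -{m'}mE in D; have [cw1 cw2] := (dd_conv1 D, dd_conv2 D).
have [w1 w2] := (dd_vanish1 D, dd_vanish2 D).
rewrite -/w in w1 w2 cw1 cw2.
pose T := tang w X.
have cT : convergent T by apply: convergentD; exact: convergentM.
have [g cg gT] := invariant_divisor_dvd cw1 cw2 cT T0 inv.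
have a0 : hpart w.1 m.+1 = - 'X by rewrite hpart_example1 eqxx.
have lt1 : (m.+1 < m.+2)%N by []. have lt2 : (m.+2 < m.+3)%N by [].
have lt3 : (m.+3 < m.+4)%N by []. have lt13 := ltn_trans lt1 lt2.
have lt24 := ltn_trans lt2 lt3; have lt14 := ltn_trans lt1 lt24.
have a1 : hpart w.1 m.+2 = 0 by rewrite hpart_example1 (gtn_eqF lt1).
have a2 : hpart w.1 m.+3 = 0 by rewrite hpart_example1 (gtn_eqF lt13).
have a3 : hpart w.1 m.+4 = 0 by rewrite hpart_example1 (gtn_eqF lt14).
have b0 : hpart w.2 m.+1 = 1.
  by rewrite hpart_example2 eqxx (ltn_eqF lt1) (ltn_eqF lt14) !addr0.
have b1 : hpart w.2 m.+2 = 'X^(m.+2).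
  by rewrite hpart_example2 eqxx (gtn_eqF lt1) (ltn_eqF lt24) addr0 add0r.
have b2 : hpart w.2 m.+3 = 0.
  by rewrite hpart_example2 (gtn_eqF lt13) (gtn_eqF lt2) (ltn_eqF lt3) !addr0.
have b3 : hpart w.2 m.+4 = 'X^(m.+1).
  by rewrite hpart_example2 eqxx (gtn_eqF lt14) (gtn_eqF lt24) !add0r.
pose A2 := hpart X.1 2; pose B2 := hpart X.2 2.
pose A3 := hpart X.1 3; pose B3 := hpart X.2 3.
pose H5 := hpart X.2 4 - 'X * hpart X.1 4.
have sX p (q : {poly K}) : (size q <= p)%N -> (size ('X * q)%R <= p.+1)%N.
  move=> sq; apply: leq_trans (size_polyMleq _ _) _.
  by rewrite size_polyX.
have sA2 : (size A2 <= 3)%N := size_hpart _ _.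
have sB2 : (size B2 <= 3)%N := size_hpart _ _.
have sA3 : (size A3 <= 4)%N := size_hpart _ _.
have sB3 : (size B3 <= 4)%N := size_hpart _ _.
have sH5 : (size H5 <= 6)%N.
  by apply: size_subS; [apply: leq_trans (size_hpart _ _) _|apply/sX/size_hpart].
have mE3 : m.+3 = (m.+1 + 1).+1 by rewrite addn1.
have vT : vanish m.+3 T.
  rewrite mE3; apply: vanishS; first exact: tang_vanish D _ _ v1 v2.
  by rewrite (tang_hpart0 D v1 v2) h11 h12 mulr1 subrr mulr0.
have T1 : hpart T m.+3 = B2 - 'X * A2 + 'X^(m.+3).
  rewrite mE3 (hpartD_eq (hpartM_shift1 w1 v1) (hpartM_shift1 w2 v2)).
  by rewrite -addnS addn2 a0 a1 b0 b1 h11 h12 -/A2 -/B2 [in RHS]exprSr; ring.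
have T2 : hpart T m.+4 = B3 - 'X * A3 + 'X^(m.+2) * B2.
  rewrite mE3 (hpartD_eq (hpartM_shift2 w1 v1) (hpartM_shift2 w2 v2)).
  by rewrite a0 a1 a2 b0 b1 b2 -/A3 -/B3 -/B2; ring.
have T3 : hpart T m.+4.+1 = H5 + 'X^(m.+2) * B3 + 'X^(m.+2).
  rewrite mE3 (hpartD_eq (hpartM_shift3 w1 v1) (hpartM_shift3 w2 v2)).
  by rewrite a0 a1 a2 a3 b0 b1 b2 b3 h12 -/B3 /H5 ['X^(m.+2)]exprSr; ring.
pose r := hpart T m.+3; pose r1 := hpart T m.+4; pose r2 := hpart T m.+4.+1.
have r0 : r <> 0.
  move=> r0; have : r`_m.+3 = 0 by rewrite r0 coef0.
  rewrite /r T1 coefD coefXn eqxx nth_default => [/eqP|]; first by rewrite add0r oner_eq0.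
  apply: (@leq_trans 4); last by lia.
  by apply: size_subS; [apply: leq_trans sB2 _|exact: sX].
have [vy vx] := (vanish_dy vT, vanish_dx vT).
have nE : (m.+3 + m = m.+1 + m.+2)%N by lia.
have vg : vanish m g.
  apply: (vanish_cancel vT r0); rewrite -gT nE; apply: vanishD; first exact: vanishM.
  by apply: vanishN; exact: vanishM.
have hv d : hpart (vf w T) d = hpart (w.1 * dy T) d - hpart (w.2 * dx T) d.
  by rewrite /vf hpartB.
(* An opaque name for the degree of [r] lets [ring] treat the Euler factors of [r], [r1] and [r2] as
   [c], [c + 1] and [c + 2]. *)
have [c cE] : exists c : {poly K}, c = m.+3%:R by eexists.
have n3 (p : {poly K}) : p *+ m.+3 = p * c by rewrite cE mulr_natr.
have n4 (p : {poly K}) : p *+ m.+4 = p * c + p by rewrite mulrSr n3.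
have n5 (p : {poly K}) : p *+ m.+4.+1 = p * c + p *+ 2 by rewrite mulrSr n4 -addrA.
(* Euler's relation again: the initial part of [v] is minus the radial field times a power of [x],
   which is 1 at [x = 1]. *)
have g0 : hpart g m = - c.
  have := hpartM_shift0 vT vg; rewrite -gT hv nE.
  rewrite (hpartM_shift0 w1 vy) (hpartM_shift0 w2 vx) hpart_dy hpart_dx.
  rewrite a0 b0 -/r n3 => E; have : r * (hpart g m + c) = 0 by rewrite mulrDr -E; ring.
  by case/poly_nzd => [/r0 //|/eqP]; rewrite addr_eq0 => /eqP.
have E1 : - r1 - 'X^(m.+2) * (r *+ m.+3 - 'X * r^`()) = r * hpart g m.+1.
  have := hpartM_shift1 vT vg; rewrite -gT hv nE.
  rewrite (hpartM_shift1 w1 vy) (hpartM_shift1 w2 vx) !hpart_dy !hpart_dx.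
  rewrite a0 a1 b0 b1 g0 -/r -/r1 n3 n4 => E.
  have -> : r * hpart g m.+1 = (r * hpart g m.+1 + r1 * - c) + r1 * c by ring.
  by rewrite -E; ring.
have E2 : - (r2 *+ 2) - 'X^(m.+2) * (r1 *+ m.+4 - 'X * r1^`()) =
    r * hpart g m.+2 + r1 * hpart g m.+1.
  have := hpartM_shift2 vT vg; rewrite -gT hv nE.
  rewrite (hpartM_shift2 w1 vy) (hpartM_shift2 w2 vx) !hpart_dy !hpart_dx.
  rewrite a0 a1 a2 b0 b1 b2 g0 -/r -/r1 -/r2 n4 n5 => E.
  have -> : r * hpart g m.+2 + r1 * hpart g m.+1 =
    (r * hpart g m.+2 + r1 * hpart g m.+1 + r2 * - c) + r2 * c by ring.
  by rewrite -E; ring.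
rewrite /r /r1 /r2 T1 T2 T3 in E1 E2.
exact: (@no_invariant_curve K m.+1 A2 B2 A3 B3 H5 (hpart g m.+1) (hpart g m.+2)
  _ sA2 sB2 sA3 sB3 sH5 (size_hpart _ _) (size_hpart _ _) E1 E2).
Qed.

End Example.

Theorem theorem1 (R : realType) :
  (forall w : germ2 R[i],
     foliation w ->
     (exists2 m : nat, (m <= 4)%N & multiplicity w m) ->
     regular_after_blowup w ->
     homogeneous_dicritical w) /\
  (forall m : nat, (5 <= m)%N ->
     exists w : germ2 R[i],
       [/\ foliation w, multiplicity w m, regular_after_blowup w &
           ~ homogeneous_dicritical w]).
Proof.
split=> [w fw [m m4 wm] reg|[//|m] m5].
  have [m' mE D] := regular_dicritical_data fw wm reg.
  have [m3|] := leqP m' 2; first exact: homogeneous_dicritical_le3 D m3 reg.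
  move=> m3; have m'3 : m' = 3%N by lia.
  by rewrite m'3 in D; exact: homogeneous_dicritical_4 D reg.
exists (example_form R[i] m); split.
- exact: foliation_example.
- exact: multiplicity_example.
- by apply: regular_example; lia.
exact: not_homogeneous_dicritical_example.
Qed.
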